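(* For all integers $n\ge 230$, $$q(n-1)q(n+3)-4q(n)q(n+2)+3q(n+1)^2>0,$$ i.e. $A(q(n-1),q(n),q(n+1),q(n+2),q(n+3))>0$ where $A(a_0,a_1,a_2,a_3,a_4)=a_0a_4-4a_1a_3+3a_2^2$.
   Context: $q(n)$ denotes the number of partitions of $n$ into distinct parts. *)

(* Defs.v *)
From mathcomp Require Import all_boot all_order all_algebra.

Set Implicit Arguments.
Unset Strict Implicit.
Unset Printing Implicit Defensive.

Import Order.TTheory GRing.Theory Num.Theory.

(* A partition of n into distinct parts is a finite set of positive integers
   with sum n; such parts are at most n, hence live in 'I_n.+1. *)
Definition distinct_partitions (n : nat) : {set {set 'I_n.+1}} :=
  [set P : {set 'I_n.+1} | (ord0 \notin P) && (\sum_(i in P) i == n)%N].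

Definition q (n : nat) : nat := #|distinct_partitions n|.

Local Open Scope ring_scope.

Definition A (a0 a1 a2 a3 a4 : int) : int :=
  a0 * a4 - 4 * a1 * a3 + 3 * a2 ^+ 2.

(* Main.v *)
(** The form [A] is a transvectant: writing [q m], up to a common factor, as the
    Fourier coefficient of [prod_k (1 + e^(-t k) e^(i k h))], the five coefficients
    around [m = n + 1] turn [A] into a double integral against
    [8 sin^4 ((h - h') / 2)], so that the Gaussian part of the integrand already
    gives a positive main term and no precise asymptotics of [q] are needed.

    The saddle point [t] is the one for which the tilted mean [sum k r_k / (1 + r_k)],
    [r_k = e^(-t k)], equals [m].  With [f e^(i psi)] the normalised product and
    [U_j = int f cos psi (1 - cos h)^j], [W1 = int f sin psi sin h],
    [W2 = int f sin psi sin h (1 - cos h)], the form is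
    [4 U0 U2 + 12 U1^2 - 16 U1 U2 + 4 U2^2 + 8 W1 W2 - 4 W2^2].  Near [h = 0] the phase
    [psi] is cubic and the moments of [f] satisfy the Gaussian recursion up to a small
    loss (integration by parts), so [U0 U2] dominates; away from [0] the function [f]
    is exponentially small because [r / (1 + r)^2 >= r - 2 r^2 + (5/4) r^3] reduces
    [- ln f] to geometric sums.  This settles [m >= 11000]; smaller values are
    computed exactly. *)

From Stdlib Require Import Reals Lra Lia ZArith NArith List.
From Coquelicot Require Import Coquelicot.
Import ListNotations.

Open Scope R_scope.

(** The obstacle is uniformity in [m] by elementary means. The product is cut at a finite [K],
    chosen after [m] so that all truncation errors stay below [rem <= 1/1000]; no infinite product
    or limit occurs. With [u = 1/t], cumulants are bounded by rational multiples of powers of [u],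
    because the rational functions of [r_k] are replaced by polynomials whose sums are geometric.
    After division by [N0 * N4], moments of [f] on [[0, 2t/5]], each error is a small constant or a
    multiple of a positive power of [t], so the worst case is [u = 115]; the tilted mean there,
    about [115^2 pi^2/12], is below [11000]. [U1] enters only through a completed square: the form
    is [12 (U1 - 2 U2/3)^2 + 4 U2 (U0 - U2/3)] plus the terms in [W1] and [W2]. For small [m] the
    table rests on conjugation: partitions into distinct parts correspond to partitions whose part
    sizes fill an interval [1, .., M]. Removing a smallest part gives a recurrence by additions,
    needing about [sqrt(2 m)] passes. *)

Fixpoint sum1 (g : nat -> R) (K : nat) : R :=
  match K with O => 0 | S k => sum1 g k + g (S k) end.

Lemma sum1_ext (g h : nat -> R) (K : nat) :
  (forall k, (1 <= k)%nat -> g k = h k) -> sum1 g K = sum1 h K.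
Proof.
intros E; induction K as [|K IH]; simpl; trivial.
rewrite IH, E; [reflexivity | lia].
Qed.

Lemma sum1_le (g h : nat -> R) (K : nat) :
  (forall k, (1 <= k)%nat -> g k <= h k) -> sum1 g K <= sum1 h K.
Proof.
intros E; induction K as [|K IH]; simpl; [lra|].
assert (E1 := E (S K) ltac:(lia)); lra.
Qed.

Lemma sum1_plus (g h : nat -> R) (K : nat) :
  sum1 (fun k => g k + h k) K = sum1 g K + sum1 h K.
Proof. induction K as [|K IH]; simpl; [lra|]; rewrite IH; ring. Qed.

Lemma sum1_scal (c : R) (g : nat -> R) (K : nat) :
  sum1 (fun k => c * g k) K = c * sum1 g K.
Proof. induction K as [|K IH]; simpl; [lra|]; rewrite IH; ring. Qed.

Lemma sum1_nonneg (g : nat -> R) (K : nat) :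
  (forall k, (1 <= k)%nat -> 0 <= g k) -> 0 <= sum1 g K.
Proof.
intros E; induction K as [|K IH]; simpl; [lra|].
assert (E1 := E (S K) ltac:(lia)); lra.
Qed.

Lemma sum1_le_length (g : nat -> R) (K L : nat) :
  (forall k, (1 <= k)%nat -> 0 <= g k) -> (K <= L)%nat -> sum1 g K <= sum1 g L.
Proof.
intros E H; induction H as [|L H IH]; [lra|simpl].
assert (E1 := E (S L) ltac:(lia)); lra.
Qed.

Lemma is_derive_sum1 (g : nat -> R -> R) (d : nat -> R) (K : nat) (x : R) :
  (forall k, (1 <= k)%nat -> is_derive (g k) x (d k)) ->
  is_derive (fun u => sum1 (fun k => g k u) K) x (sum1 d K).
Proof.
intros E; induction K as [|K IH]; simpl.
- apply (is_derive_const (V := R_NormedModule)).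
- apply (is_derive_plus (V := R_NormedModule)); [exact IH|apply E; lia].
Qed.

Lemma continuous_sum1 (g : nat -> R -> R) (K : nat) (x : R) :
  (forall k, (1 <= k)%nat -> continuous (g k) x) ->
  continuous (fun u => sum1 (fun k => g k u) K) x.
Proof.
intros E; induction K as [|K IH]; simpl.
- apply continuous_const.
- apply (continuous_plus (V := R_NormedModule)); [exact IH|apply E; lia].
Qed.

(** * Power sums *)

(** [geo0] to [geo4] are the infinite sums of [k^p z^k] over [k >= 1] for [p = 0, .., 4]; their
    numerators are Eulerian polynomials. *)
Definition geo0 (z : R) := z / (1 - z).
Definition geo1 (z : R) := z / (1 - z) ^ 2.
Definition geo2 (z : R) := z * (1 + z) / (1 - z) ^ 3.
Definition geo3 (z : R) := z * (1 + 4 * z + z ^ 2) / (1 - z) ^ 4.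
Definition geo4 (z : R) := z * (1 + 11 * z + 11 * z ^ 2 + z ^ 3) / (1 - z) ^ 5.

Lemma geo_bounds (z : R) : 0 < z < 1 ->
  (0 <= geo0 z <= 24 / (1 - z) ^ 5) /\ (0 <= geo1 z <= 24 / (1 - z) ^ 5) /\
  (0 <= geo2 z <= 24 / (1 - z) ^ 5) /\ (0 <= geo3 z <= 24 / (1 - z) ^ 5) /\ 0 <= geo4 z.
Proof.
intros Hz.
assert (P : forall n, 0 < (1 - z) ^ n <= 1).
{ induction n as [|n IH]; simpl; [lra|]; split; [nra|nra]. }
assert (X : forall p n, 0 <= p <= 24 -> (n <= 5)%nat -> 0 <= p / (1 - z) ^ n <= 24 / (1 - z) ^ 5).
{ intros p n Hp Hn.
  replace (p / (1 - z) ^ n) with ((p * (1 - z) ^ (5 - n)) / (1 - z) ^ 5).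
  2:{ replace ((1 - z) ^ 5) with ((1 - z) ^ n * (1 - z) ^ (5 - n)).
      2:{ rewrite <- pow_add; f_equal; lia. }
      field; split; apply Rgt_not_eq; apply P. }
  assert (Q := P (5 - n)%nat); assert (Q5 := P 5%nat).
  split.
  - apply Rmult_le_pos; [nra|]. apply Rlt_le, Rinv_0_lt_compat; lra.
  - apply Rmult_le_compat_r; [apply Rlt_le, Rinv_0_lt_compat; lra|nra]. }
unfold geo0, geo1, geo2, geo3, geo4.
assert (z ^ 2 <= 1) by nra. assert (z ^ 3 <= 1) by nra.
assert (0 <= z ^ 2) by nra. assert (0 <= z ^ 3) by nra.
repeat split.
- replace (z / (1 - z)) with (z / (1 - z) ^ 1) by (rewrite pow_1; reflexivity). apply X; [lra|lia].
- replace (z / (1 - z)) with (z / (1 - z) ^ 1) by (rewrite pow_1; reflexivity). apply X; [lra|lia].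
- apply X; [lra|lia].
- apply X; [lra|lia].
- apply X; [nra|lia].
- apply X; [nra|lia].
- apply X; [nra|lia].
- apply X; [nra|lia].
- apply X; [nra|lia].
Qed.

(** In this lemma and the next four, the subtracted term is the tail [z^K] times the sum of
    [(K + k)^p z^k], expanded by the binomial theorem. *)
Lemma sum_pow0 (z : R) (K : nat) : z <> 1 ->
  sum1 (fun k => z ^ k) K = geo0 z - z ^ K * geo0 z.
Proof.
intros Hz; unfold geo0; induction K as [|K IH]; cbn [sum1]; [simpl; field; lra|].
rewrite IH; simpl pow; field; lra.
Qed.

Lemma sum_pow1 (z : R) (K : nat) : z <> 1 ->
  sum1 (fun k => INR k * z ^ k) K = geo1 z - z ^ K * (INR K * geo0 z + geo1 z).
Proof.
intros Hz; unfold geo0, geo1; induction K as [|K IH]; cbn [sum1]; [simpl; field; lra|].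
rewrite IH, S_INR; simpl pow; field; lra.
Qed.

Lemma sum_pow2 (z : R) (K : nat) : z <> 1 ->
  sum1 (fun k => INR k ^ 2 * z ^ k) K =
  geo2 z - z ^ K * (INR K ^ 2 * geo0 z + 2 * INR K * geo1 z + geo2 z).
Proof.
intros Hz; unfold geo0, geo1, geo2; induction K as [|K IH]; cbn [sum1]; [simpl; field; lra|].
rewrite IH, S_INR; simpl pow; field; lra.
Qed.

Lemma sum_pow3 (z : R) (K : nat) : z <> 1 ->
  sum1 (fun k => INR k ^ 3 * z ^ k) K =
  geo3 z - z ^ K * (INR K ^ 3 * geo0 z + 3 * INR K ^ 2 * geo1 z + 3 * INR K * geo2 z + geo3 z).
Proof.
intros Hz; unfold geo0, geo1, geo2, geo3; induction K as [|K IH]; cbn [sum1]; [simpl; field; lra|].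
rewrite IH, S_INR; simpl pow; field; lra.
Qed.

Lemma sum_pow4 (z : R) (K : nat) : z <> 1 ->
  sum1 (fun k => INR k ^ 4 * z ^ k) K =
  geo4 z - z ^ K * (INR K ^ 4 * geo0 z + 4 * INR K ^ 3 * geo1 z + 6 * INR K ^ 2 * geo2 z
                  + 4 * INR K * geo3 z + geo4 z).
Proof.
intros Hz; unfold geo0, geo1, geo2, geo3, geo4; induction K as [|K IH]; cbn [sum1]; [simpl; field; lra|].
rewrite IH, S_INR; simpl pow; field; lra.
Qed.

(* Dominates the tails after [K] of the power sums and of the cosine sums. *)
Definition rem (z : R) (K : nat) := z ^ K * (INR K + 1) ^ 3 * (24 / (1 - z) ^ 5).

(** With all [geo_p] below a common [C], the binomial tails for [p <= 3] are at most
    [z^K C (K + 1)^3]. For [p = 4] only an upper bound is wanted, and the tail is dropped. *)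
Lemma sum_pow_bounds (z : R) (K : nat) : 0 < z < 1 ->
  (geo1 z - rem z K <= sum1 (fun k => INR k * z ^ k) K <= geo1 z) /\
  (geo2 z - rem z K <= sum1 (fun k => INR k ^ 2 * z ^ k) K <= geo2 z) /\
  (geo3 z - rem z K <= sum1 (fun k => INR k ^ 3 * z ^ k) K <= geo3 z) /\
  sum1 (fun k => INR k ^ 4 * z ^ k) K <= geo4 z.
Proof.
intros Hz.
destruct (geo_bounds z Hz) as (H0 & H1 & H2 & H3 & H4).
assert (0 < z ^ K) by (apply pow_lt; lra).
assert (HK : 0 <= INR K) by apply pos_INR.
rewrite sum_pow1, sum_pow2, sum_pow3, sum_pow4 by lra.
unfold rem. set (C := 24 / (1 - z) ^ 5) in *. set (k := INR K) in *.
set (w := z ^ K) in *.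
assert (0 <= k * k) by nra. assert (0 <= k ^ 2) by (simpl; nra).
assert (0 <= k ^ 3) by (simpl; nra). assert (0 <= k ^ 4) by (simpl; nra).
assert (B : forall x y, 0 <= x <= y -> 0 <= w * x <= w * y) by (intros; nra).
assert (M : forall c a, 0 <= c -> 0 <= a <= C -> 0 <= c * a <= c * C) by (intros; nra).
replace (w * (k + 1) ^ 3 * C) with (w * (k ^ 3 * C + 3 * k ^ 2 * C + 3 * k * C + C)) by ring.
assert (0 <= C) by lra.
assert (0 <= k * C) by nra. assert (0 <= k ^ 2 * C) by nra. assert (0 <= k ^ 3 * C) by nra.
assert (E1 := M k _ HK H0). 
assert (E2 := M (k ^ 2) (geo0 z) ltac:(lra) H0). assert (E3 := M k (geo1 z) HK H1).
assert (E4 := M (k ^ 3) (geo0 z) ltac:(lra) H0). assert (E5 := M (k ^ 2) (geo1 z) ltac:(lra) H1).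
assert (E6 := M k (geo2 z) HK H2).
assert (F1 := B (k * geo0 z + geo1 z) (k ^ 3 * C + 3 * k ^ 2 * C + 3 * k * C + C) ltac:(lra)).
assert (F2 := B (k ^ 2 * geo0 z + 2 * k * geo1 z + geo2 z) (k ^ 3 * C + 3 * k ^ 2 * C + 3 * k * C + C) ltac:(lra)).
assert (F3 := B (k ^ 3 * geo0 z + 3 * k ^ 2 * geo1 z + 3 * k * geo2 z + geo3 z) (k ^ 3 * C + 3 * k ^ 2 * C + 3 * k * C + C) ltac:(lra)).
assert (F4 : 0 <= w * (k ^ 4 * geo0 z + 4 * k ^ 3 * geo1 z + 6 * k ^ 2 * geo2 z + 4 * k * geo3 z + geo4 z)).
{ apply Rmult_le_pos; [lra|].
  assert (0 <= k ^ 4 * geo0 z) by (apply Rmult_le_pos; lra).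
  assert (0 <= k ^ 3 * geo1 z) by (apply Rmult_le_pos; lra).
  assert (0 <= k ^ 2 * geo2 z) by (apply Rmult_le_pos; lra).
  assert (0 <= k * geo3 z) by (apply Rmult_le_pos; lra).
  lra. }
repeat split; lra.
Qed.

(** * Fourier inversion in polar form *)

Definition rk (t : R) (k : nat) : R := exp (- (t * INR k)).
(* Variance of a Bernoulli variable with odds [x], and [|1 + x e^(i a)|^2 / (1 + x)^2]. *)
Definition vr (x : R) : R := x / (1 + x) ^ 2.
Definition dn (x a : R) : R := 1 - 2 * vr x * (1 - cos a).

Definition modulus (t : R) (K : nat) (h : R) : R :=
  exp (sum1 (fun k => ln (dn (rk t k) (INR k * h)) / 2) K).
(** For [0 < t] each factor has positive real part because [r_k < 1], so a sum of arctangents is a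
    continuous argument of the product, without branch jumps. *)
Definition phase (t : R) (K : nat) (h : R) : R :=
  sum1 (fun k => atan (rk t k * sin (INR k * h) / (1 + rk t k * cos (INR k * h)))) K.
Fixpoint total (t : R) (K : nat) : R :=
  match K with O => 1 | S k => total t k * (1 + rk t (S k)) end.

(* Real part of [e^(-i x h) * prod_(k <= K) (1 + r_k e^(i k h))]. *)
Fixpoint rotated (t : R) (K : nat) (h x : R) : R :=
  match K with
  | O => cos (x * h)
  | S k => rotated t k h x + rk t (S k) * rotated t k h (x - INR (S k))
  end.

(* Number of subsets of {1, .., K} with sum [z]. *)
Fixpoint dcount (K : nat) (z : Z) : Z :=
  match K with
  | O => if (z =? 0)%Z then 1%Z else 0%Z
  | S k => (dcount k z + dcount k (z - Z.of_nat (S k)))%Z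
  end.

Lemma rk_bounds (t : R) (k : nat) : 0 < t -> (1 <= k)%nat -> 0 < rk t k < 1.
Proof.
intros Ht Hk; unfold rk; split; [apply exp_pos|].
rewrite <- exp_0; apply exp_increasing.
assert (1 <= INR k) by (apply (le_INR 1); lia). nra.
Qed.

Lemma exp_pow_nat (x : R) (n : nat) : exp x ^ n = exp (INR n * x).
Proof.
induction n as [|n IH]; [simpl; rewrite Rmult_0_l, exp_0; reflexivity|].
rewrite S_INR; cbn [pow]; rewrite IH, <- exp_plus; f_equal; ring.
Qed.

Lemma rk_pow (t : R) (k j : nat) : rk t k ^ j = exp (- (INR j * t)) ^ k.
Proof.
unfold rk; rewrite !exp_pow_nat; f_equal; ring.
Qed.

Lemma dn_eq (x a : R) : 0 < x -> dn x a = (1 + 2 * x * cos a + x ^ 2) / (1 + x) ^ 2.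
Proof. intros Hx; unfold dn, vr; field; lra. Qed.

Lemma norm_pos (x a : R) : 0 < x < 1 -> 0 < 1 + 2 * x * cos a + x ^ 2.
Proof. intros Hx; assert (H := COS_bound a); nra. Qed.

Lemma dn_pos (x a : R) : 0 < x < 1 -> 0 < dn x a.
Proof.
intros Hx; rewrite dn_eq by lra; apply Rdiv_lt_0_compat; [apply norm_pos; lra|].
apply pow_lt; lra.
Qed.

Lemma one_cos_pos (x a : R) : 0 < x < 1 -> 0 < 1 + x * cos a.
Proof. intros Hx; assert (H := COS_bound a); nra. Qed.

(** Polar form of [1 + x e^(i a)]. The modulus is written as [exp] of half a logarithm, not as a
    square root, so that products become exponentials of sums. *)
Lemma polar_factor (x a : R) : 0 < x < 1 ->
  let p := atan (x * sin a / (1 + x * cos a)) in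
  (1 + x) * exp (ln (dn x a) / 2) * cos p = 1 + x * cos a /\
  (1 + x) * exp (ln (dn x a) / 2) * sin p = x * sin a.
Proof.
intros Hx p.
assert (Hc := one_cos_pos x a Hx). assert (Hn := norm_pos x a Hx).
assert (Hd := dn_pos x a Hx).
assert (E : exp (ln (dn x a) / 2) = sqrt (dn x a)).
{ rewrite <- (sqrt_Rsqr (exp (ln (dn x a) / 2))) by (apply Rlt_le, exp_pos).
  f_equal; unfold Rsqr; rewrite <- exp_plus.
  replace (ln (dn x a) / 2 + ln (dn x a) / 2) with (ln (dn x a)) by field.
  apply exp_ln; exact Hd. }
assert (S : sqrt (1 + (x * sin a / (1 + x * cos a)) ^ 2)
            = (1 + x) * sqrt (dn x a) / (1 + x * cos a)).
{ rewrite <- (sqrt_Rsqr ((1 + x) * sqrt (dn x a) / (1 + x * cos a))).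
  2:{ apply Rlt_le, Rdiv_lt_0_compat; [|lra]. apply Rmult_lt_0_compat; [lra|].
      apply sqrt_lt_R0; exact Hd. }
  f_equal. unfold Rsqr.
  replace ((1 + x) * sqrt (dn x a) / (1 + x * cos a) * ((1 + x) * sqrt (dn x a) / (1 + x * cos a)))
    with ((1 + x) ^ 2 * (sqrt (dn x a) * sqrt (dn x a)) / (1 + x * cos a) ^ 2) by (field; lra).
  rewrite sqrt_sqrt by lra. rewrite dn_eq by lra.
  assert (T := sin2_cos2 a); unfold Rsqr in T.
  replace ((1 + x) ^ 2 * ((1 + 2 * x * cos a + x ^ 2) / (1 + x) ^ 2) / (1 + x * cos a) ^ 2)
    with ((1 + 2 * x * cos a + x ^ 2) / (1 + x * cos a) ^ 2) by (field; lra).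
  replace (1 + 2 * x * cos a + x ^ 2) with
    (1 + 2 * x * cos a + x ^ 2 * (sin a * sin a + cos a * cos a)) by (rewrite T; ring).
  field; lra. }
assert (0 < sqrt (dn x a)) by (apply sqrt_lt_R0; exact Hd).
rewrite E; unfold p; rewrite cos_atan, sin_atan.
unfold Rsqr; replace (x * sin a / (1 + x * cos a) * (x * sin a / (1 + x * cos a)))
  with ((x * sin a / (1 + x * cos a)) ^ 2) by ring.
rewrite S; split; field; lra.
Qed.

(** Shifting [x] by [k] in [rotated] stands for multiplication by [e^(i k h)]; with [x] generalised,
    the induction needs only real parts and no complex numbers. *)
Lemma rotated_polar (t : R) (K : nat) (h x : R) : 0 < t ->
  rotated t K h x = total t K * modulus t K h * cos (phase t K h - x * h).
Proof.
intros Ht; revert x; induction K as [|K IH]; intros x.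
- simpl; unfold modulus, phase; simpl sum1; rewrite exp_0, <- cos_neg.
  replace (- (x * h)) with (0 - x * h) by ring; ring.
- cbn [rotated total]. rewrite !IH.
  unfold modulus, phase; cbn [sum1]; fold (phase t K h).
  rewrite exp_plus; fold (modulus t K h).
  assert (Hr := rk_bounds t (S K) Ht ltac:(lia)).
  destruct (polar_factor (rk t (S K)) (INR (S K) * h) Hr) as [C S'].
  set (p := atan _) in *. set (e := exp _) in *. set (a := INR (S K) * h) in *.
  set (Ph := phase t K h). set (M := modulus t K h). set (T := total t K).
  replace (Ph - (x - INR (S K)) * h) with ((Ph - x * h) + a) by (unfold a; ring).
  replace (Ph + p - x * h) with ((Ph - x * h) + p) by ring.
  rewrite !cos_plus. set (b := Ph - x * h).
  replace (T * (1 + rk t (S K)) * (M * e) * (cos b * cos p - sin b * sin p)) with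
   (T * M * (cos b * ((1 + rk t (S K)) * e * cos p) - sin b * ((1 + rk t (S K)) * e * sin p))) by ring.
  rewrite C, S'; ring.
Qed.

Lemma is_RInt_cos_int (z : Z) :
  is_RInt (fun h => cos (IZR z * h)) 0 PI (if (z =? 0)%Z then PI else 0).
Proof.
destruct (Z.eqb_spec z 0) as [->|Hz].
- apply (is_RInt_ext (fun _ => 1)).
  + intros h _; rewrite Rmult_0_l, cos_0; reflexivity.
  + replace PI with (scal (PI - 0) 1) at 2 by (unfold scal; simpl; unfold mult; simpl; ring).
    apply (is_RInt_const (V := R_NormedModule)).
- assert (Hz' : IZR z <> 0) by (apply not_0_IZR; exact Hz).
  replace 0 with (minus (sin (IZR z * PI) / IZR z) (sin (IZR z * 0) / IZR z)) at 2.
  + apply (is_RInt_derive (fun h => sin (IZR z * h) / IZR z)).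
    * intros h _; auto_derive; [exact I|field; exact Hz'].
    * intros h _. apply (ex_derive_continuous (fun h => cos (IZR z * h))). auto_derive; exact I.
  + rewrite sin_eq_0_1 by (exists z; reflexivity).
    rewrite Rmult_0_r, sin_0. unfold minus, plus, opp; simpl. field; exact Hz'.
Qed.

(** A subset with sum [z] carries the weight [prod r_k = exp (- t z)], and orthogonality of the
    cosines kills all other subsets. The recursions of [rotated] and [dcount] match term by term. *)
Lemma is_RInt_rotated (t : R) (K : nat) (z : Z) :
  is_RInt (fun h => rotated t K h (IZR z)) 0 PI (PI * IZR (dcount K z) * exp (- (t * IZR z))).
Proof.
revert z; induction K as [|K IH]; intros z.
- assert (H := is_RInt_cos_int z); simpl.
  destruct (Z.eqb_spec z 0) as [Hz|Hz]; simpl.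
  + replace (t * IZR z) with 0 by (rewrite Hz; ring); rewrite Ropp_0, exp_0, !Rmult_1_r; exact H.
  + rewrite Rmult_0_r, Rmult_0_l; exact H.
- assert (H1 := IH z). assert (H2 := IH (z - Z.of_nat (S K))%Z).
  apply (is_RInt_scal (V := R_NormedModule) _ _ _ (rk t (S K))) in H2.
  assert (H3 := is_RInt_plus (V := R_NormedModule) _ _ _ _ _ _ H1 H2).
  cbn [dcount rotated].
  eapply is_RInt_ext; [|replace (PI * _ * _) with
     (plus (PI * IZR (dcount K z) * exp (- (t * IZR z)))
        (scal (rk t (S K)) (PI * IZR (dcount K (z - Z.of_nat (S K)))
                 * exp (- (t * IZR (z - Z.of_nat (S K))))))); [exact H3|]].
  + intros h _; change (rotated t K h (IZR z) + rk t (S K) * rotated t K h (IZR (z - Z.of_nat (S K)))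
      = rotated t K h (IZR z) + rk t (S K) * rotated t K h (IZR z - INR (S K))).
    rewrite minus_IZR, <- INR_IZR_INZ; reflexivity.
  + change (PI * IZR (dcount K z) * exp (- (t * IZR z)) + rk t (S K) *
      (PI * IZR (dcount K (z - Z.of_nat (S K))) * exp (- (t * IZR (z - Z.of_nat (S K)))))
      = PI * IZR (dcount K z + dcount K (z - Z.of_nat (S K))) * exp (- (t * IZR z))).
    rewrite plus_IZR, minus_IZR, <- INR_IZR_INZ; unfold rk.
    rewrite Rmult_plus_distr_l, Rmult_plus_distr_r; f_equal.
    replace (- (t * IZR z)) with (- (t * INR (S K)) + - (t * (IZR z - INR (S K)))) by ring.
    rewrite exp_plus; ring.
Qed.

Lemma total_pos (t : R) (K : nat) : 0 < total t K.
Proof.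
induction K as [|K IH]; cbn [total]; [lra|].
apply Rmult_lt_0_compat; [exact IH|]. assert (0 < rk t (S K)) by apply exp_pos; lra.
Qed.

Lemma RInt_polar (t : R) (K : nat) (z : Z) : 0 < t ->
  RInt (fun h => modulus t K h * cos (phase t K h - IZR z * h)) 0 PI =
  PI / total t K * exp (- (t * IZR z)) * IZR (dcount K z).
Proof.
intros Ht; assert (HT := total_pos t K).
apply is_RInt_unique.
assert (H := is_RInt_scal (V := R_NormedModule) _ _ _ (/ total t K) _ (is_RInt_rotated t K z)).
eapply is_RInt_ext; [|replace (PI / _ * _ * _) with
   (scal (/ total t K) (PI * IZR (dcount K z) * exp (- (t * IZR z)))); [exact H|]].
- intros h _; unfold scal; cbn -[IZR]; unfold mult; cbn -[IZR]. rewrite rotated_polar by exact Ht.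
  field; lra.
- unfold scal; cbn -[IZR]; unfold mult; cbn -[IZR]. field; lra.
Qed.

(** * Derivatives of the modulus and of the phase *)

Definition decay (t : R) (K : nat) (h : R) : R :=
  sum1 (fun k => INR k * vr (rk t k) * (sin (INR k * h) / dn (rk t k) (INR k * h))) K.

Lemma is_derive_modulus (t : R) (K : nat) (h : R) : 0 < t ->
  is_derive (modulus t K) h (- (decay t K h * modulus t K h)).
Proof.
intros Ht; unfold modulus.
replace (- (decay t K h * exp (sum1 (fun k => ln (dn (rk t k) (INR k * h)) / 2) K)))
  with (scal (- decay t K h) (exp (sum1 (fun k => ln (dn (rk t k) (INR k * h)) / 2) K)))
  by (unfold scal; simpl; unfold mult; simpl; ring).
apply (is_derive_comp (V := R_NormedModule) exp
  (fun u => sum1 (fun k => ln (dn (rk t k) (INR k * u)) / 2) K)).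
- apply is_derive_exp.
- replace (- decay t K h) with
    (sum1 (fun k => - (INR k * vr (rk t k) * (sin (INR k * h) / dn (rk t k) (INR k * h)))) K).
  + apply is_derive_sum1; intros k Hk.
    assert (Hr := rk_bounds t k Ht Hk). assert (Hd := dn_pos (rk t k) (INR k * h) Hr).
    unfold dn in *; auto_derive; [lra|]. field; lra.
  + unfold decay. rewrite (sum1_ext _ (fun k => (-1) * (INR k * vr (rk t k) * (sin (INR k * h) / dn (rk t k) (INR k * h))))) by (intros; ring).
    rewrite sum1_scal; ring.
Qed.

Lemma continuous_modulus (t : R) (K : nat) (h : R) : 0 < t -> continuous (modulus t K) h.
Proof.
intros Ht; apply (ex_derive_continuous (modulus t K)).
eexists; apply is_derive_modulus; exact Ht.
Qed.

Lemma continuous_decay (t : R) (K : nat) (h : R) : 0 < t -> continuous (decay t K) h.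
Proof.
intros Ht; unfold decay; apply (continuous_sum1
  (fun k h => INR k * vr (rk t k) * (sin (INR k * h) / dn (rk t k) (INR k * h)))).
intros k Hk; assert (Hr := rk_bounds t k Ht Hk). assert (Hd := dn_pos (rk t k) (INR k * h) Hr).
apply (ex_derive_continuous (fun h => INR k * vr (rk t k) * (sin (INR k * h) / dn (rk t k) (INR k * h)))).
unfold dn in *; auto_derive. lra.
Qed.

(* Third cumulant, up to sign, of a Bernoulli variable with odds [x]. *)
Definition wr (x : R) : R := x * (1 - x) / (1 + x) ^ 3.

Definition mean (t : R) (K : nat) : R := sum1 (fun k => INR k * (rk t k / (1 + rk t k))) K.

Definition drift (t : R) (K : nat) (h : R) : R :=
  sum1 (fun k => INR k * wr (rk t k) * ((1 - cos (INR k * h)) / dn (rk t k) (INR k * h))) K.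

(** With [c = cos (k h)] and [x = r_k], the derivative of a term is
    [k x (c + x) / (1 + 2 x c + x^2)]. Splitting off its value at [h = 0] isolates the tilted mean,
    which the saddle point equates with [m]; the rest, [drift], is quadratic in [h]. *)
Lemma is_derive_phase (t : R) (K : nat) (h : R) : 0 < t ->
  is_derive (phase t K) h (mean t K - drift t K h).
Proof.
intros Ht; unfold phase.
replace (mean t K - drift t K h) with
  (sum1 (fun k => INR k * (rk t k / (1 + rk t k))
         + (-1) * (INR k * wr (rk t k) * ((1 - cos (INR k * h)) / dn (rk t k) (INR k * h)))) K)
  by (rewrite sum1_plus, sum1_scal; unfold mean, drift; ring).
apply is_derive_sum1; intros k Hk.
assert (Hr := rk_bounds t k Ht Hk). assert (Hn := norm_pos (rk t k) (INR k * h) Hr).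
assert (Hc := one_cos_pos (rk t k) (INR k * h) Hr).
auto_derive; [lra|].
rewrite dn_eq by lra. unfold wr.
set (x := rk t k) in *. set (k' := INR k). 
assert (T := sin2_cos2 (k' * h)); unfold Rsqr in T. fold k' in Hn, Hc |- *.
set (c := cos (k' * h)) in *. set (s := sin (k' * h)) in *.
assert (P : 0 < (1 + x * c) ^ 2 + (x * s) ^ 2) by nra.
transitivity (k' * ((x * c * (1 + x * c) + x ^ 2 * (s * s)) / ((1 + x * c) ^ 2 + x ^ 2 * (s * s)))).
- field; repeat split; nra.
- replace (s * s) with (1 - c * c) by lra. field. repeat split; nra.
Qed.

Lemma continuous_phase (t : R) (K : nat) (h : R) : 0 < t -> continuous (phase t K) h.
Proof.
intros Ht; apply (ex_derive_continuous (phase t K)).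
eexists; apply is_derive_phase; exact Ht.
Qed.

(** * Integration tools *)

Lemma ex_RInt_cont (f : R -> R) (a b : R) : (forall x, continuous f x) -> ex_RInt f a b.
Proof. intros H; apply (ex_RInt_continuous (V := R_CompleteNormedModule)); intros z _; apply H. Qed.

Lemma cont_mult (f g : R -> R) (x : R) :
  continuous f x -> continuous g x -> continuous (fun u => f u * g u) x.
Proof. intros H1 H2; apply (continuous_mult (K := R_AbsRing) f g); assumption. Qed.

Lemma cont_plus (f g : R -> R) (x : R) :
  continuous f x -> continuous g x -> continuous (fun u => f u + g u) x.
Proof. intros H1 H2; apply (continuous_plus (V := R_NormedModule) f g); assumption. Qed.

Lemma cont_minus (f g : R -> R) (x : R) :
  continuous f x -> continuous g x -> continuous (fun u => f u - g u) x.
Proof. intros H1 H2; apply (continuous_minus (V := R_NormedModule) f g); assumption. Qed.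

Lemma cont_pow (n : nat) (x : R) : continuous (fun u => u ^ n) x.
Proof. apply (ex_derive_continuous (fun u => u ^ n)); auto_derive; exact I. Qed.

Lemma cont_comp (f g : R -> R) (x : R) :
  continuous f x -> continuous g (f x) -> continuous (fun u => g (f u)) x.
Proof. intros H1 H2; apply (continuous_comp f g); assumption. Qed.

Lemma cont_cos (x : R) : continuous cos x.
Proof. apply (ex_derive_continuous cos); auto_derive; exact I. Qed.

Lemma cont_sin (x : R) : continuous sin x.
Proof. apply (ex_derive_continuous sin); auto_derive; exact I. Qed.

Lemma RInt_le_cont (f g : R -> R) (a b : R) : a <= b ->
  (forall x, continuous f x) -> (forall x, continuous g x) ->
  (forall x, a <= x <= b -> f x <= g x) -> RInt f a b <= RInt g a b.
Proof.
intros H Cf Cg L; apply RInt_le; [exact H|apply ex_RInt_cont, Cf|apply ex_RInt_cont, Cg|].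
intros x Hx; apply L; lra.
Qed.

Lemma RInt_scal_cont (f : R -> R) (c a b : R) : (forall x, continuous f x) ->
  RInt (fun x => c * f x) a b = c * RInt f a b :> R.
Proof.
intros C; apply (RInt_scal (V := R_CompleteNormedModule) f a b c), ex_RInt_cont, C.
Qed.

Lemma RInt_plus_cont (f g : R -> R) (a b : R) :
  (forall x, continuous f x) -> (forall x, continuous g x) ->
  RInt (fun x => f x + g x) a b = RInt f a b + RInt g a b :> R.
Proof.
intros Cf Cg; apply (RInt_plus (V := R_CompleteNormedModule) f g); apply ex_RInt_cont; assumption.
Qed.

Lemma RInt_minus_cont (f g : R -> R) (a b : R) :
  (forall x, continuous f x) -> (forall x, continuous g x) ->
  RInt (fun x => f x - g x) a b = RInt f a b - RInt g a b :> R.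
Proof.
intros Cf Cg; apply (RInt_minus (V := R_CompleteNormedModule) f g); apply ex_RInt_cont; assumption.
Qed.

Lemma RInt_split (f : R -> R) (a b c : R) : (forall x, continuous f x) ->
  RInt f a c = RInt f a b + RInt f b c :> R.
Proof.
intros C; symmetry; apply (RInt_Chasles (V := R_CompleteNormedModule)); apply ex_RInt_cont, C.
Qed.

Lemma RInt_abs_le (f g : R -> R) (a b : R) : a <= b ->
  (forall x, continuous f x) -> (forall x, continuous g x) ->
  (forall x, a <= x <= b -> Rabs (f x) <= g x) -> Rabs (RInt f a b) <= RInt g a b.
Proof.
intros H Cf Cg L; apply Rabs_le; split.
- assert (E := RInt_scal_cont g (-1) a b Cg).
  replace (- RInt g a b) with (RInt (fun x => (-1) * g x) a b : R) by lra.
  apply RInt_le_cont; trivial.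
  + intros x; apply cont_mult; [apply continuous_const|apply Cg].
  + intros x Hx; assert (Q := L x Hx); apply Rabs_le_between in Q; lra.
- apply RInt_le_cont; trivial.
  intros x Hx; assert (Q := L x Hx); apply Rabs_le_between in Q; lra.
Qed.

Lemma RInt_nonneg (f : R -> R) (a b : R) : a <= b -> (forall x, continuous f x) ->
  (forall x, a <= x <= b -> 0 <= f x) -> 0 <= RInt f a b.
Proof. intros H C L; apply RInt_ge_0; [exact H|apply ex_RInt_cont, C|]. intros; apply L; lra. Qed.

Lemma RInt_upper (f : R -> R) (a b M : R) : a <= b -> (forall x, continuous f x) ->
  (forall x, a <= x <= b -> f x <= M) -> RInt f a b <= (b - a) * M.
Proof.
intros H C L; replace ((b - a) * M) with (RInt (fun _ => M) a b).
- apply RInt_le_cont; trivial. intros; apply continuous_const.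
- rewrite RInt_const; reflexivity.
Qed.

Lemma is_derive_nondecreasing (g d : R -> R) (a b : R) : a <= b ->
  (forall x, is_derive g x (d x)) -> (forall x, a <= x <= b -> 0 <= d x) -> g a <= g b.
Proof.
intros H D P.
destruct (MVT_gen g a b d) as (x & Hx & E).
- intros x _; apply D.
- intros x _; apply continuity_pt_filterlim, (ex_derive_continuous g); eexists; apply D.
- rewrite Rmin_left, Rmax_right in Hx by lra.
  assert (0 <= d x) by (apply P; lra). nra.
Qed.

(** * Trigonometric bounds *)

Lemma sin_le_id (x : R) : 0 <= x -> sin x <= x.
Proof.
intros H; destruct (Req_dec x 0) as [->|N]; [rewrite sin_0; lra|].
apply Rlt_le, sin_lt_x; lra.
Qed.

Lemma Rabs_sin_le (x : R) : Rabs (sin x) <= Rabs x.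
Proof.
assert (P : forall y, 0 <= y -> Rabs (sin y) <= y).
{ intros y Hy; apply Rabs_le; split; [|apply sin_le_id; lra].
  destruct (Rle_lt_dec y 1).
  - assert (0 <= sin y); [|lra]. apply sin_ge_0; [lra|]. assert (Q := PI2_1); lra.
  - assert (Q := SIN_bound y); lra. }
destruct (Rle_lt_dec 0 x).
- rewrite (Rabs_pos_eq x) by lra; apply P; lra.
- rewrite <- Rabs_Ropp, <- sin_neg, (Rabs_left x) by lra; apply P; lra.
Qed.

Lemma one_minus_cos (x : R) : 1 - cos x = 2 * sin (x / 2) ^ 2.
Proof.
replace x with (2 * (x / 2)) at 1 by field. rewrite cos_2a_sin; ring.
Qed.

Lemma one_minus_cos_bounds (x : R) : 0 <= 1 - cos x <= x ^ 2 / 2.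
Proof.
rewrite one_minus_cos; assert (Q := Rabs_sin_le (x / 2)).
split; [nra|].
assert (E : sin (x / 2) ^ 2 <= (x / 2) ^ 2); [|lra].
rewrite <- (pow2_abs (sin _)), <- (pow2_abs (x / 2)).
apply pow_incr; split; [apply Rabs_pos|exact Q].
Qed.

Lemma sin_lower (x : R) : 0 <= x -> x - x ^ 3 / 6 <= sin x.
Proof.
intros H; destruct (Rle_lt_dec x 3) as [L|L].
- assert (Q := pre_sin_bound x 0 H ltac:(lra)).
  unfold sin_approx, sin_term in Q; simpl in Q. lra.
- assert (Q := SIN_bound x). assert (9 * x <= x ^ 3) by (simpl; nra). lra.
Qed.

Lemma cos_lower (x : R) : 1 - x ^ 2 / 2 <= cos x.
Proof. assert (Q := one_minus_cos_bounds x); lra. Qed.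

Lemma cos_upper (x : R) : 0 <= x <= 2 -> x ^ 2 / 2 - x ^ 4 / 24 <= 1 - cos x.
Proof.
intros H. rewrite one_minus_cos.
assert (Q := sin_lower (x / 2) ltac:(lra)).
assert (P : 0 <= x / 2 - (x / 2) ^ 3 / 6) by (simpl; nra).
assert (E : (x / 2 - (x / 2) ^ 3 / 6) ^ 2 <= sin (x / 2) ^ 2) by (apply pow_incr; lra).
assert (0 <= x ^ 6) by (apply pow_le; lra).
replace ((x / 2 - (x / 2) ^ 3 / 6) ^ 2) with (x ^ 2 / 4 - x ^ 4 / 48 + x ^ 6 / 2304) in E by field.
lra.
Qed.

(** * Moments *)

Definition moment (f : R -> R) (d : R) (j : nat) : R := RInt (fun h => f h * h ^ j) 0 d.

Lemma moment_nonneg (f : R -> R) (d : R) (j : nat) : 0 <= d ->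
  (forall x, 0 < f x) -> (forall x, continuous f x) -> 0 <= moment f d j.
Proof.
intros Hd P C; apply RInt_nonneg; trivial.
- intros x; apply cont_mult; [apply C|apply cont_pow].
- intros x Hx; apply Rmult_le_pos; [apply Rlt_le, P|apply pow_le; lra].
Qed.

(* Integrating the derivative of [h^(j+1) f] and dropping the boundary term. *)
Lemma moment_parts (f lam : R -> R) (d : R) (j : nat) : 0 <= d ->
  (forall x, 0 < f x) -> (forall x, continuous lam x) ->
  (forall x, is_derive f x (- (lam x * f x))) ->
  RInt (fun h => h ^ (S j) * lam h * f h) 0 d <= INR (S j) * moment f d j.
Proof.
intros Hd P Cl D.
assert (Cf : forall x, continuous f x).
{ intros x; apply (ex_derive_continuous f); eexists; apply D. }
assert (C1 : forall x, continuous (fun h => f h * h ^ j) x)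
  by (intros; apply cont_mult; [apply Cf|apply cont_pow]).
assert (C2 : forall x, continuous (fun h => h ^ (S j) * lam h * f h) x)
  by (intros; apply cont_mult; [apply cont_mult; [apply cont_pow|apply Cl]|apply Cf]).
assert (E : RInt (fun h => INR (S j) * (f h * h ^ j) - h ^ (S j) * lam h * f h) 0 d
            = d ^ (S j) * f d :> R).
{ apply is_RInt_unique.
  replace (d ^ S j * f d) with (minus (d ^ S j * f d) (0 ^ S j * f 0))
    by (unfold minus, plus, opp; simpl; ring).
  apply (is_RInt_derive (fun h => h ^ S j * f h)).
  - intros x _.
    replace (INR (S j) * (f x * x ^ j) - x ^ S j * lam x * f x) with
      ((INR (S j) * 1 * x ^ j) * f x + x ^ S j * (- (lam x * f x))) by ring.
    apply (is_derive_mult (fun h => h ^ S j) f x); [| apply D | intros; apply Rmult_comm].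
    apply (is_derive_pow (fun h => h) (S j) x 1). apply (is_derive_id (K := R_AbsRing)).
  - intros x _; apply cont_minus; [apply cont_mult; [apply continuous_const|apply C1]|apply C2]. }
rewrite RInt_minus_cont, RInt_scal_cont in E; trivial.
2:{ intros x; apply cont_mult; [apply continuous_const|apply C1]. }
assert (0 <= d ^ S j * f d).
{ apply Rmult_le_pos; [apply pow_le; lra|apply Rlt_le, P]. }
unfold moment; lra.
Qed.

(** For [lam h = s h] integration by parts gives the Gaussian recursion [s M_(j+2) <= (j+1) M_j].
    The cubic loss adds [b M_(j+4)], which is brought back to [M_(j+2)] by the same inequality at
    index [j + 2], closed with the crude bound [M_(j+6) <= d^2 M_(j+4)]. *)
Lemma moment_rec (f lam : R -> R) (s b d : R) (j : nat) : 0 <= d -> 0 <= b ->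
  (forall x, 0 < f x) -> (forall x, continuous lam x) ->
  (forall x, is_derive f x (- (lam x * f x))) ->
  (forall h, 0 <= h <= d -> s * h - b * h ^ 3 <= lam h) ->
  0 < s - b * d ^ 2 ->
  (s - b * (INR j + 3) / (s - b * d ^ 2)) * moment f d (S (S j)) <= (INR j + 1) * moment f d j.
Proof.
intros Hd Hb P Cl D L Hs.
assert (Cf : forall x, continuous f x).
{ intros x; apply (ex_derive_continuous f); eexists; apply D. }
assert (C1 : forall i x, continuous (fun h => f h * h ^ i) x)
  by (intros; apply cont_mult; [apply Cf|apply cont_pow]).
assert (C2 : forall i x, continuous (fun h => h ^ i * lam h * f h) x)
  by (intros; apply cont_mult; [apply cont_mult; [apply cont_pow|apply Cl]|apply Cf]).
assert (S1 : forall i, s * moment f d (S (S i)) - b * moment f d (S (S (S (S i))))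
                       <= (INR i + 1) * moment f d i).
{ intros i; rewrite <- S_INR; eapply Rle_trans; [|apply (moment_parts f lam d i); trivial].
  unfold moment; rewrite <- !RInt_scal_cont, <- RInt_minus_cont;
    try (intros; apply cont_mult; [apply continuous_const|]); try apply C1.
  apply RInt_le_cont; trivial; try apply C2.
  - intros x; apply cont_minus; apply cont_mult; try apply continuous_const; apply C1.
  - intros x Hx.
    replace (s * (f x * x ^ S (S i)) - b * (f x * x ^ S (S (S (S i))))) with
      (x ^ S i * f x * (s * x - b * x ^ 3)) by (simpl; ring).
    replace (x ^ S i * lam x * f x) with (x ^ S i * f x * lam x) by ring.
    apply Rmult_le_compat_l; [|apply L; exact Hx].
    apply Rmult_le_pos; [apply pow_le; lra|apply Rlt_le, P]. }
assert (S2 : forall i, moment f d (S (S i)) <= d ^ 2 * moment f d i).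
{ intros i; unfold moment; rewrite <- RInt_scal_cont by apply C1.
  apply RInt_le_cont; trivial; try apply C1.
  - intros x; apply cont_mult; [apply continuous_const|apply C1].
  - intros x Hx. replace (f x * x ^ S (S i)) with (f x * x ^ i * x ^ 2) by (simpl; ring).
    rewrite (Rmult_comm (d ^ 2)). apply Rmult_le_compat_l; [|apply pow_incr; lra].
    apply Rmult_le_pos; [apply Rlt_le, P|apply pow_le; lra]. }
assert (N := moment_nonneg f d (S (S j)) Hd P Cf).
assert (Q1 := S1 (S (S j))). assert (Q2 := S2 (S (S j))). assert (Q3 := S1 j).
rewrite !S_INR in Q1.
set (M4 := moment f d (S (S (S (S j))))) in *. set (M2 := moment f d (S (S j))) in *.
assert (Q4 : (s - b * d ^ 2) * M4 <= (INR j + 3) * M2).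
{ assert (Q5 := S2 (S (S (S (S j))))). 
  assert (b * moment f d (S (S (S (S (S (S j)))))) <= b * (d ^ 2 * M4)) by (apply Rmult_le_compat_l; trivial).
  unfold M4 in *; lra. }
assert (Q5 : M4 <= (INR j + 3) * M2 / (s - b * d ^ 2)).
{ apply Rmult_le_reg_l with (s - b * d ^ 2); [exact Hs|].
  replace ((s - b * d ^ 2) * ((INR j + 3) * M2 / (s - b * d ^ 2))) with ((INR j + 3) * M2)
    by (field; lra). exact Q4. }
assert (b * M4 <= b * ((INR j + 3) * M2 / (s - b * d ^ 2))) by (apply Rmult_le_compat_l; trivial).
replace ((s - b * (INR j + 3) / (s - b * d ^ 2)) * M2)
  with (s * M2 - b * ((INR j + 3) * M2 / (s - b * d ^ 2))) by (field; lra).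
lra.
Qed.

(** * The quadratic form *)

Definition harm (f ps : R -> R) (x : R) : R := RInt (fun h => f h * cos (ps h - x * h)) 0 PI.

(** The coefficients [1, -4, 3] cancel [U0^2], [U0 U1] and [W1^2]. This reflects the vanishing to
    order four of the kernel of the transvectant: what remains has the size of [U0 U2] and
    [U1^2]. *)
Lemma form_expand (f ps : R -> R) :
  (forall x, continuous f x) -> (forall x, continuous ps x) ->
  let U0 := RInt (fun h => f h * cos (ps h)) 0 PI in
  let U1 := RInt (fun h => f h * (cos (ps h) * (1 - cos h))) 0 PI in
  let U2 := RInt (fun h => f h * (cos (ps h) * (1 - cos h) ^ 2)) 0 PI in
  let W1 := RInt (fun h => f h * (sin (ps h) * sin h)) 0 PI in
  let W2 := RInt (fun h => f h * (sin (ps h) * (sin h * (1 - cos h)))) 0 PI in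
  harm f ps (-2) * harm f ps 2 - 4 * harm f ps (-1) * harm f ps 1 + 3 * harm f ps 0 ^ 2
  = 4 * U0 * U2 + 12 * U1 ^ 2 - 16 * U1 * U2 + 4 * U2 ^ 2 + 8 * W1 * W2 - 4 * W2 ^ 2.
Proof.
intros Cf Cp U0 U1 U2 W1 W2.
assert (Cc : forall x, continuous (fun h => cos (ps h)) x)
  by (intros; apply (cont_comp ps cos); [apply Cp|apply cont_cos]).
assert (Cs : forall x, continuous (fun h => sin (ps h)) x)
  by (intros; apply (cont_comp ps sin); [apply Cp|apply cont_sin]).
assert (C1 : forall x, continuous (fun h => 1 - cos h) x)
  by (intros; apply cont_minus; [apply continuous_const|apply cont_cos]).
assert (C0' : forall x, continuous (fun h => f h * cos (ps h)) x)
  by (intros; apply cont_mult; [apply Cf|apply Cc]).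
assert (C1' : forall x, continuous (fun h => f h * (cos (ps h) * (1 - cos h))) x)
  by (intros; apply cont_mult; [apply Cf|apply cont_mult; [apply Cc|apply C1]]).
assert (C2' : forall x, continuous (fun h => f h * (cos (ps h) * (1 - cos h) ^ 2)) x).
{ intros x; apply cont_mult; [apply Cf|apply cont_mult; [apply Cc|]].
  apply (cont_comp (fun h => 1 - cos h) (fun u => u ^ 2)); [apply C1|apply cont_pow]. }
assert (D1' : forall x, continuous (fun h => f h * (sin (ps h) * sin h)) x)
  by (intros; apply cont_mult; [apply Cf|apply cont_mult; [apply Cs|apply cont_sin]]).
assert (D2' : forall x, continuous (fun h => f h * (sin (ps h) * (sin h * (1 - cos h)))) x)
  by (intros; apply cont_mult; [apply Cf|apply cont_mult; [apply Cs|apply cont_mult; [apply cont_sin|apply C1]]]).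
assert (S : forall c (g : R -> R), (forall x, continuous g x) -> forall x, continuous (fun h => c * g h) x)
  by (intros; apply cont_mult; [apply continuous_const|auto]).
assert (L : forall x a1 a2 b1 b2,
  (forall h, cos (ps h - x * h) = cos (ps h) * (1 + a1 * (1 - cos h) + a2 * (1 - cos h) ^ 2)
      + sin (ps h) * (b1 * sin h + b2 * (sin h * (1 - cos h)))) ->
  harm f ps x = U0 + a1 * U1 + a2 * U2 + b1 * W1 + b2 * W2).
{ intros x a1 a2 b1 b2 E; unfold harm, U0, U1, U2, W1, W2.
  assert (G1 := fun x => S a1 _ C1' x). assert (G2 := fun x => S a2 _ C2' x).
  assert (G3 := fun x => S b1 _ D1' x). assert (G4 := fun x => S b2 _ D2' x).
  assert (P1 := fun x => cont_plus _ _ x (C0' x) (G1 x)).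
  assert (P2 := fun x => cont_plus _ _ x (P1 x) (G2 x)).
  assert (P3 := fun x => cont_plus _ _ x (P2 x) (G3 x)).
  rewrite <- (RInt_scal_cont _ a1 _ _ C1'), <- (RInt_scal_cont _ a2 _ _ C2'),
    <- (RInt_scal_cont _ b1 _ _ D1'), <- (RInt_scal_cont _ b2 _ _ D2').
  rewrite <- (RInt_plus_cont _ _ _ _ C0' G1), <- (RInt_plus_cont _ _ _ _ P1 G2),
    <- (RInt_plus_cont _ _ _ _ P2 G3), <- (RInt_plus_cont _ _ _ _ P3 G4).
  apply RInt_ext; intros h _; rewrite E.
  match goal with |- ?a = ?b => change (a = b :> R) end; ring. }
(* With [w = 1 - cos h]: [cos h = 1 - w], [cos (2h) = 1 - 4 w + 2 w^2] and
   [sin (2h) = 2 sin h - 2 w sin h]. *)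
rewrite (L 0 0 0 0 0), (L 1 (-1) 0 1 0), (L (-1) (-1) 0 (-1) 0), (L 2 (-4) 2 2 (-2)), (L (-2) (-4) 2 (-2) 2).
- ring.
- intros h; replace (ps h - -2 * h) with (ps h + 2 * h) by ring.
  rewrite cos_plus, cos_2a_cos, sin_2a; ring.
- intros h; rewrite cos_minus, cos_2a_cos, sin_2a; ring.
- intros h; replace (ps h - -1 * h) with (ps h + h) by ring. rewrite cos_plus; ring.
- intros h; replace (ps h - 1 * h) with (ps h - h) by ring. rewrite cos_minus; ring.
- intros h; replace (ps h - 0 * h) with (ps h) by ring. ring.
Qed.

(** The weight is [4 (1 - cos h)^2], which behaves like [h^4] at [0]: the tail is thus measured in
    the unit of the fourth moment, the size of [U2]. *)
Definition tail (f : R -> R) (d : R) : R := RInt (fun h => f h * (16 * sin (h / 2) ^ 4)) d PI.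

Lemma cont_sin4 (x : R) : continuous (fun h => 16 * sin (h / 2) ^ 4) x.
Proof. apply (ex_derive_continuous (fun h => 16 * sin (h / 2) ^ 4)); auto_derive; exact I. Qed.

Lemma half_sin_lower (d h : R) : 0 < d <= 1 / 50 -> d <= h <= PI -> 999 / 1000 * (d / 2) <= sin (h / 2).
Proof.
intros Hd Hh.
assert (Q := sin_lower (d / 2) ltac:(lra)).
assert (sin (d / 2) <= sin (h / 2)).
{ assert (P := PI_RGT_0). assert (P2 := PI2_1).
  apply sin_incr_1; lra. }
assert ((d / 2) ^ 3 <= (d / 2) / 10000).
{ replace ((d / 2) ^ 3) with ((d / 2) * (d / 2) ^ 2) by ring.
  assert ((d / 2) ^ 2 <= 1 / 10000) by (simpl; nra). nra. }
lra.
Qed.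

Lemma tail_weight (f w : R -> R) (d k : R) : d <= PI ->
  (forall x, 0 < f x) -> (forall x, continuous f x) -> (forall x, continuous w x) ->
  (forall h, d <= h <= PI -> Rabs (w h) <= k * (16 * sin (h / 2) ^ 4)) ->
  Rabs (RInt (fun h => f h * w h) d PI) <= k * tail f d.
Proof.
intros Hd P Cf Cw L; unfold tail.
assert (C4 : forall x, continuous (fun h => f h * (16 * sin (h / 2) ^ 4)) x)
  by (intros; apply cont_mult; [apply Cf|apply cont_sin4]).
rewrite <- RInt_scal_cont by exact C4.
apply RInt_abs_le; trivial.
- intros x; apply cont_mult; [apply Cf|apply Cw].
- intros x; apply cont_mult; [apply continuous_const|apply C4].
- intros x Hx; rewrite Rabs_mult, (Rabs_pos_eq (f x)) by (apply Rlt_le, P).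
  replace (k * (f x * (16 * sin (x / 2) ^ 4))) with (f x * (k * (16 * sin (x / 2) ^ 4))) by ring.
  apply Rmult_le_compat_l; [apply Rlt_le, P|apply L, Hx].
Qed.

(** Each integral is cut at [d]. On [[0, d]] the cubic bound on the phase gives
    [cos >= 1 - c^2 h^6 / 2] and [|sin| <= c h^3]; beyond [d] every weight is a multiple of the
    weight of [tail]. The moments thus occurring have orders 0, 4, 6 and 10. *)
Lemma form_bounds (f ps : R -> R) (c d e : R) :
  0 < d <= 1 / 50 -> 0 <= c -> 0 <= e ->
  (forall x, 0 < f x) -> (forall x, continuous f x) -> (forall x, continuous ps x) ->
  (forall h, 0 <= h <= d -> Rabs (ps h) <= c * h ^ 3) ->
  tail f d <= e * moment f d 4 ->
  let N := moment f d in
  let U0 := RInt (fun h => f h * cos (ps h)) 0 PI in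
  let U2 := RInt (fun h => f h * (cos (ps h) * (1 - cos h) ^ 2)) 0 PI in
  let W1 := RInt (fun h => f h * (sin (ps h) * sin h)) 0 PI in
  let W2 := RInt (fun h => f h * (sin (ps h) * (sin h * (1 - cos h)))) 0 PI in
  N 0%nat - c ^ 2 / 2 * N 6%nat - (101/100) / d ^ 4 * (e * N 4%nat) <= U0 /\
  ((999/1000) * N 4%nat - c ^ 2 / 2 * N 10%nat - e * N 4%nat) / 4 <= U2 <= (1 + e) * N 4%nat / 4 /\
  Rabs W1 <= c * N 4%nat + (101/100) / d ^ 3 * (e * N 4%nat) /\
  Rabs W2 <= c / 2 * N 6%nat + (101/100) / (2 * d) * (e * N 4%nat).
Proof.
intros Hd Hc He P Cf Cp Hps HT N U0 U2 W1 W2.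
assert (HPI : 3 < PI) by (assert (Q := PI2_3_2); lra).
assert (Cc : forall x, continuous (fun h => cos (ps h)) x)
  by (intros; apply (cont_comp ps cos); [apply Cp|apply cont_cos]).
assert (Cs : forall x, continuous (fun h => sin (ps h)) x)
  by (intros; apply (cont_comp ps sin); [apply Cp|apply cont_sin]).
assert (C1 : forall x, continuous (fun h => 1 - cos h) x)
  by (intros; apply cont_minus; [apply continuous_const|apply cont_cos]).
assert (C12 : forall x, continuous (fun h => (1 - cos h) ^ 2) x)
  by (intros; apply (cont_comp (fun h => 1 - cos h) (fun u => u ^ 2)); [apply C1|apply cont_pow]).
assert (V2 : forall x, continuous (fun h => cos (ps h) * (1 - cos h) ^ 2) x)
  by (intros; apply cont_mult; [apply Cc|apply C12]).
assert (V3 : forall x, continuous (fun h => sin (ps h) * sin h) x)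
  by (intros; apply cont_mult; [apply Cs|apply cont_sin]).
assert (V4 : forall x, continuous (fun h => sin (ps h) * (sin h * (1 - cos h))) x)
  by (intros; apply cont_mult; [apply Cs|apply cont_mult; [apply cont_sin|apply C1]]).
assert (F : forall w, (forall x, continuous w x) -> forall x, continuous (fun h => f h * w h) x)
  by (intros; apply cont_mult; [apply Cf|auto]).
assert (M : forall k j x, continuous (fun h => k * (f h * h ^ j)) x)
  by (intros; apply cont_mult; [apply continuous_const|apply cont_mult; [apply Cf|apply cont_pow]]).
assert (Mj : forall j x, continuous (fun h => f h * h ^ j) x)
  by (intros; apply cont_mult; [apply Cf|apply cont_pow]).
assert (Bc : forall x, Rabs (cos x) <= 1) by (intros; apply Rabs_le, COS_bound).
assert (Bs : forall x, Rabs (sin x) <= 1) by (intros; apply Rabs_le, SIN_bound).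
(* On the tail, each weight is compared with 16 sin^4(h/2) through sin(h/2) >= (999/1000) d/2. *)
assert (X : forall h, d <= h <= PI ->
   0 < 999 / 1000 * (d / 2) <= sin (h / 2) /\ 0 <= sin h <= 2 * sin (h / 2) /\
   1 - cos h = 2 * sin (h / 2) ^ 2).
{ intros h Hh; assert (Q := half_sin_lower d h Hd Hh). split; [lra|]. split; [|apply one_minus_cos].
  split; [apply sin_ge_0; lra|].
  replace h with (2 * (h / 2)) at 1 by field. rewrite sin_2a.
  assert (Q1 := COS_bound (h / 2)). nra. }
assert (T0 : Rabs (RInt (fun h => f h * cos (ps h)) d PI) <= (101/100) / d ^ 4 * tail f d).
{ apply tail_weight; trivial; [lra|]. intros h Hh; destruct (X h Hh) as (X1 & _).
  apply Rle_trans with 1; [apply Bc|].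
  set (s := sin (h / 2)) in *.
  assert (Q : (999 / 1000 * (d / 2)) ^ 4 <= s ^ 4) by (apply pow_incr; lra).
  apply Rmult_le_reg_l with (d ^ 4); [apply pow_lt; lra|].
  replace (d ^ 4 * ((101/100) / d ^ 4 * (16 * s ^ 4))) with ((101/100) * 16 * s ^ 4) by (field; lra).
  replace ((999 / 1000 * (d / 2)) ^ 4) with ((999/1000)^4 / 16 * d ^ 4) in Q by field.
  assert (0 <= d ^ 4) by (apply pow_le; lra).
  (* The factor [101/100] is chosen so that its product with [995/1000] exceeds 1. *)
  assert ((995/1000) <= (999/1000)^4) by (simpl; lra). nra. }
assert (T2 : Rabs (RInt (fun h => f h * (cos (ps h) * (1 - cos h) ^ 2)) d PI) <= 1 / 4 * tail f d).
{ apply tail_weight; trivial; [lra|]. intros h Hh; destruct (X h Hh) as (X1 & X2 & X3).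
  rewrite X3, Rabs_mult, (Rabs_pos_eq ((2 * sin (h / 2) ^ 2) ^ 2)) by (apply pow2_ge_0).
  assert (Q := Bc (ps h)). assert (0 <= sin (h / 2) ^ 4) by (apply pow_le; lra).
  replace ((2 * sin (h / 2) ^ 2) ^ 2) with (4 * sin (h / 2) ^ 4) by ring. nra. }
assert (T3 : Rabs (RInt (fun h => f h * (sin (ps h) * sin h)) d PI) <= (101/100) / d ^ 3 * tail f d).
{ apply tail_weight; trivial; [lra|]. intros h Hh; destruct (X h Hh) as (X1 & X2 & X3).
  rewrite Rabs_mult, (Rabs_pos_eq (sin h)) by lra.
  assert (Q0 := Bs (ps h)). set (s := sin (h / 2)) in *.
  assert (Q : (999 / 1000 * (d / 2)) ^ 3 <= s ^ 3) by (apply pow_incr; lra).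
  apply Rle_trans with (2 * s); [assert (0 <= Rabs (sin (ps h))) by apply Rabs_pos; nra|].
  apply Rmult_le_reg_l with (d ^ 3); [apply pow_lt; lra|].
  replace (d ^ 3 * ((101/100) / d ^ 3 * (16 * s ^ 4))) with ((101/100) * 16 * s ^ 3 * s) by (field; lra).
  replace ((999 / 1000 * (d / 2)) ^ 3) with ((999/1000)^3 / 8 * d ^ 3) in Q by field.
  assert (0 <= d ^ 3) by (apply pow_le; lra).
  assert ((996/1000) <= (999/1000)^3) by (simpl; lra).
  replace (d ^ 3 * (2 * s)) with (2 * d ^ 3 * s) by ring.
  apply Rmult_le_compat_r; [lra|]. nra. }
assert (T4 : Rabs (RInt (fun h => f h * (sin (ps h) * (sin h * (1 - cos h)))) d PI)
             <= (101/100) / (2 * d) * tail f d).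
{ apply tail_weight; trivial; [lra|]. intros h Hh; destruct (X h Hh) as (X1 & X2 & X3).
  rewrite X3; set (s := sin (h / 2)) in *.
  rewrite Rabs_mult, (Rabs_pos_eq (sin h * (2 * s ^ 2))) by (apply Rmult_le_pos; [lra|nra]).
  assert (Q0 := Bs (ps h)).
  assert (0 <= s ^ 2) by (apply pow_le; lra).
  apply Rle_trans with (2 * s * (2 * s ^ 2)).
  { assert (0 <= Rabs (sin (ps h))) by apply Rabs_pos.
    assert (0 <= sin h * (2 * s ^ 2) <= 2 * s * (2 * s ^ 2)) by nra. nra. }
  apply Rmult_le_reg_l with d; [lra|].
  replace (d * ((101/100) / (2 * d) * (16 * s ^ 4))) with ((808/100) * s * s ^ 3) by (field; lra).
  replace (d * (2 * s * (2 * s ^ 2))) with (4 * d * s ^ 3) by ring.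
  apply Rmult_le_compat_r; [apply pow_le; lra|]. lra. }
assert (HT0 : (101/100) / d ^ 4 * tail f d <= (101/100) / d ^ 4 * (e * N 4%nat)).
{ apply Rmult_le_compat_l; [|exact HT]. apply Rlt_le, Rdiv_lt_0_compat; [lra|apply pow_lt; lra]. }
assert (HT3 : (101/100) / d ^ 3 * tail f d <= (101/100) / d ^ 3 * (e * N 4%nat)).
{ apply Rmult_le_compat_l; [|exact HT]. apply Rlt_le, Rdiv_lt_0_compat; [lra|apply pow_lt; lra]. }
assert (HT4 : (101/100) / (2 * d) * tail f d <= (101/100) / (2 * d) * (e * N 4%nat)).
{ apply Rmult_le_compat_l; [|exact HT]. apply Rlt_le, Rdiv_lt_0_compat; lra. }
assert (Y : forall h, 0 <= h <= d -> 1 - c ^ 2 / 2 * h ^ 6 <= cos (ps h)).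
{ intros h Hh. assert (Q := cos_lower (ps h)). assert (Q1 := Hps h Hh).
  assert (ps h ^ 2 <= (c * h ^ 3) ^ 2).
  { rewrite <- (pow2_abs (ps h)); apply pow_incr; split; [apply Rabs_pos|exact Q1]. }
  replace ((c * h ^ 3) ^ 2) with (c ^ 2 * h ^ 6) in H by ring. lra. }
assert (Z : forall h, 0 <= h <= d -> Rabs (sin (ps h)) <= c * h ^ 3).
{ intros h Hh; eapply Rle_trans; [apply Rabs_sin_le|apply Hps, Hh]. }
assert (K0 : N 0%nat - c ^ 2 / 2 * N 6%nat <= RInt (fun h => f h * cos (ps h)) 0 d).
{ unfold N, moment; rewrite <- RInt_scal_cont, <- RInt_minus_cont by auto.
  apply RInt_le_cont; [lra| |apply F, Cc|].
  - intros x; apply cont_minus; auto.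
  - intros h Hh; assert (Q := Y h Hh). assert (Pf := P h). simpl pow in Q |- *. nra. }
assert (K2 : ((999/1000) * N 4%nat - c ^ 2 / 2 * N 10%nat) / 4
             <= RInt (fun h => f h * (cos (ps h) * (1 - cos h) ^ 2)) 0 d).
{ replace (((999/1000) * N 4%nat - c ^ 2 / 2 * N 10%nat) / 4)
    with ((999/1000) / 4 * N 4%nat - c ^ 2 / 8 * N 10%nat) by field.
  unfold N, moment; rewrite <- !RInt_scal_cont, <- RInt_minus_cont by auto.
  apply RInt_le_cont; [lra| |apply F, V2|].
  - intros x; apply cont_minus; auto.
  - intros h Hh; assert (Q := Y h Hh). assert (Pf := P h).
    assert (Q1 := one_minus_cos_bounds h). assert (Q2 := cos_upper h ltac:(lra)).
    set (q := 1 - cos h) in *.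
    assert (0 <= h ^ 2 <= 4 / 10000) by (split; [apply pow2_ge_0|simpl; nra]).
    assert (0 <= h ^ 4) by (apply pow_le; lra). assert (0 <= h ^ 6) by (apply pow_le; lra).
    assert (E1 : (999/1000) * h ^ 4 / 4 <= q ^ 2).
    { assert (h ^ 2 / 2 * (9999/10000) <= q).
      { replace (h ^ 4) with (h ^ 2 * h ^ 2) in Q2 by ring. nra. }
      assert ((h ^ 2 / 2 * (9999/10000)) ^ 2 <= q ^ 2) by (apply pow_incr; lra).
      replace ((h ^ 2 / 2 * (9999/10000)) ^ 2) with (h ^ 4 * ((9999/10000) ^ 2 / 4)) in H2 by field.
      assert ((999/1000) / 4 <= (9999/10000) ^ 2 / 4) by (simpl; lra). nra. }
    assert (E2 : q ^ 2 <= h ^ 4 / 4).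
    { assert (q ^ 2 <= (h ^ 2 / 2) ^ 2) by (apply pow_incr; lra).
      replace ((h ^ 2 / 2) ^ 2) with (h ^ 4 / 4) in H2 by field. exact H2. }
    replace ((999/1000) / 4 * (f h * h ^ 4) - c ^ 2 / 8 * (f h * h ^ 10)) with
      (f h * ((999/1000) * h ^ 4 / 4 - c ^ 2 / 2 * h ^ 6 * (h ^ 4 / 4))) by field.
    apply Rmult_le_compat_l; [lra|].
    assert (0 <= c ^ 2 / 2 * h ^ 6) by (apply Rmult_le_pos; [assert (0 <= c ^ 2) by apply pow2_ge_0; lra|lra]).
    assert (0 <= q ^ 2) by apply pow2_ge_0.
    apply Rle_trans with ((1 - c ^ 2 / 2 * h ^ 6) * q ^ 2); [nra|].
    apply Rmult_le_compat_r; lra. }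
assert (K2' : RInt (fun h => f h * (cos (ps h) * (1 - cos h) ^ 2)) 0 d <= 1 / 4 * N 4%nat).
{ unfold N, moment; rewrite <- !RInt_scal_cont by auto.
  apply RInt_le_cont; [lra|apply F, V2|auto|].
  intros h Hh; assert (Pf := P h). assert (Q1 := one_minus_cos_bounds h).
  assert ((1 - cos h) ^ 2 <= (h ^ 2 / 2) ^ 2) by (apply pow_incr; lra).
  assert (0 <= (1 - cos h) ^ 2) by apply pow2_ge_0.
  assert (Q2 := COS_bound (ps h)).
  replace ((h ^ 2 / 2) ^ 2) with (h ^ 4 / 4) in H by field.
  replace (1 / 4 * (f h * h ^ 4)) with (f h * (h ^ 4 / 4)) by field.
  apply Rmult_le_compat_l; [lra|]. nra. }
assert (K3 : Rabs (RInt (fun h => f h * (sin (ps h) * sin h)) 0 d) <= c * N 4%nat).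
{ unfold N, moment; rewrite <- !RInt_scal_cont by auto.
  apply RInt_abs_le; [lra|apply F, V3|auto|].
  intros h Hh; assert (Pf := P h). rewrite !Rabs_mult, (Rabs_pos_eq (f h)) by lra.
  assert (Q := Z h Hh). assert (Q1 := Rabs_sin_le h). rewrite (Rabs_pos_eq h) in Q1 by lra.
  replace (c * (f h * h ^ 4)) with (f h * (c * h ^ 3 * h)) by ring.
  apply Rmult_le_compat_l; [lra|]. apply Rmult_le_compat; trivial; apply Rabs_pos. }
assert (K4 : Rabs (RInt (fun h => f h * (sin (ps h) * (sin h * (1 - cos h)))) 0 d) <= c / 2 * N 6%nat).
{ unfold N, moment; rewrite <- !RInt_scal_cont by auto.
  apply RInt_abs_le; [lra|apply F, V4|auto|].
  intros h Hh; assert (Pf := P h). rewrite !Rabs_mult, (Rabs_pos_eq (f h)) by lra.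
  assert (Q := Z h Hh). assert (Q1 := Rabs_sin_le h). rewrite (Rabs_pos_eq h) in Q1 by lra.
  assert (Q2 := one_minus_cos_bounds h). rewrite (Rabs_pos_eq (1 - cos h)) by lra.
  replace (c / 2 * (f h * h ^ 6)) with (f h * (c * h ^ 3 * (h * (h ^ 2 / 2)))) by field.
  apply Rmult_le_compat_l; [lra|]. apply Rmult_le_compat; trivial; try apply Rabs_pos.
  - apply Rmult_le_pos; [apply Rabs_pos|lra].
  - apply Rmult_le_compat; trivial; try apply Rabs_pos; lra. }
assert (R0 : U0 = RInt (fun h => f h * cos (ps h)) 0 d + RInt (fun h => f h * cos (ps h)) d PI :> R)
  by (apply (RInt_split _ 0 d PI (F _ Cc))).
assert (R2 : U2 = RInt (fun h => f h * (cos (ps h) * (1 - cos h) ^ 2)) 0 d + RInt (fun h => f h * (cos (ps h) * (1 - cos h) ^ 2)) d PI :> R)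
  by (apply (RInt_split _ 0 d PI (F _ V2))).
assert (R3 : W1 = RInt (fun h => f h * (sin (ps h) * sin h)) 0 d + RInt (fun h => f h * (sin (ps h) * sin h)) d PI :> R)
  by (apply (RInt_split _ 0 d PI (F _ V3))).
assert (R4 : W2 = RInt (fun h => f h * (sin (ps h) * (sin h * (1 - cos h)))) 0 d + RInt (fun h => f h * (sin (ps h) * (sin h * (1 - cos h)))) d PI :> R)
  by (apply (RInt_split _ 0 d PI (F _ V4))).
fold N in HT.
apply Rabs_le_between in T0. apply Rabs_le_between in T2.
split; [lra|]. split; [split; lra|]. split.
- rewrite R3; eapply Rle_trans; [apply Rabs_triang|]. lra.
- rewrite R4; eapply Rle_trans; [apply Rabs_triang|]. lra.
Qed.

(** Completing the square in [U1] leaves [4 U2 (U0 - U2/3) + 8 W1 W2 - 4 W2^2]. All terms are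
    compared with [N0 N4]; for this [W2] is bounded both by [w2 N0] and by [w3 N4], so that [W1 W2]
    and [W2^2] each receive one factor of either kind. *)
Lemma form_positive (f ps : R -> R) (c d e n4 n6 n10 m6 : R) :
  0 < d <= 1 / 50 -> 0 <= c -> 0 <= e ->
  (forall x, 0 < f x) -> (forall x, continuous f x) -> (forall x, continuous ps x) ->
  (forall h, 0 <= h <= d -> Rabs (ps h) <= c * h ^ 3) ->
  tail f d <= e * moment f d 4 ->
  0 < moment f d 4 ->
  moment f d 4 <= n4 * moment f d 0 -> moment f d 6 <= n6 * moment f d 0 ->
  moment f d 6 <= m6 * moment f d 4 -> moment f d 10 <= n10 * moment f d 4 ->
  let u0 := 1 - c ^ 2 / 2 * n6 - (101/100) / d ^ 4 * e * n4 in
  let u2 := (999/1000) - c ^ 2 / 2 * n10 - e in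
  let w1 := c + (101/100) / d ^ 3 * e in
  let w2 := c / 2 * n6 + (101/100) / (2 * d) * e * n4 in
  let w3 := c / 2 * m6 + (101/100) / (2 * d) * e in
  0 < u2 ->
  8 * w1 * w2 + 4 * w2 * w3 < u2 * (u0 - (1 + e) * n4 / 12) ->
  0 < harm f ps (-2) * harm f ps 2 - 4 * harm f ps (-1) * harm f ps 1 + 3 * harm f ps 0 ^ 2.
Proof.
intros Hd Hc He P Cf Cp Hps HT N4p H4 H6 H6' H10 u0 u2 w1 w2 w3 Hu2 HH.
destruct (form_bounds f ps c d e Hd Hc He P Cf Cp Hps HT) as (B0 & B2 & B3 & B4).
rewrite (form_expand f ps Cf Cp).
set (U0 := RInt (fun h => f h * cos (ps h)) 0 PI) in *.
set (U1 := RInt (fun h => f h * (cos (ps h) * (1 - cos h))) 0 PI) in *.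
set (U2 := RInt (fun h => f h * (cos (ps h) * (1 - cos h) ^ 2)) 0 PI) in *.
set (W1 := RInt (fun h => f h * (sin (ps h) * sin h)) 0 PI) in *.
set (W2 := RInt (fun h => f h * (sin (ps h) * (sin h * (1 - cos h)))) 0 PI) in *.
change R in (type of U0). change R in (type of U1). change R in (type of U2).
change R in (type of W1). change R in (type of W2).
assert (N0p : 0 <= moment f d 0) by (apply moment_nonneg; trivial; lra).
set (N0 := moment f d 0) in *. set (N4 := moment f d 4) in *.
set (N6 := moment f d 6) in *. set (N10 := moment f d 10) in *.
assert (0 <= c ^ 2 / 2) by (assert (0 <= c ^ 2) by apply pow2_ge_0; lra).
assert (D4 : 0 <= (101/100) / d ^ 4 * e).
{ apply Rmult_le_pos; trivial. apply Rlt_le, Rdiv_lt_0_compat; [lra|apply pow_lt; lra]. }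
assert (D3 : 0 <= (101/100) / d ^ 3 * e).
{ apply Rmult_le_pos; trivial. apply Rlt_le, Rdiv_lt_0_compat; [lra|apply pow_lt; lra]. }
assert (D1 : 0 <= (101/100) / (2 * d) * e).
{ apply Rmult_le_pos; trivial. apply Rlt_le, Rdiv_lt_0_compat; lra. }
assert (E0 : u0 * N0 <= U0).
{ unfold u0. assert (c ^ 2 / 2 * N6 <= c ^ 2 / 2 * (n6 * N0)) by (apply Rmult_le_compat_l; trivial).
  assert ((101/100) / d ^ 4 * e * N4 <= (101/100) / d ^ 4 * e * (n4 * N0)) by (apply Rmult_le_compat_l; trivial).
  lra. }
assert (E2 : u2 * N4 / 4 <= U2).
{ unfold u2. assert (c ^ 2 / 2 * N10 <= c ^ 2 / 2 * (n10 * N4)) by (apply Rmult_le_compat_l; trivial).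
  lra. }
assert (E3 : Rabs W1 <= w1 * N4) by (unfold w1; lra).
assert (E4 : Rabs W2 <= w2 * N0).
{ unfold w2. assert (c / 2 * N6 <= c / 2 * (n6 * N0)) by (apply Rmult_le_compat_l; lra).
  assert ((101/100) / (2 * d) * e * N4 <= (101/100) / (2 * d) * e * (n4 * N0)) by (apply Rmult_le_compat_l; trivial).
  lra. }
assert (E5 : Rabs W2 <= w3 * N4).
{ unfold w3. assert (c / 2 * N6 <= c / 2 * (m6 * N4)) by (apply Rmult_le_compat_l; lra). lra. }
assert (E6 : U2 / 3 <= (1 + e) * n4 / 12 * N0).
{ assert ((1 + e) * N4 <= (1 + e) * (n4 * N0)) by (apply Rmult_le_compat_l; lra). lra. }
assert (N0pp : 0 < N0).
{ destruct (Rle_lt_or_eq_dec _ _ N0p) as [L|L]; [exact L|].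
  rewrite <- L, Rmult_0_r in H4; lra. }
assert (A1 := Rabs_pos W1). assert (A2 := Rabs_pos W2).
assert (Q1 : Rabs W1 * Rabs W2 <= w1 * w2 * (N0 * N4)).
{ apply Rle_trans with ((w1 * N4) * (w2 * N0)); [apply Rmult_le_compat; trivial|]. lra. }
assert (Q2 : Rabs W2 * Rabs W2 <= w2 * w3 * (N0 * N4)).
{ apply Rle_trans with ((w2 * N0) * (w3 * N4)); [apply Rmult_le_compat; trivial|]. lra. }
assert (Q3 : - (W1 * W2) <= Rabs W1 * Rabs W2).
{ rewrite <- Rabs_mult, <- Rabs_Ropp. apply Rle_abs. }
assert (Q4 : W2 ^ 2 = Rabs W2 * Rabs W2) by (rewrite <- (pow2_abs W2); ring).
assert (Q5 : 0 <= 12 * U1 ^ 2 - 16 * U1 * U2 + 16 / 3 * U2 ^ 2).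
{ replace (12 * U1 ^ 2 - 16 * U1 * U2 + 16 / 3 * U2 ^ 2) with (12 * (U1 - 2 / 3 * U2) ^ 2) by field.
  assert (0 <= (U1 - 2 / 3 * U2) ^ 2) by apply pow2_ge_0. lra. }
assert (W2p : 0 <= w2) by (apply Rmult_le_reg_r with N0; lra).
assert (W1p : 0 <= w1) by (unfold w1; lra).
assert (W3p : 0 <= w3) by (apply Rmult_le_reg_r with N4; lra).
assert (G : 0 < u0 - (1 + e) * n4 / 12).
{ assert (0 <= w1 * w2) by (apply Rmult_le_pos; trivial).
  assert (0 <= w2 * w3) by (apply Rmult_le_pos; trivial). nra. }
assert (Q6 : u2 * N4 / 4 * ((u0 - (1 + e) * n4 / 12) * N0) <= U2 * (U0 - U2 / 3)).
{ apply Rmult_le_compat.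
  - assert (0 <= u2 * N4) by (apply Rmult_le_pos; lra). lra.
  - apply Rmult_le_pos; lra.
  - exact E2.
  - lra. }
assert (NN : 0 < N0 * N4) by (apply Rmult_lt_0_compat; trivial).
assert (Q7 := Rmult_lt_compat_r _ _ _ NN HH).
nra.
Qed.

(** * Hyperbolic estimates *)

Lemma exp_upper (w : R) : w <= 1 / 2 -> exp w <= 1 + w + 2 * w ^ 2.
Proof.
intros Hw; assert (Q := exp_ineq1_le (- w)). rewrite exp_Ropp in Q.
assert (P := exp_pos w).
assert (Q1 : exp w * (1 - w) <= 1).
{ replace 1 with (exp w * / exp w) at 2 by (field; lra). apply Rmult_le_compat_l; lra. }
assert (1 <= (1 - w) * (1 + w + 2 * w ^ 2)).
{ replace ((1 - w) * (1 + w + 2 * w ^ 2)) with (1 + w ^ 2 * (1 - 2 * w)) by ring.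
  assert (0 <= w ^ 2) by apply pow2_ge_0. nra. }
assert (0 < 1 + w + 2 * w ^ 2) by nra. nra.
Qed.

Lemma sinh_lower (x : R) : 0 <= x -> x <= exp (x / 2) - exp (- (x / 2)).
Proof.
intros Hx.
assert (D : forall y, is_derive (fun u => exp (u / 2) - exp (- (u / 2)) - u) y
             ((exp (y / 2) + exp (- (y / 2))) / 2 - 1)).
{ intros y; auto_derive; [exact I|]. unfold Rdiv; field. }
assert (Q := is_derive_nondecreasing _ _ 0 x Hx D); cbv beta in Q.
replace (0 / 2) with 0 in Q by field. rewrite Ropp_0, exp_0 in Q.
assert (0 <= exp (x / 2) - exp (- (x / 2)) - x); [|lra].
eapply Rle_trans; [|apply Q]; [lra|].
intros y _; assert (Q1 := exp_ineq1_le (y / 2)). assert (Q2 := exp_ineq1_le (- (y / 2))). lra.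
Qed.

(** The witnesses are [s = 2 sinh (x/2)] and [c = cosh (x/2)], so that [c - s/2 = exp (-x/2)]. The
    algebraic relations are what later [field] computations need, the inequalities what the
    estimates need. *)
Lemma sinh_facts (x : R) : 0 < x <= 1 ->
  exists s c : R, 0 < s /\ x <= s <= x * c /\ 1 <= c <= 1 + x ^ 2 / 2 /\ s ^ 2 = 4 * c ^ 2 - 4 /\
    exp (- x) = (c - s / 2) ^ 2 /\ (c + s / 2) * (c - s / 2) = 1.
Proof.
intros Hx.
set (e := exp (x / 2)). set (i := exp (- (x / 2))).
assert (Ei : e * i = 1) by (unfold e, i; rewrite <- exp_plus, Rplus_opp_r; apply exp_0).
assert (D2 : forall y, is_derive (fun u => u * ((exp (u / 2) + exp (- (u / 2))) / 2)
                                  - (exp (u / 2) - exp (- (u / 2)))) y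
             (y / 4 * (exp (y / 2) - exp (- (y / 2))))).
{ intros y; auto_derive; [exact I|]. unfold Rdiv; field. }
assert (G1 : x <= e - i) by (apply sinh_lower; lra).
assert (G2 : x * ((e + i) / 2) - (e - i) >= 0).
{ assert (Q := is_derive_nondecreasing _ _ 0 x ltac:(lra) D2).
  cbv beta in Q; unfold e, i; replace (0 / 2) with 0 in Q by field. rewrite Ropp_0, exp_0 in Q.
  apply Rle_ge; eapply Rle_trans; [|apply Q]; [lra|].
  intros y Hy. assert (exp (- (y / 2)) <= exp (y / 2)); [|nra].
  destruct (Req_dec y 0) as [->|N]; [right; f_equal; field|].
  apply Rlt_le, exp_increasing; lra. }
exists (e - i), ((e + i) / 2).
assert (U1 := exp_upper (x / 2) ltac:(lra)). assert (U2 := exp_upper (- (x / 2)) ltac:(lra)).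
fold e in U1. fold i in U2.
assert (L1 := exp_ineq1_le (x / 2)). assert (L2 := exp_ineq1_le (- (x / 2))).
fold e in L1. fold i in L2.
split; [lra|]. split; [lra|]. split; [split; nra|]. split; [nra|]. split.
- replace ((e + i) / 2 - (e - i) / 2) with i by field. unfold i.
  simpl; rewrite Rmult_1_r, <- exp_plus; f_equal; field.
- replace ((e + i) / 2 - (e - i) / 2) with i by field.
  replace ((e + i) / 2 + (e - i) / 2) with e by field. exact Ei.
Qed.

(** Eulerian polynomials are palindromic, so at [z = exp (-x)] each [geo_p] is a polynomial in
    [cosh (x/2)] and [s] over [s^(p+1)]. The check substitutes [e = exp (x/2)]. *)
Lemma geo_sinh (c s : R) : 0 < s -> 1 <= c -> s ^ 2 = 4 * c ^ 2 - 4 ->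
  (c + s / 2) * (c - s / 2) = 1 -> let z := (c - s / 2) ^ 2 in
  geo1 z = / s ^ 2 /\ geo2 z = 2 * c / s ^ 3 /\ geo3 z = (s ^ 2 + 6) / s ^ 4
  /\ geo4 z = (8 * c ^ 3 + 16 * c) / s ^ 5.
Proof.
intros Hs Hc E I z.
set (e := c + s / 2) in *. set (i := c - s / 2) in *.
assert (Hi : i = / e) by (apply Rmult_eq_reg_l with e; [rewrite I; field|]; nra).
assert (He : e <> 0) by nra.
assert (Hs' : s = e - i) by (unfold e, i; field).
assert (Hc' : c = (e + i) / 2) by (unfold e, i; field).
assert (Hz : z = / e ^ 2) by (unfold z; rewrite Hi; field; exact He).
assert (N : e ^ 2 - 1 <> 0).
{ intros Q; assert (s * e = 0); [|nra]. rewrite Hs', Rmult_minus_distr_r, (Rmult_comm i), I; lra. }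
assert (Se : s = (e ^ 2 - 1) / e) by (rewrite Hs', Hi; field; exact He).
assert (Ce : c = (e ^ 2 + 1) / (2 * e)) by (rewrite Hc', Hi; field; exact He).
clearbody e i z. rewrite Hz, Se, Ce; unfold geo1, geo2, geo3, geo4.
repeat split; field; repeat split; try exact He; try exact N;
  intros Q; apply N; nra.
Qed.

(** Leading Laurent terms [p! / x^(p+1)] with explicit errors, from [x <= s <= x c] and
    [c <= 1 + x^2/2]. The range of [x] covers [j / u] for [j <= 4] and [u >= 115]. *)
Lemma geo_estimates (x : R) : 0 < x <= 1 / 25 ->
  let z := exp (- x) in
  (/ x ^ 2 - 101/100 <= geo1 z <= / x ^ 2) /\
  (2 / x ^ 3 - 202/100 / x <= geo2 z <= 2 / x ^ 3 + / x) /\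
  (6 / x ^ 4 - 126/10 / x ^ 2 <= geo3 z <= 6 / x ^ 4 + / x ^ 2) /\
  geo4 z <= 24 / x ^ 5 + 48 / x ^ 3.
Proof.
intros Hx z.
destruct (sinh_facts x ltac:(lra)) as (s & c & Hs & Hsx & Hc & E & Ez & I).
destruct (geo_sinh c s Hs ltac:(lra) E I) as (E1 & E2 & E3 & E4).
unfold z; rewrite Ez, E1, E2, E3, E4; clear z Ez E1 E2 E3 E4 I.
assert (X2 : 0 < x ^ 2 <= 1 / 625) by (simpl; nra).
assert (C2 : 1 <= c ^ 2 <= 1 + 101/100 * x ^ 2).
{ split; [nra|]. apply Rle_trans with ((1 + x ^ 2 / 2) ^ 2); [apply pow_incr; lra|]. nra. }
assert (C3 : 1 <= c ^ 3 <= 1 + 2 * x ^ 2).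
{ replace (c ^ 3) with (c * c ^ 2) by ring. split; nra. }
assert (C4 : 1 <= c ^ 4 <= 1 + 21/10 * x ^ 2).
{ replace (c ^ 4) with (c ^ 2 * c ^ 2) by ring. split; nra. }
assert (P : forall n, 0 < x ^ n <= s ^ n /\ s ^ n <= x ^ n * c ^ n).
{ intros n; rewrite <- Rpow_mult_distr. split; [split; [apply pow_lt; lra|apply pow_incr; lra]|apply pow_incr; lra]. }
assert (J : forall n, 0 < / s ^ n <= / x ^ n).
{ intros n; destruct (P n) as ((P1 & P2) & _). split; [apply Rinv_0_lt_compat; lra|].
  apply Rinv_le_contravar; lra. }
assert (LL : forall n u, 1 <= c ^ n <= 1 + u -> 0 <= u -> / x ^ n * (1 - u) <= / s ^ n).
{ intros n u Hu Hu0; destruct (P n) as ((P1 & P2) & P3).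
  apply Rmult_le_reg_l with (s ^ n); [lra|]. rewrite Rinv_r by lra.
  destruct (Rle_lt_dec u 1) as [L|L].
  - apply Rle_trans with (x ^ n * c ^ n * (/ x ^ n * (1 - u))).
    + apply Rmult_le_compat_r; [|exact P3]. apply Rmult_le_pos; [apply Rlt_le, Rinv_0_lt_compat; lra|lra].
    + replace (x ^ n * c ^ n * (/ x ^ n * (1 - u))) with (c ^ n * (1 - u)) by (field; lra). nra.
  - assert (0 < / x ^ n) by (apply Rinv_0_lt_compat; lra).
    assert (0 < s ^ n * / x ^ n) by (apply Rmult_lt_0_compat; lra). nra. }
assert (x <> 0) by lra.
split; [|split; [|split]].
- destruct (J 2%nat) as (J1 & J2). split; [|exact J2].
  assert (Q := LL 2%nat _ C2 ltac:(lra)).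
  replace (/ x ^ 2 * (1 - 101/100 * x ^ 2)) with (/ x ^ 2 - 101/100) in Q by (field; lra). exact Q.
- destruct (J 3%nat) as (J1 & J2). split.
  + destruct (P 3%nat) as ((P1 & P2) & P3).
    assert (Q1 : / x ^ 3 <= c ^ 3 * / s ^ 3).
    { apply Rmult_le_reg_l with (x ^ 3 * s ^ 3); [apply Rmult_lt_0_compat; lra|].
      replace (x ^ 3 * s ^ 3 * / x ^ 3) with (s ^ 3) by (field; lra).
      replace (x ^ 3 * s ^ 3 * (c ^ 3 * / s ^ 3)) with (x ^ 3 * c ^ 3) by (field; lra). exact P3. }
    assert (Q2 : / x ^ 3 * (1 - 101/100 * x ^ 2) <= c * / s ^ 3).
    { apply Rmult_le_reg_l with (c ^ 2); [lra|].
      replace (c ^ 2 * (c * / s ^ 3)) with (c ^ 3 * / s ^ 3) by ring.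
      assert (0 < / x ^ 3) by (apply Rinv_0_lt_compat; lra).
      apply Rle_trans with (/ x ^ 3); [|exact Q1].
      replace (c ^ 2 * (/ x ^ 3 * (1 - 101/100 * x ^ 2))) with (/ x ^ 3 * (c ^ 2 * (1 - 101/100 * x ^ 2))) by ring.
      rewrite <- (Rmult_1_r (/ x ^ 3)) at 2. apply Rmult_le_compat_l; [lra|]. nra. }
    replace (2 / x ^ 3 - 202/100 / x) with (2 * (/ x ^ 3 * (1 - 101/100 * x ^ 2))) by (field; lra).
    unfold Rdiv; lra.
  + replace (2 / x ^ 3 + / x) with (2 * ((1 + x ^ 2 / 2) * / x ^ 3)) by (field; lra).
    replace (2 * c / s ^ 3) with (2 * (c * / s ^ 3)) by (field; lra).
    apply Rmult_le_compat_l; [lra|]. apply Rmult_le_compat; lra.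
- replace ((s ^ 2 + 6) / s ^ 4) with (/ s ^ 2 + 6 * / s ^ 4) by (field; lra).
  destruct (J 2%nat) as (J1 & J2). destruct (J 4%nat) as (J3 & J4). split; [|unfold Rdiv; lra].
  assert (Q := LL 4%nat _ C4 ltac:(lra)).
  replace (6 / x ^ 4 - 126/10 / x ^ 2) with (6 * (/ x ^ 4 * (1 - 21/10 * x ^ 2))) by (field; lra). lra.
- destruct (J 5%nat) as (J1 & J2).
  replace (24 / x ^ 5 + 48 / x ^ 3) with (24 * (1 + 2 * x ^ 2) * / x ^ 5) by (field; lra).
  unfold Rdiv; apply Rmult_le_compat; [|lra| |exact J2].
  + assert (0 <= c ^ 3) by lra. lra.
  + assert (c <= c ^ 3); [|lra]. replace (c ^ 3) with (c * c ^ 2) by ring. nra.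
Qed.

(** * Cumulant sums *)

(** Here and in the next two lemmas the polynomial is a Taylor polynomial at 0 whose last
    coefficient is altered so that both sides agree at [x = 1]; this is the factor [1 - x] in the
    differences. Agreement at 1 matters because [r_k] is near 1 for [k] small against [1/t]. *)
Lemma vr_bounds (x : R) : 0 < x < 1 -> x - 2 * x ^ 2 + 5 / 4 * x ^ 3 <= vr x <= x.
Proof.
intros Hx; unfold vr; assert (0 < (1 + x) ^ 2) by (apply pow_lt; lra). split.
- apply Rmult_le_reg_r with ((1 + x) ^ 2); [lra|].
  replace (x / (1 + x) ^ 2 * (1 + x) ^ 2) with x by (field; lra).
  replace ((x - 2 * x ^ 2 + 5 / 4 * x ^ 3) * (1 + x) ^ 2)
    with (x - x ^ 3 * ((1 - x) * (7 / 4 + 5 / 4 * x))) by field.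
  assert (0 <= x ^ 3) by (apply pow_le; lra). assert (0 <= (1 - x) * (7 / 4 + 5 / 4 * x)) by nra. nra.
- apply Rmult_le_reg_r with ((1 + x) ^ 2); [lra|].
  replace (x / (1 + x) ^ 2 * (1 + x) ^ 2) with x by (field; lra). nra.
Qed.

Lemma wr_bounds (x : R) : 0 < x < 1 -> 0 <= wr x <= x - 4 * x ^ 2 + 9 * x ^ 3 - 6 * x ^ 4.
Proof.
intros Hx; unfold wr; assert (0 < (1 + x) ^ 3) by (apply pow_lt; lra). split.
- apply Rlt_le, Rdiv_lt_0_compat; [nra|lra].
- apply Rmult_le_reg_r with ((1 + x) ^ 3); [lra|].
  replace (x * (1 - x) / (1 + x) ^ 3 * (1 + x) ^ 3) with (x * (1 - x)) by (field; lra).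
  replace ((x - 4 * x ^ 2 + 9 * x ^ 3 - 6 * x ^ 4) * (1 + x) ^ 3)
    with (x * (1 - x) + x ^ 4 * ((1 - x) * (10 + 15 * x + 6 * x ^ 2))) by ring.
  assert (0 <= x ^ 4) by (apply pow_le; lra).
  assert (0 <= (1 - x) * (10 + 15 * x + 6 * x ^ 2)) by (apply Rmult_le_pos; nra). nra.
Qed.

Lemma pr_bound (x : R) : 0 < x < 1 -> x / (1 + x) <= x - x ^ 2 + x ^ 3 - / 2 * x ^ 4.
Proof.
intros Hx; apply Rmult_le_reg_r with (1 + x); [lra|].
replace (x / (1 + x) * (1 + x)) with x by (field; lra).
replace ((x - x ^ 2 + x ^ 3 - / 2 * x ^ 4) * (1 + x)) with (x + x ^ 4 * (1 - x) / 2) by field.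
assert (0 <= x ^ 4) by (apply pow_le; lra). nra.
Qed.

Lemma rem_mono (z z' : R) (K : nat) : 0 < z <= z' -> z' < 1 -> rem z K <= rem z' K.
Proof.
intros Hz Hz'; unfold rem.
assert (0 <= INR K) by apply pos_INR.
assert (0 < z ^ K) by (apply pow_lt; lra).
assert (0 <= (INR K + 1) ^ 3) by (apply pow_le; lra).
assert (0 < (1 - z') ^ 5) by (apply pow_lt; lra).
apply Rmult_le_compat.
- apply Rmult_le_pos; lra.
- apply Rlt_le, Rdiv_lt_0_compat; [lra|apply pow_lt; lra].
- apply Rmult_le_compat_r; [lra|apply pow_incr; lra].
- apply Rmult_le_compat_l; [lra|]. apply Rinv_le_contravar; [lra|apply pow_incr; lra].
Qed.

Lemma exp_neg_lt_1 (x : R) : 0 < x -> 0 < exp (- x) < 1.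
Proof. intros Hx; split; [apply exp_pos|]. rewrite <- exp_0; apply exp_increasing; lra. Qed.

Lemma rem_multiple (t : R) (j K : nat) : 0 < t -> (1 <= j)%nat ->
  rem (exp (- (INR j * t))) K <= rem (exp (- t)) K.
Proof.
intros Ht Hj; assert (1 <= INR j) by (apply (le_INR 1); lia).
apply rem_mono; [split; [apply exp_pos|]|apply exp_neg_lt_1; lra].
destruct (Req_dec (INR j) 1) as [->|N]; [right; f_equal; ring|].
apply Rlt_le, exp_increasing; nra.
Qed.

Lemma sum_rk (t : R) (p j K : nat) :
  sum1 (fun k => INR k ^ p * rk t k ^ j) K = sum1 (fun k => INR k ^ p * exp (- (INR j * t)) ^ k) K.
Proof. apply sum1_ext; intros k _; rewrite rk_pow; reflexivity. Qed.

(** The powers [r_k^j] are geometric with exponent [x = j / u], so [geo_estimates] applies; its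
    error constants are rounded up to absorb [rem]. *)
Lemma power_sum_estimates (u : R) (j K : nat) : 115 <= u -> (1 <= j <= 4)%nat ->
  rem (exp (- / u)) K <= 1 / 1000 ->
  let S p := sum1 (fun k => INR k ^ p * rk (/ u) k ^ j) K in
  (u ^ 2 / INR j ^ 2 - 102/100 <= S 1%nat <= u ^ 2 / INR j ^ 2) /\
  (2 * u ^ 3 / INR j ^ 3 - 203/100 * u / INR j <= S 2%nat <= 2 * u ^ 3 / INR j ^ 3 + u / INR j) /\
  (6 * u ^ 4 / INR j ^ 4 - 127/10 * u ^ 2 / INR j ^ 2 <= S 3%nat <= 6 * u ^ 4 / INR j ^ 4 + u ^ 2 / INR j ^ 2) /\
  S 4%nat <= 24 * u ^ 5 / INR j ^ 5 + 48 * u ^ 3 / INR j ^ 3.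
Proof.
intros Hu Hj Hr S.
assert (Ht : 0 < / u <= / 115) by (split; [apply Rinv_0_lt_compat; lra|apply Rinv_le_contravar; lra]).
assert (J : 1 <= INR j <= 4) by (split; [apply (le_INR 1); lia|replace 4 with (INR 4) by (simpl; lra); apply le_INR; lia]).
set (x := INR j * / u).
assert (Hx : 0 < x <= 1 / 25) by (unfold x; split; nra).
assert (Hr' := rem_multiple (/ u) j K ltac:(lra) ltac:(lia)). fold x in Hr'.
destruct (sum_pow_bounds (exp (- x)) K (exp_neg_lt_1 x ltac:(lra))) as (B1 & B2 & B3 & B4).
destruct (geo_estimates x Hx) as (C1 & C2 & C3 & C4).
unfold S; rewrite !sum_rk; fold x.
rewrite (sum1_ext (fun k => INR k ^ 1 * exp (- x) ^ k) (fun k => INR k * exp (- x) ^ k))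
  by (intros; rewrite pow_1; reflexivity).
replace (/ x ^ 2) with (u ^ 2 / INR j ^ 2) in C1, C3 by (unfold x; field; lra).
replace (2 / x ^ 3) with (2 * u ^ 3 / INR j ^ 3) in C2 by (unfold x; field; lra).
replace (/ x) with (u / INR j) in C2 by (unfold x; field; lra).
replace (202/100 / x) with (202/100 * (u / INR j)) in C2 by (unfold x; field; lra).
replace (6 / x ^ 4) with (6 * u ^ 4 / INR j ^ 4) in C3 by (unfold x; field; lra).
replace (126/10 / x ^ 2) with (126/10 * (u ^ 2 / INR j ^ 2)) in C3 by (unfold x; field; lra).
replace (24 / x ^ 5) with (24 * u ^ 5 / INR j ^ 5) in C4 by (unfold x; field; lra).
replace (48 / x ^ 3) with (48 * u ^ 3 / INR j ^ 3) in C4 by (unfold x; field; lra).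
assert (L1 : 1 <= u / INR j).
{ apply Rmult_le_reg_r with (INR j); [lra|]. replace (u / INR j * INR j) with u by (field; lra). lra. }
assert (L2 : 1 <= u ^ 2 / INR j ^ 2).
{ replace (u ^ 2 / INR j ^ 2) with ((u / INR j) ^ 2) by (field; lra). nra. }
replace (203/100 * u / INR j) with (203/100 * (u / INR j)) by (field; lra).
replace (127/10 * u ^ 2 / INR j ^ 2) with (127/10 * (u ^ 2 / INR j ^ 2)) by (field; lra).
repeat split; lra.
Qed.

Definition sigma2 (t : R) (K : nat) : R := sum1 (fun k => INR k ^ 2 * vr (rk t k)) K.
Definition fourth (t : R) (K : nat) : R := sum1 (fun k => INR k ^ 4 * vr (rk t k)) K.
Definition third (t : R) (K : nat) : R := sum1 (fun k => INR k ^ 3 * wr (rk t k)) K.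

(* As [u] grows the three ratios tend to [pi^2/6], [7 pi^4/30] and [pi^2/2]. *)
Lemma cumulant_estimates (u : R) (K : nat) : 115 <= u -> rem (exp (- / u)) K <= 1 / 1000 ->
  (159/100 * u ^ 3 <= sigma2 (/ u) K <= 2001/1000 * u ^ 3) /\
  fourth (/ u) K <= 24006/1000 * u ^ 5 /\ third (/ u) K <= 503/100 * u ^ 4.
Proof.
intros Hu Hr.
assert (Ht : 0 < / u) by (apply Rinv_0_lt_compat; lra).
assert (HR : forall k, (1 <= k)%nat -> 0 < rk (/ u) k < 1) by (intros; apply rk_bounds; trivial).
destruct (power_sum_estimates u 1 K Hu ltac:(lia) Hr) as (_ & P2 & P3 & P4).
destruct (power_sum_estimates u 2 K Hu ltac:(lia) Hr) as (_ & Q2 & Q3 & _).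
destruct (power_sum_estimates u 3 K Hu ltac:(lia) Hr) as (_ & R2 & R3 & _).
destruct (power_sum_estimates u 4 K Hu ltac:(lia) Hr) as (_ & _ & S3 & _).
set (Z p j := sum1 (fun k => INR k ^ p * rk (/ u) k ^ j) K).
fold (Z 2 1)%nat in P2. fold (Z 3 1)%nat in P3. fold (Z 4 1)%nat in P4. fold (Z 2 2)%nat in Q2. fold (Z 3 2)%nat in Q3.
fold (Z 2 3)%nat in R2. fold (Z 3 3)%nat in R3. fold (Z 3 4)%nat in S3.
replace (INR 1) with 1 in * by reflexivity. replace (INR 2) with 2 in * by (simpl; lra).
replace (INR 3) with 3 in * by (simpl; lra). replace (INR 4) with 4 in * by (simpl; lra).
assert (U2 : 13225 * u <= u ^ 3) by (simpl; nra).
assert (U3 : 13225 * u ^ 3 <= u ^ 5) by (simpl; nra).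
assert (U4 : 13225 * u ^ 2 <= u ^ 4) by (simpl; nra).
(* Leading coefficients: [2 (1 - 2/8 + (5/4)/27) = 1.592..] for [sigma2] from below, and
   [6 (1 - 4/16 + 9/81 - 6/256) = 5.026..] for [third] in [B4]. *)
assert (B1 : Z 2%nat 1%nat + (-2) * Z 2%nat 2%nat + 5 / 4 * Z 2%nat 3%nat <= sigma2 (/ u) K).
{ unfold Z, sigma2; rewrite <- !sum1_scal, <- !sum1_plus; apply sum1_le; intros k Hk.
  destruct (vr_bounds _ (HR k Hk)) as (V & _).
  assert (0 <= INR k ^ 2) by (apply pow_le, pos_INR). rewrite pow_1. nra. }
assert (B2 : sigma2 (/ u) K <= Z 2%nat 1%nat).
{ apply sum1_le; intros k Hk; destruct (vr_bounds _ (HR k Hk)) as (_ & V).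
  rewrite pow_1; apply Rmult_le_compat_l; [apply pow_le, pos_INR|exact V]. }
assert (B3 : fourth (/ u) K <= Z 4%nat 1%nat).
{ apply sum1_le; intros k Hk; destruct (vr_bounds _ (HR k Hk)) as (_ & V).
  rewrite pow_1; apply Rmult_le_compat_l; [apply pow_le, pos_INR|exact V]. }
assert (B4 : third (/ u) K <= Z 3%nat 1%nat + (-4) * Z 3%nat 2%nat + 9 * Z 3%nat 3%nat + (-6) * Z 3%nat 4%nat).
{ unfold Z, third; rewrite <- !sum1_scal, <- !sum1_plus; apply sum1_le; intros k Hk.
  destruct (wr_bounds _ (HR k Hk)) as (_ & V).
  assert (0 <= INR k ^ 3) by (apply pow_le, pos_INR). rewrite pow_1. nra. }
split; [split|split]; lra.
Qed.

(* The exact value is close to [115^2 pi^2/12 = 10877]. *)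
Lemma mean_upper (K : nat) : rem (exp (- / 115)) K <= 1 / 1000 -> mean (/ 115) K <= 10980.
Proof.
intros Hr; assert (Hu : 115 <= 115) by lra.
assert (HR : forall k, (1 <= k)%nat -> 0 < rk (/ 115) k < 1) by (intros; apply rk_bounds; trivial; lra).
destruct (power_sum_estimates 115 1 K Hu ltac:(lia) Hr) as (P & _).
destruct (power_sum_estimates 115 2 K Hu ltac:(lia) Hr) as (Q & _).
destruct (power_sum_estimates 115 3 K Hu ltac:(lia) Hr) as (R & _).
destruct (power_sum_estimates 115 4 K Hu ltac:(lia) Hr) as (S & _).
set (Z p j := sum1 (fun k => INR k ^ p * rk (/ 115) k ^ j) K).
fold (Z 1 1)%nat in P. fold (Z 1 2)%nat in Q. fold (Z 1 3)%nat in R. fold (Z 1 4)%nat in S.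
replace (INR 1) with 1 in * by reflexivity. replace (INR 2) with 2 in * by (simpl; lra).
replace (INR 3) with 3 in * by (simpl; lra). replace (INR 4) with 4 in * by (simpl; lra).
(* The leading term is [115^2 (1 - 1/4 + 1/9 - 1/32)], just below [10975]. *)
assert (B : mean (/ 115) K <= Z 1%nat 1%nat + (-1) * Z 1%nat 2%nat + Z 1%nat 3%nat + (- / 2) * Z 1%nat 4%nat).
{ unfold Z, mean; rewrite <- !sum1_scal, <- !sum1_plus; apply sum1_le; intros k Hk.
  assert (V := pr_bound _ (HR k Hk)). assert (0 <= INR k) by apply pos_INR. rewrite !pow_1. nra. }
lra.
Qed.

(** * The central arc [0 <= h <= 2t/5] *)

Lemma exp_mono (x y : R) : x <= y -> exp x <= exp y.
Proof. intros [H| ->]; [apply Rlt_le, exp_increasing, H|lra]. Qed.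

Lemma ln_upper (y : R) : 0 < y -> ln y <= y - 1.
Proof.
intros Hy; rewrite <- (ln_exp (y - 1)). apply ln_le; [exact Hy|].
assert (Q := exp_ineq1_le (y - 1)); lra.
Qed.

Lemma ln_lower (y : R) : 0 < y -> - (/ y - 1) <= ln y.
Proof.
intros Hy; assert (Q := ln_upper (/ y) (Rinv_0_lt_compat _ Hy)). rewrite ln_Rinv in Q by exact Hy. lra.
Qed.

(** Here [vr (exp (-x)) = 1 / (2 cosh (x/2))^2]. With [a = exp (x/4)] and [b = 1/a], one has [2 cosh
    (x/2) = (a - b)^2 + 2 >= 2 + x^2/4], whose square is at least [2 x^2]. *)
Lemma vr_exp_sq (x : R) : 0 <= x -> vr (exp (- x)) * x ^ 2 <= 1 / 2.
Proof.
intros Hx; assert (Q := sinh_lower (x / 2) ltac:(lra)).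
set (a := exp (x / 2 / 2)) in *. set (b := exp (- (x / 2 / 2))) in *.
assert (Pa : 0 < a) by apply exp_pos. assert (Pb : 0 < b) by apply exp_pos.
assert (I : a * b = 1) by (unfold a, b; rewrite <- exp_plus, Rplus_opp_r; apply exp_0).
assert (E : exp (- x) = b ^ 4).
{ unfold b; rewrite exp_pow_nat; f_equal; simpl; field. }
assert (C : 2 + x ^ 2 / 4 <= a ^ 2 + b ^ 2).
{ assert ((x / 2) ^ 2 <= (a - b) ^ 2) by (apply pow_incr; lra).
  replace ((a - b) ^ 2) with (a ^ 2 + b ^ 2 - 2 * (a * b)) in H by ring. rewrite I in H.
  replace ((x / 2) ^ 2) with (x ^ 2 / 4) in H by field. lra. }
assert (C2 : 2 * x ^ 2 <= (a ^ 2 + b ^ 2) ^ 2).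
{ apply Rle_trans with ((2 + x ^ 2 / 4) ^ 2).
  { assert (0 <= (x ^ 2 / 4 - 2) ^ 2) by apply pow2_ge_0.
    replace ((2 + x ^ 2 / 4) ^ 2) with (2 * x ^ 2 + (x ^ 2 / 4 - 2) ^ 2) by field. lra. }
  apply pow_incr; split; [nra|exact C]. }
rewrite E; unfold vr.
assert (0 < b ^ 4) by (apply pow_lt; lra).
assert (V : b ^ 4 / (1 + b ^ 4) ^ 2 = / (a ^ 2 + b ^ 2) ^ 2).
{ replace a with (/ b) by (apply Rmult_eq_reg_r with b; [rewrite I; field|]; lra).
  field; repeat split; nra. }
rewrite V. assert (0 < (a ^ 2 + b ^ 2) ^ 2) by (apply pow_lt; nra).
set (q := (a ^ 2 + b ^ 2) ^ 2) in *.
apply Rmult_le_reg_l with q; [lra|].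
replace (q * (/ q * x ^ 2)) with (x ^ 2) by (field; lra). lra.
Qed.

Lemma vr_pos (x : R) : 0 < x -> 0 < vr x.
Proof. intros; apply Rdiv_lt_0_compat; [lra|apply pow_lt; lra]. Qed.

(** Uniform in [k], even where [k h] is large: [1 - dn <= vr (k h)^2 <= (4/25) vr (t k)^2], and
    [vr_exp_sq] bounds this by [2/25]. *)
Lemma dn_center (t : R) (k : nat) (h : R) : 0 < t -> (1 <= k)%nat -> 0 <= h <= 2 / 5 * t ->
  92/100 <= dn (rk t k) (INR k * h) <= 1.
Proof.
intros Ht Hk Hh; unfold dn.
assert (Hr := rk_bounds t k Ht Hk). assert (Hv := vr_pos (rk t k) ltac:(lra)).
assert (Q := one_minus_cos_bounds (INR k * h)).
assert (K1 : 1 <= INR k) by (apply (le_INR 1); lia).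
assert (V := vr_exp_sq (t * INR k) ltac:(nra)). fold (rk t k) in V.
assert (B : vr (rk t k) * (INR k * h) ^ 2 <= 4 / 25 * (vr (rk t k) * (t * INR k) ^ 2)).
{ replace (4 / 25 * (vr (rk t k) * (t * INR k) ^ 2)) with (vr (rk t k) * (INR k * (2 / 5 * t)) ^ 2) by field.
  apply Rmult_le_compat_l; [lra|]. apply pow_incr; split; [nra|]. nra. }
assert (vr (rk t k) * (1 - cos (INR k * h)) <= vr (rk t k) * ((INR k * h) ^ 2 / 2))
  by (apply Rmult_le_compat_l; lra).
assert (0 <= vr (rk t k) * (1 - cos (INR k * h))) by (apply Rmult_le_pos; lra).
split; lra.
Qed.

Lemma sin_div_lower (a D : R) : 0 <= a -> 92/100 <= D <= 1 -> a - a ^ 3 / 6 <= sin a / D.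
Proof.
intros Ha HD; assert (Q := sin_lower a Ha).
assert (I : 1 <= / D <= 100/92).
{ split; [rewrite <- Rinv_1; apply Rinv_le_contravar; lra|].
  replace (100/92) with (/ (92/100)) by field. apply Rinv_le_contravar; lra. }
(* Division by [D < 1] lowers a negative sine, but then [a > 3] and the cubic is already below
   [-3/2], less than [-100/92]. *)
unfold Rdiv. destruct (Rle_lt_dec 0 (sin a)) as [L|L]; [nra|].
assert (a > 3).
{ apply Rnot_le_gt; intros C. assert (0 <= sin a); [|lra].
  apply sin_ge_0; [lra|]. assert (B := PI2_3_2). lra. }
assert (B := SIN_bound a). assert (a - a ^ 3 * / 6 <= -3/2) by (simpl; nra). nra.
Qed.

Lemma decay_lower (t : R) (K : nat) (h : R) : 0 < t -> 0 <= h <= 2 / 5 * t ->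
  sigma2 t K * h - fourth t K / 6 * h ^ 3 <= decay t K h.
Proof.
intros Ht Hh.
replace (sigma2 t K * h - fourth t K / 6 * h ^ 3) with
  (sum1 (fun k => h * (INR k ^ 2 * vr (rk t k)) + (- (h ^ 3 / 6)) * (INR k ^ 4 * vr (rk t k))) K)
  by (rewrite sum1_plus, !sum1_scal; unfold sigma2, fourth; field).
apply sum1_le; intros k Hk.
assert (Hr := rk_bounds t k Ht Hk). assert (Hv := vr_pos (rk t k) ltac:(lra)).
assert (K1 : 1 <= INR k) by (apply (le_INR 1); lia).
assert (Q := sin_div_lower (INR k * h) _ ltac:(nra) (dn_center t k h Ht Hk Hh)).
replace (h * (INR k ^ 2 * vr (rk t k)) + - (h ^ 3 / 6) * (INR k ^ 4 * vr (rk t k))) with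
  (INR k * vr (rk t k) * (INR k * h - (INR k * h) ^ 3 / 6)) by field.
apply Rmult_le_compat_l; [apply Rmult_le_pos; lra|exact Q].
Qed.

Lemma drift_upper (t : R) (K : nat) (h : R) : 0 < t -> 0 <= h <= 2 / 5 * t ->
  0 <= drift t K h <= third t K / 2 * (100/92) * h ^ 2.
Proof.
intros Ht Hh.
assert (X : forall k, (1 <= k)%nat ->
  0 <= INR k * wr (rk t k) * ((1 - cos (INR k * h)) / dn (rk t k) (INR k * h))
    <= (/ 2 * (100/92) * h ^ 2) * (INR k ^ 3 * wr (rk t k))).
{ intros k Hk.
  assert (Hr := rk_bounds t k Ht Hk). assert (Hw := wr_bounds (rk t k) Hr).
  assert (K1 : 1 <= INR k) by (apply (le_INR 1); lia).
  assert (HD := dn_center t k h Ht Hk Hh). set (D := dn _ _) in *.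
  assert (Q := one_minus_cos_bounds (INR k * h)).
  assert (I : 0 < / D <= 100/92).
  { split; [apply Rinv_0_lt_compat; lra|].
    replace (100/92) with (/ (92/100)) by field. apply Rinv_le_contravar; lra. }
  assert (B : 0 <= (1 - cos (INR k * h)) / D <= (INR k * h) ^ 2 / 2 * (100/92)).
  { unfold Rdiv; split; [apply Rmult_le_pos; lra|]. apply Rmult_le_compat; lra. }
  assert (0 <= INR k * wr (rk t k)) by (apply Rmult_le_pos; lra).
  split; [apply Rmult_le_pos; lra|].
  replace (/ 2 * (100 / 92) * h ^ 2 * (INR k ^ 3 * wr (rk t k))) with
    (INR k * wr (rk t k) * ((INR k * h) ^ 2 / 2 * (100/92))) by field.
  apply Rmult_le_compat_l; lra. }
split; [apply sum1_nonneg; intros; apply X; trivial|].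
replace (third t K / 2 * (100 / 92) * h ^ 2) with ((/ 2 * (100/92) * h ^ 2) * third t K) by field.
unfold third; rewrite <- sum1_scal. apply sum1_le; intros; apply X; trivial.
Qed.

Lemma phase_0 (t : R) (K : nat) : phase t K 0 = 0.
Proof.
unfold phase; induction K as [|K IH]; cbn [sum1]; trivial.
rewrite IH, Rmult_0_r, sin_0, Rmult_0_r. unfold Rdiv; rewrite Rmult_0_l, atan_0; ring.
Qed.

(** The derivative of the centred phase is [- drift], and [drift] lies between 0 and [3 c h^2];
    hence both [c h^3 + psi] and [c h^3 - psi] are nondecreasing from 0. *)
Lemma phase_center (t : R) (K : nat) (h : R) : 0 < t -> 0 <= h <= 2 / 5 * t ->
  Rabs (phase t K h - mean t K * h) <= third t K / 6 * (100/92) * h ^ 3.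
Proof.
intros Ht Hh.
set (c := third t K / 6 * (100/92)).
assert (D1 : forall x, is_derive (fun u => c * u ^ 3 - (phase t K u - mean t K * u)) x
               (3 * c * x ^ 2 + drift t K x)).
{ intros x. replace (3 * c * x ^ 2 + drift t K x) with
    (minus (3 * c * x ^ 2) (minus (mean t K - drift t K x) (mean t K)))
    by (unfold minus, plus, opp; simpl; ring).
  apply (is_derive_minus (V := R_NormedModule) (fun u => c * u ^ 3)).
  - auto_derive; [exact I|ring].
  - apply (is_derive_minus (V := R_NormedModule) (phase t K)); [apply is_derive_phase; exact Ht|].
    auto_derive; [exact I|ring]. }
assert (D2 : forall x, is_derive (fun u => c * u ^ 3 + (phase t K u - mean t K * u)) x
               (3 * c * x ^ 2 - drift t K x)).
{ intros x. replace (3 * c * x ^ 2 - drift t K x) with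
    (plus (3 * c * x ^ 2) (minus (mean t K - drift t K x) (mean t K)))
    by (unfold minus, plus, opp; simpl; ring).
  apply (is_derive_plus (V := R_NormedModule) (fun u => c * u ^ 3)).
  - auto_derive; [exact I|ring].
  - apply (is_derive_minus (V := R_NormedModule) (phase t K)); [apply is_derive_phase; exact Ht|].
    auto_derive; [exact I|ring]. }
assert (B : forall x, 0 <= x <= h -> 0 <= drift t K x <= 3 * c * x ^ 2).
{ intros x Hx; assert (Q := drift_upper t K x Ht ltac:(lra)). unfold c; lra. }
assert (Q1 := is_derive_nondecreasing _ _ 0 h ltac:(lra) D1).
assert (Q2 := is_derive_nondecreasing _ _ 0 h ltac:(lra) D2).
cbv beta in Q1, Q2; rewrite phase_0 in Q1, Q2.
assert (Q1' := Q1 ltac:(intros x Hx; assert (T := B x Hx); lra)).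
assert (Q2' := Q2 ltac:(intros x Hx; assert (T := B x Hx); lra)).
apply Rabs_le; lra.
Qed.

Lemma modulus_lower (t : R) (K : nat) (h : R) : 0 < t -> 0 <= h <= 2 / 5 * t ->
  exp (- (sigma2 t K / 2 * (100/92) * h ^ 2)) <= modulus t K h.
Proof.
intros Ht Hh; unfold modulus.
apply Rle_trans with (exp (sum1 (fun k => (- (/ 2 * (100/92) * h ^ 2)) * (INR k ^ 2 * vr (rk t k))) K)).
- right; f_equal; rewrite sum1_scal; unfold sigma2; field.
- apply exp_mono, sum1_le; intros k Hk.
  assert (Hr := rk_bounds t k Ht Hk). assert (Hv := vr_pos (rk t k) ltac:(lra)).
  assert (HD := dn_center t k h Ht Hk Hh).
  assert (L := ln_lower (dn (rk t k) (INR k * h)) ltac:(lra)).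
  assert (Q := one_minus_cos_bounds (INR k * h)).
  assert (B : 1 - dn (rk t k) (INR k * h) <= vr (rk t k) * (INR k * h) ^ 2).
  { unfold dn. assert (vr (rk t k) * (1 - cos (INR k * h)) <= vr (rk t k) * ((INR k * h) ^ 2 / 2))
      by (apply Rmult_le_compat_l; lra). lra. }
  set (D := dn _ _) in *.
  assert (I : 0 < / D <= 100/92).
  { split; [apply Rinv_0_lt_compat; lra|].
    replace (100/92) with (/ (92/100)) by field. apply Rinv_le_contravar; lra. }
  assert ((1 - D) * / D <= vr (rk t k) * (INR k * h) ^ 2 * (100/92)) by (apply Rmult_le_compat; lra).
  replace (/ D - 1) with ((1 - D) * / D) in L by (field; lra).
  replace (- (/ 2 * (100 / 92) * h ^ 2) * (INR k ^ 2 * vr (rk t k))) with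
    (- (vr (rk t k) * (INR k * h) ^ 2 * (100/92)) / 2) by field.
  lra.
Qed.

(** * Minor arcs *)

(* The full sum of [z^k (1 - cos (k h))], where [w = 1 - cos h]. *)
Definition Bz (z w : R) : R := z * (1 + z) * w / ((1 - z) * ((1 - z) ^ 2 + 2 * z * w)).

Lemma cos_sum (z h : R) (K : nat) : 0 < z < 1 ->
  sum1 (fun k => z ^ k * cos (INR k * h)) K =
  (z * cos h - z ^ 2 - z ^ (S K) * cos (INR (S K) * h) + z ^ (S (S K)) * cos (INR K * h))
  / (1 - 2 * z * cos h + z ^ 2).
Proof.
intros Hz.
assert (D : 0 < 1 - 2 * z * cos h + z ^ 2) by (assert (H := COS_bound h); nra).
induction K as [|K IH].
- simpl. rewrite Rmult_1_l, Rmult_0_l, cos_0. field; nra.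
- cbn [sum1]; rewrite IH.
  assert (E : cos (INR (S (S K)) * h) = 2 * cos h * cos (INR (S K) * h) - cos (INR K * h)).
  { rewrite (S_INR (S K)).
    replace (INR K * h) with (INR (S K) * h - h) by (rewrite S_INR; ring).
    replace ((INR (S K) + 1) * h) with (INR (S K) * h + h) by ring.
    rewrite cos_plus, cos_minus; ring. }
  rewrite E; simpl pow; field; nra.
Qed.

Lemma versine_sum (z h : R) (K : nat) : 0 < z < 1 ->
  Rabs (sum1 (fun k => z ^ k * (1 - cos (INR k * h))) K - Bz z (1 - cos h)) <= rem z K.
Proof.
intros Hz.
assert (HC := COS_bound h).
set (D := 1 - 2 * z * cos h + z ^ 2).
assert (HD : (1 - z) ^ 2 <= D) by (unfold D; nra).
assert (P1 : 0 < (1 - z) ^ 2) by (apply pow_lt; lra).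
rewrite (sum1_ext _ (fun k => z ^ k + (-1) * (z ^ k * cos (INR k * h)))) by (intros; ring).
rewrite sum1_plus, sum1_scal, cos_sum, sum_pow0 by lra. fold D.
set (a := cos (INR (S K) * h)). set (b := cos (INR K * h)).
assert (Ha : -1 <= a <= 1) by apply COS_bound. assert (Hb : -1 <= b <= 1) by apply COS_bound.
assert (E : geo0 z - z ^ K * geo0 z + -1 * ((z * cos h - z ^ 2 - z ^ S K * a + z ^ S (S K) * b) / D)
            - Bz z (1 - cos h) = z ^ K * (- geo0 z + (z * a - z ^ 2 * b) / D)).
{ unfold geo0, Bz. replace ((1 - z) ^ 2 + 2 * z * (1 - cos h)) with D by (unfold D; ring).
  simpl pow. unfold D. field. split; [unfold D in HD; nra|lra]. }
rewrite E, Rabs_mult, (Rabs_pos_eq (z ^ K)) by (apply pow_le; lra).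
unfold rem. rewrite Rmult_assoc. apply Rmult_le_compat_l; [apply pow_le; lra|].
assert (K1 : 1 <= (INR K + 1) ^ 3).
{ assert (0 <= INR K) by apply pos_INR. apply pow_R1_Rle; lra. }
assert (P5 : 0 < (1 - z) ^ 5) by (apply pow_lt; lra).
assert (C5 : 24 / (1 - z) ^ 5 <= (INR K + 1) ^ 3 * (24 / (1 - z) ^ 5)).
{ assert (0 < 24 / (1 - z) ^ 5) by (apply Rdiv_lt_0_compat; lra). nra. }
eapply Rle_trans; [|exact C5].
assert (I1 : geo0 z <= / (1 - z) ^ 5).
{ unfold geo0. apply Rmult_le_reg_r with ((1 - z) ^ 5); [exact P5|]. rewrite Rinv_l by lra.
  replace (z / (1 - z) * (1 - z) ^ 5) with (z * (1 - z) ^ 4) by (field; lra).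
  assert (0 <= (1 - z) ^ 4 <= 1) by (split; [apply pow_le; lra|rewrite <- (pow1 4); apply pow_incr; lra]). nra. }
assert (I0 : 0 <= geo0 z) by (apply Rlt_le, Rdiv_lt_0_compat; lra).
assert (I2 : / D <= / (1 - z) ^ 5).
{ apply Rinv_le_contravar; [exact P5|]. apply Rle_trans with ((1 - z) ^ 2); [|exact HD].
  replace ((1 - z) ^ 5) with ((1 - z) ^ 2 * (1 - z) ^ 3) by ring.
  assert (0 <= (1 - z) ^ 3 <= 1) by (split; [apply pow_le; lra|rewrite <- (pow1 3); apply pow_incr; lra]). nra. }
assert (I3 : 0 < / D) by (apply Rinv_0_lt_compat; lra).
assert (N : -2 <= z * a - z ^ 2 * b <= 2).
{ assert (0 <= z ^ 2 <= 1) by (simpl; nra). split; nra. }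
unfold Rdiv. apply Rabs_le.
assert (-2 * / D <= (z * a - z ^ 2 * b) * / D <= 2 * / D) by (split; apply Rmult_le_compat_r; lra).
split; lra.
Qed.

(** For [w = 1 - cos h] the variable [Y] is [(sin (h/2) / sinh (t/2))^2]. Doubling and tripling the
    argument multiply [sinh (t/2)] by [2 c] and [4 c^2 - 1], so all three sums depend on [h] through
    [Y] alone. *)
Lemma Bz_sinh (c s w : R) : 0 < s -> 1 <= c -> 0 <= w -> s ^ 2 = 4 * c ^ 2 - 4 ->
  (c + s / 2) * (c - s / 2) = 1 -> let z := (c - s / 2) ^ 2 in let Y := 2 * w / s ^ 2 in
  s * Bz z w = c * Y / (1 + Y) /\
  s * (2 * Bz (z ^ 2) w) = (2 * c ^ 2 - 1) / c * Y / (4 * c ^ 2 + Y) /\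
  s * Bz (z ^ 3) w = c * (4 * c ^ 2 - 3) * Y / ((4 * c ^ 2 - 1) * ((4 * c ^ 2 - 1) ^ 2 + Y)).
Proof.
intros Hs Hc Hw E I z Y.
set (e := c + s / 2) in *. set (i := c - s / 2) in *.
assert (Hi : i = / e) by (apply Rmult_eq_reg_l with e; [rewrite I; field|]; nra).
assert (He : 1 < e) by (unfold e; lra).
assert (Hs' : s = e - i) by (unfold e, i; field).
assert (Hc' : c = (e + i) / 2) by (unfold e, i; field).
assert (Hz : z = / e ^ 2) by (unfold z; rewrite Hi; field; lra).
assert (N : 0 < e ^ 2 - 1) by nra.
assert (Se : s = (e ^ 2 - 1) / e) by (rewrite Hs', Hi; field; lra).
assert (Ce : c = (e ^ 2 + 1) / (2 * e)) by (rewrite Hc', Hi; field; lra).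
unfold Y; clearbody e i z. rewrite Hz, Se, Ce; unfold Bz.
assert (0 < e ^ 2) by nra. assert (0 < e ^ 4) by (apply pow_lt; lra). assert (0 < e ^ 6) by (apply pow_lt; lra).
assert (1 < e ^ 4) by nra. assert (1 < e ^ 6) by nra.
assert (0 <= e ^ 2 * w) by nra. assert (0 <= e ^ 4 * w) by nra. assert (0 <= e ^ 6 * w) by nra.
repeat split; field; repeat split; nra.
Qed.

(** From [ln y <= y - 1] and the cubic minorant of [vr]. The slack [1/200] covers the three
    truncation errors [(1 + 2 + 5/4) / 1000]. *)
Lemma modulus_upper (t : R) (K : nat) (h : R) : 0 < t -> rem (exp (- t)) K <= 1 / 1000 ->
  let z := exp (- t) in let w := 1 - cos h in
  modulus t K h <= exp (- (Bz z w - 2 * Bz (z ^ 2) w + 5 / 4 * Bz (z ^ 3) w - 1 / 200)).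
Proof.
intros Ht Hr z w; unfold modulus; apply exp_mono.
set (V j := sum1 (fun k => exp (- (INR j * t)) ^ k * (1 - cos (INR k * h))) K).
assert (X : forall j, (1 <= j)%nat -> Rabs (V j - Bz (z ^ j) w) <= 1 / 1000).
{ intros j Hj. replace (z ^ j) with (exp (- (INR j * t)))
    by (unfold z; rewrite exp_pow_nat; f_equal; ring).
  eapply Rle_trans; [apply versine_sum, exp_neg_lt_1|].
  - assert (1 <= INR j) by (apply (le_INR 1); lia). nra.
  - eapply Rle_trans; [apply rem_multiple; trivial|exact Hr]. }
assert (X1 := X 1%nat ltac:(lia)). assert (X2 := X 2%nat ltac:(lia)). assert (X3 := X 3%nat ltac:(lia)).
rewrite pow_1 in X1. apply Rabs_le_between in X1, X2, X3.
assert (L : sum1 (fun k => ln (dn (rk t k) (INR k * h)) / 2) K <= (-1) * V 1%nat + 2 * V 2%nat + (- (5 / 4)) * V 3%nat).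
{ unfold V; rewrite <- !sum1_scal, <- !sum1_plus; apply sum1_le; intros k Hk.
  assert (Hk' := rk_bounds t k Ht Hk). rewrite <- !rk_pow, pow_1.
  assert (Q := ln_upper _ (dn_pos (rk t k) (INR k * h) Hk')). unfold dn at 2 in Q.
  assert (Q1 := vr_bounds (rk t k) Hk'). assert (Q2 := one_minus_cos_bounds (INR k * h)).
  set (r := rk t k) in *. set (q := 1 - cos (INR k * h)) in *.
  assert ((r - 2 * r ^ 2 + 5 / 4 * r ^ 3) * q <= vr r * q) by (apply Rmult_le_compat_r; lra).
  lra. }
lra.
Qed.

(** [H] is the limit [c = 1] of the previous exponent multiplied by [s], its constants relaxed to
    allow [c] slightly above 1. The thresholds lie just below the squares of [2/5], [1/2], [3/4] and
    [3/2]. *)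
Lemma profile_lower (Y : R) : 0 <= Y ->
  let H := Y / (1 + Y) - 10002/10000 * Y / (4 + Y) + 5 / 4 * (Y / (3001/1000 * (901/100 + Y))) in
  (1598/10000 <= Y -> 106/1000 <= H) /\ (249/1000 <= Y -> 151/1000 <= H) /\
  (56/100 <= Y -> 251/1000 <= H) /\ (224/100 <= Y -> 404/1000 <= H).
Proof.
intros HY H.
set (D := (1 + Y) * (4 + Y) * (901/100 + Y)).
assert (HD : 0 < D) by (unfold D; repeat apply Rmult_lt_0_compat; lra).
assert (E : forall g, H - g = (Y * (4 + Y) * (901/100 + Y) - 10002/10000 * Y * (1 + Y) * (901/100 + Y)
   + 1250/3001 * Y * (1 + Y) * (4 + Y) - g * D) / D).
{ intros g; unfold H, D; field; lra. }
assert (X : forall g, 0 <= Y * (4 + Y) * (901/100 + Y) - 10002/10000 * Y * (1 + Y) * (901/100 + Y)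
   + 1250/3001 * Y * (1 + Y) * (4 + Y) - g * D -> g <= H).
{ intros g Hg. assert (0 <= H - g); [|lra]. rewrite E.
  apply Rmult_le_pos; [exact Hg|apply Rlt_le, Rinv_0_lt_compat, HD]. }
repeat split; intros L; apply X; unfold D.
- set (w := Y - 1598/10000). replace Y with (1598/10000 + w) by (unfold w; ring).
  assert (0 <= w) by (unfold w; lra). assert (0 <= w * w) by nra. assert (0 <= w * w * w) by nra. nra.
- set (w := Y - 249/1000). replace Y with (249/1000 + w) by (unfold w; ring).
  assert (0 <= w) by (unfold w; lra). assert (0 <= w * w) by nra. assert (0 <= w * w * w) by nra. nra.
- set (w := Y - 56/100). replace Y with (56/100 + w) by (unfold w; ring).
  assert (0 <= w) by (unfold w; lra). assert (0 <= w * w) by nra. assert (0 <= w * w * w) by nra. nra.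
- set (w := Y - 224/100). replace Y with (224/100 + w) by (unfold w; ring).
  assert (0 <= w) by (unfold w; lra). 
  (* Here the shifted cubic has a negative quadratic coefficient; this product, with double root
     near the minimum, compensates for it. *)
  assert (0 <= w * (w - 20) ^ 2) by (apply Rmult_le_pos; [lra|apply pow2_ge_0]). nra.
Qed.

(** As [h] grows from [a / u] to [PI], [Y] stays above about [a^2], so each bound holds on the whole
    remaining range. The four values of [a] are the cut points of the tail. *)
Lemma modulus_minor (u : R) (K : nat) (h a : R) : 115 <= u -> rem (exp (- / u)) K <= 1 / 1000 ->
  0 <= a <= 3 / 2 -> a * / u <= h <= PI ->
  (a = 2 / 5 -> modulus (/ u) K h <= exp (- (105/1000 * u))) /\
  (a = 1 / 2 -> modulus (/ u) K h <= exp (- (15/100 * u))) /\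
  (a = 3 / 4 -> modulus (/ u) K h <= exp (- (25/100 * u))) /\
  (a = 3 / 2 -> modulus (/ u) K h <= exp (- (403/1000 * u))).
Proof.
intros Hu Hr Ha Hh.
set (t := / u) in *.
assert (Ht : 0 < t <= / 115) by (unfold t; split; [apply Rinv_0_lt_compat; lra|apply Rinv_le_contravar; lra]).
assert (M := modulus_upper t K h ltac:(lra) Hr). cbv zeta in M.
set (w := 1 - cos h) in *.
assert (Hw : (a * t) ^ 2 / 2 - (a * t) ^ 4 / 24 <= w).
{ assert (PP := PI2_3_2). apply Rle_trans with (1 - cos (a * t)); [apply cos_upper; nra|].
  unfold w; assert (cos h <= cos (a * t)); [|lra].
  destruct (Req_dec h (a * t)) as [->|N]; [lra|]. apply Rlt_le, cos_decreasing_1; nra. }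
assert (Hw0 : 0 <= w) by (apply one_minus_cos_bounds).
destruct (sinh_facts t ltac:(lra)) as (s & c & Hs & Hst & Hc & E & Ez & I).
destruct (Bz_sinh c s w Hs ltac:(lra) Hw0 E I) as (E1 & E2 & E3).
rewrite Ez in M. set (z := (c - s / 2) ^ 2) in *. set (Y := 2 * w / s ^ 2) in *.
assert (T2 : t ^ 2 <= 1 / 13225) by (simpl; nra).
assert (Hc1 : c <= 1 + 1 / 26450) by lra.
assert (Hs1 : s <= 10001/10000 * t) by nra.
assert (S2 : 0 < s ^ 2 <= 10003/10000 * t ^ 2) by (split; [apply pow_lt; lra|simpl; nra]).
assert (HY : 999/1000 * a ^ 2 <= Y).
{ unfold Y. apply Rmult_le_reg_r with (s ^ 2); [lra|].
  replace (2 * w / s ^ 2 * s ^ 2) with (2 * w) by (field; lra).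
  assert (A4 : (a * t) ^ 4 <= a ^ 2 * t ^ 2 / 5000).
  { replace ((a * t) ^ 4) with (a ^ 2 * t ^ 2 * (a ^ 2 * t ^ 2)) by ring.
    assert (0 <= a ^ 2 <= 9 / 4) by (simpl; nra). assert (0 <= t ^ 2) by (simpl; nra).
    assert (0 <= a ^ 2 * t ^ 2 <= 1 / 5000) by (split; nra). nra. }
  replace ((a * t) ^ 2) with (a ^ 2 * t ^ 2) in Hw by ring.
  assert (0 <= a ^ 2) by (simpl; nra). assert (0 <= a ^ 2 * t ^ 2) by (apply Rmult_le_pos; simpl; nra).
  apply Rle_trans with (999/1000 * (10003/10000) * (a ^ 2 * t ^ 2)); [|lra].
  replace (999/1000 * (10003/10000) * (a ^ 2 * t ^ 2)) with (999/1000 * a ^ 2 * (10003/10000 * t ^ 2)) by ring.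
  apply Rmult_le_compat_l; lra. }
assert (Y0 : 0 <= Y) by (assert (0 <= a ^ 2) by (simpl; nra); lra).
assert (C2 : 1 <= c ^ 2 <= 1 + 1 / 10000) by (split; simpl; nra).
assert (F1 : Y / (1 + Y) <= s * Bz z w).
{ rewrite E1. replace (c * Y / (1 + Y)) with (c * (Y / (1 + Y))) by (field; lra).
  assert (0 <= Y / (1 + Y)) by (apply Rmult_le_pos; [lra|apply Rlt_le, Rinv_0_lt_compat; lra]). nra. }
assert (F2 : s * (2 * Bz (z ^ 2) w) <= 10002/10000 * Y / (4 + Y)).
{ rewrite E2. unfold Rdiv. apply Rmult_le_compat.
  - apply Rmult_le_pos; [apply Rmult_le_pos; [lra|apply Rlt_le, Rinv_0_lt_compat; lra]|lra].
  - apply Rlt_le, Rinv_0_lt_compat; lra.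
  - apply Rmult_le_compat_r; [lra|].
    apply Rmult_le_reg_r with c; [lra|]. rewrite Rmult_assoc, Rinv_l by lra. nra.
  - apply Rinv_le_contravar; lra. }
assert (F3 : Y / (3001/1000 * (901/100 + Y)) <= s * Bz (z ^ 3) w).
{ rewrite E3. unfold Rdiv.
  assert (0 < 4 * c ^ 2 - 1 <= 3001/1000) by lra.
  assert ((4 * c ^ 2 - 1) ^ 2 <= 901/100) by (simpl; nra).
  assert (0 < (4 * c ^ 2 - 1) ^ 2) by (apply pow_lt; lra).
  apply Rmult_le_compat; trivial.
  - apply Rlt_le, Rinv_0_lt_compat, Rmult_lt_0_compat; lra.
  - assert (1 <= c * (4 * c ^ 2 - 3)) by nra. nra.
  - apply Rinv_le_contravar; [apply Rmult_lt_0_compat; lra|]. apply Rmult_le_compat; lra. }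
assert (P := profile_lower Y Y0). cbv zeta in P.
set (H := Y / (1 + Y) - 10002 / 10000 * Y / (4 + Y) + 5 / 4 * (Y / (3001 / 1000 * (901 / 100 + Y)))) in *.
(* The factor [9998/10000] pays for [s u <= 10001/10000], and [5/100000] times [u >= 115] exceeds
   the slack [1/200]. *)
assert (G : forall g g', 0 < g <= 1 -> g <= H -> g' <= 9998/10000 * g - 5 / 100000 -> 
  modulus t K h <= exp (- (g' * u))).
{ intros g g' Hg1 Hg Hg'. eapply Rle_trans; [exact M|]. apply exp_mono.
  set (EE := Bz z w - 2 * Bz (z ^ 2) w + 5 / 4 * Bz (z ^ 3) w).
  assert (HE : g <= s * EE) by (unfold EE; unfold H in Hg; lra).
  assert (u * t = 1) by (unfold t; field; lra).
  assert (Q : s * u <= 10001/10000).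
  { replace (10001/10000) with (10001/10000 * t * u) by (rewrite Rmult_assoc, (Rmult_comm t), H0; ring).
    apply Rmult_le_compat_r; lra. }
  assert (EP : 0 < EE) by (apply Rmult_lt_reg_l with s; lra).
  assert (g * u <= EE * (s * u)).
  { replace (EE * (s * u)) with (s * EE * u) by ring. apply Rmult_le_compat_r; lra. }
  assert (EE * (s * u) <= EE * (10001/10000)) by (apply Rmult_le_compat_l; lra).
  assert (g' * u <= (9998/10000 * g - 5 / 100000) * u) by (apply Rmult_le_compat_r; lra).
  fold EE. lra. }
destruct P as (P1 & P2 & P3 & P4).
repeat split; intros ->.
- apply (G (106/1000)); [lra|apply P1; simpl in HY; lra|lra].
- apply (G (151/1000)); [lra|apply P2; simpl in HY; lra|lra].
- apply (G (251/1000)); [lra|apply P3; simpl in HY; lra|lra].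
- apply (G (404/1000)); [lra|apply P4; simpl in HY; lra|lra].
Qed.

(** * Numerical bounds on the exponential, by repeated squaring with rounding *)

Lemma exp_double_lower (x a b : R) : a <= exp x -> 0 <= a -> b <= a ^ 2 -> b <= exp (2 * x).
Proof.
intros Ha Ha0 Hb; replace (2 * x) with (x + x) by ring; rewrite exp_plus.
apply Rle_trans with (1 := Hb). simpl; rewrite Rmult_1_r. apply Rmult_le_compat; lra.
Qed.

Lemma exp_double_upper (x a b : R) : exp x <= a -> a ^ 2 <= b -> exp (2 * x) <= b.
Proof.
intros Ha Hb; replace (2 * x) with (x + x) by ring; rewrite exp_plus.
apply Rle_trans with (2 := Hb). simpl; rewrite Rmult_1_r.
assert (0 < exp x) by apply exp_pos. apply Rmult_le_compat; lra.
Qed.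

Lemma exp_1_lower : 27/10 <= exp 1.
Proof.
assert (L0 : 1 + / 128 <= exp (/ 128)) by apply exp_ineq1_le.
assert (L1 := exp_double_lower _ _ (1015686/1000000) L0 ltac:(lra) ltac:(simpl; lra)).
assert (L2 := exp_double_lower _ _ (103161/100000) L1 ltac:(lra) ltac:(simpl; lra)).
assert (L3 := exp_double_lower _ _ (106421/100000) L2 ltac:(lra) ltac:(simpl; lra)).
assert (L4 := exp_double_lower _ _ (11325/10000) L3 ltac:(lra) ltac:(simpl; lra)).
assert (L5 := exp_double_lower _ _ (12825/10000) L4 ltac:(lra) ltac:(simpl; lra)).
assert (L6 := exp_double_lower _ _ (1644/1000) L5 ltac:(lra) ltac:(simpl; lra)).
assert (L7 := exp_double_lower _ _ (27/10) L6 ltac:(lra) ltac:(simpl; lra)).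
replace 1 with (2 * (2 * (2 * (2 * (2 * (2 * (2 * / 128))))))) by field. exact L7.
Qed.

(** [2128/1000] bounds the exponent in [modulus_lower] at [h = 15 t^2] when [t <= 1/115]. It equals
    [2^7] times [16625/1000000], hence seven squarings. *)
Lemma exp_2128_upper : exp (2128/1000) <= 856/100.
Proof.
assert (L0 : exp (16625/1000000) <= 10169061/10000000).
{ assert (Q := exp_ineq1_le (- (16625/1000000))). rewrite exp_Ropp in Q.
  assert (P := exp_pos (16625/1000000)).
  assert (exp (16625/1000000) * (1 + - (16625/1000000)) <= 1).
  { replace 1 with (exp (16625/1000000) * / exp (16625/1000000)) at 2 by (field; lra).
    apply Rmult_le_compat_l; lra. }
  lra. }
assert (L1 := exp_double_upper _ _ (1034099/1000000) L0 ltac:(simpl; lra)).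
assert (L2 := exp_double_upper _ _ (1069362/1000000) L1 ltac:(simpl; lra)).
assert (L3 := exp_double_upper _ _ (1143536/1000000) L2 ltac:(simpl; lra)).
assert (L4 := exp_double_upper _ _ (1307675/1000000) L3 ltac:(simpl; lra)).
assert (L5 := exp_double_upper _ _ (1710015/1000000) L4 ltac:(simpl; lra)).
assert (L6 := exp_double_upper _ _ (2924152/1000000) L5 ltac:(simpl; lra)).
assert (L7 := exp_double_upper _ _ (856/100) L6 ltac:(simpl; lra)).
replace (2128/1000) with (2 * (2 * (2 * (2 * (2 * (2 * (2 * (16625/1000000)))))))) by field. exact L7.
Qed.

Lemma exp_neg_upper (x : R) (n : nat) : INR n <= x -> exp (- x) <= / (27/10) ^ n.
Proof.
intros H; rewrite exp_Ropp; apply Rinv_le_contravar; [apply pow_lt; lra|].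
apply Rle_trans with (exp 1 ^ n); [apply pow_incr; assert (Q := exp_1_lower); lra|].
rewrite exp_pow_nat, Rmult_1_r. apply exp_mono, H.
Qed.

(** The function [u^p exp (- a u)] decreases once [a u >= p]; the proof uses [u/x <= exp (u/x - 1)].
    It reduces all tail estimates to [u = 115]. *)
Lemma pow_exp_decay (a u x : R) (p : nat) : 0 < x <= u -> INR p <= a * x ->
  u ^ p * exp (- (a * u)) <= x ^ p * exp (- (a * x)).
Proof.
intros Hx Hp.
assert (Q : (u / x) ^ p <= exp (a * (u - x))).
{ apply Rle_trans with (exp (u / x - 1) ^ p).
  - apply pow_incr; split.
    + apply Rmult_le_pos; [lra|apply Rlt_le, Rinv_0_lt_compat; lra].
    + assert (E := exp_ineq1_le (u / x - 1)); lra.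
  - rewrite exp_pow_nat; apply exp_mono.
    replace (INR p * (u / x - 1)) with (INR p / x * (u - x)) by (field; lra).
    apply Rmult_le_compat_r; [lra|]. apply Rmult_le_reg_r with x; [lra|].
    replace (INR p / x * x) with (INR p) by (field; lra). lra. }
replace (u ^ p) with (x ^ p * (u / x) ^ p).
2:{ rewrite <- Rpow_mult_distr; f_equal; field; lra. }
replace (- (a * x)) with (a * (u - x) + - (a * u)) by ring.
rewrite exp_plus, Rmult_assoc. apply Rmult_le_compat_l; [apply pow_le; lra|].
apply Rmult_le_compat_r; [apply Rlt_le, exp_pos|exact Q].
Qed.

(** * The fourth moment against the tail, and positivity of the form *)

Lemma modulus_pos (t : R) (K : nat) (h : R) : 0 < modulus t K h.
Proof. apply exp_pos. Qed.

Lemma decay_center (u : R) (K : nat) (h : R) : 115 <= u -> rem (exp (- / u)) K <= 1 / 1000 ->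
  0 <= h <= 2 / 5 * / u -> 159/100 * u ^ 3 * h - 4001/1000 * u ^ 5 * h ^ 3 <= decay (/ u) K h.
Proof.
intros Hu Hr Hh; assert (Ht : 0 < / u) by (apply Rinv_0_lt_compat; lra).
destruct (cumulant_estimates u K Hu Hr) as (S & F & _).
eapply Rle_trans; [|apply decay_lower; trivial].
assert (0 <= h ^ 3) by (apply pow_le; lra).
assert (159/100 * u ^ 3 * h <= sigma2 (/ u) K * h) by (apply Rmult_le_compat_r; lra).
assert (fourth (/ u) K / 6 * h ^ 3 <= 4001/1000 * u ^ 5 * h ^ 3) by (apply Rmult_le_compat_r; lra).
lra.
Qed.

(** The modulus decreases on [[0, 2t/5]], so the moment is at least [f a * a^5 / 5] for any [a]
    there. The true order is [t^(15/2)]; the weaker [t^10] avoids half-integer powers and suffices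
    against an exponentially small tail. *)
Lemma moment4_lower (u : R) (K : nat) : 115 <= u -> rem (exp (- / u)) K <= 1 / 1000 ->
  17742 * (/ u) ^ 10 <= moment (modulus (/ u) K) (2 / 5 * / u) 4.
Proof.
intros Hu Hr. set (t := / u) in *. set (f := modulus t K). set (d := 2 / 5 * t).
assert (Ht : 0 < t <= / 115) by (unfold t; split; [apply Rinv_0_lt_compat; lra|apply Rinv_le_contravar; lra]).
assert (ut : u * t = 1) by (unfold t; field; lra).
assert (Cf : forall x, continuous f x) by (intros; apply continuous_modulus; lra).
assert (C4 : forall x, continuous (fun h => f h * h ^ 4) x)
  by (intros; apply cont_mult; [apply Cf|apply cont_pow]).
(* The Gaussian width is of order [t^(3/2)]; at [t = 1/115] this [a] is comparable with it, and for
   smaller [t] it is below it. *)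
set (a := 15 * t ^ 2).
assert (Ha : 0 < a <= d) by (unfold a, d; split; simpl; nra).
assert (Em : moment f d 4 = RInt (fun h => f h * h ^ 4) 0 a + RInt (fun h => f h * h ^ 4) a d :> R)
  by (apply (RInt_split _ 0 a d C4)).
rewrite Em.
assert (P1 : 0 <= RInt (fun h => f h * h ^ 4) a d).
{ apply RInt_nonneg; trivial; [lra|]. intros x Hx; apply Rmult_le_pos; [apply Rlt_le, modulus_pos|apply pow_le; lra]. }
assert (Fa : / (856/100) <= f a).
{ eapply Rle_trans; [|apply modulus_lower; [lra|fold d; lra]].
  destruct (cumulant_estimates u K Hu Hr) as (S & _). fold t in S.
  apply Rle_trans with (exp (- (2128/1000))).
  - rewrite exp_Ropp. apply Rinv_le_contravar; [apply exp_pos|apply exp_2128_upper].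
  - apply exp_mono, Ropp_le_contravar.
    apply Rle_trans with (2001/1000 * u ^ 3 / 2 * (100/92) * a ^ 2).
    + apply Rmult_le_compat_r; [apply pow2_ge_0|]. lra.
    + unfold a. replace (2001/1000 * u ^ 3 / 2 * (100/92) * (15 * t ^ 2) ^ 2) with
        (2001/2000 * (100/92) * 225 * (u * t) ^ 3 * t) by field. rewrite ut. simpl; lra. }
assert (Mono : forall h, 0 <= h <= a -> f a <= f h).
{ intros h Hh.
  assert (D : forall x, is_derive (fun v => - f v) x (decay t K x * f x)).
  { intros x; replace (decay t K x * f x) with (opp (- (decay t K x * f x))) by (unfold opp; simpl; ring).
    apply (is_derive_opp (V := R_NormedModule)), is_derive_modulus; lra. }
  assert (Q := is_derive_nondecreasing (fun v => - f v) _ h a ltac:(lra) D). cbv beta in Q.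
  assert (- f h <= - f a); [|lra]. apply Q. intros x Hx.
  apply Rmult_le_pos; [|apply Rlt_le, modulus_pos].
  eapply Rle_trans; [|apply decay_center; trivial; fold t d; lra].
  replace (159/100 * u ^ 3 * x - 4001/1000 * u ^ 5 * x ^ 3) with
    (u ^ 3 * x * (159/100 - 4001/1000 * (u * x) ^ 2)) by ring.
  assert (0 <= u * x <= 2 / 5).
  { split; [nra|]. apply Rle_trans with (u * d); [apply Rmult_le_compat_l; lra|unfold d; nra]. }
  apply Rmult_le_pos; [apply Rmult_le_pos; [apply pow_le; lra|lra]|]. simpl; nra. }
assert (P2 : f a * (a ^ 5 / 5) <= RInt (fun h => f h * h ^ 4) 0 a).
{ assert (E : RInt (fun h => f a * h ^ 4) 0 a = f a * (a ^ 5 / 5) :> R).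
  { apply is_RInt_unique.
    replace (f a * (a ^ 5 / 5)) with (minus (f a * (a ^ 5 / 5)) (f a * (0 ^ 5 / 5)))
      by (unfold minus, plus, opp; simpl; field).
    apply (is_RInt_derive (fun h => f a * (h ^ 5 / 5))).
    - intros x _; auto_derive; [exact I|]. field.
    - intros x _; apply cont_mult; [apply continuous_const|apply cont_pow]. }
  rewrite <- E; apply RInt_le_cont; [lra| |exact C4|].
  - intros x; apply cont_mult; [apply continuous_const|apply cont_pow].
  - intros x Hx; apply Rmult_le_compat_r; [apply pow_le; lra|apply Mono; lra]. }
assert (0 < t ^ 10) by (apply pow_lt; lra).
assert (/ (856/100) * (a ^ 5 / 5) <= f a * (a ^ 5 / 5)).
{ apply Rmult_le_compat_r; [|exact Fa]. assert (0 <= a ^ 5) by (apply pow_le; lra). lra. }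
replace (/ (856/100) * (a ^ 5 / 5)) with (15 ^ 5 / 5 * (100/856) * t ^ 10) in H0 by (unfold a; field).
simpl (15 ^ 5) in H0. lra.
Qed.

(** The range is cut at [t/2], [3t/4] and [3t/2]. On the first three arcs the weight is at most
    [h^4] and yields a factor [t^5]; on the last it is bounded by 16. *)
Lemma tail_upper (u : R) (K : nat) : 115 <= u -> rem (exp (- / u)) K <= 1 / 1000 ->
  tail (modulus (/ u) K) (2 / 5 * / u) <= 8/100 * moment (modulus (/ u) K) (2 / 5 * / u) 4.
Proof.
intros Hu Hr.
assert (M4 := moment4_lower u K Hu Hr).
set (t := / u) in *. set (f := modulus t K) in *.
assert (Ht : 0 < t <= / 115) by (unfold t; split; [apply Rinv_0_lt_compat; lra|apply Rinv_le_contravar; lra]).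
assert (ut : u * t = 1) by (unfold t; field; lra).
assert (HPI : 3 < PI <= 4) by (assert (Q := PI2_3_2); assert (Q1 := PI_4); lra).
assert (Cf : forall x, continuous f x) by (intros; apply continuous_modulus; lra).
set (g := fun h => f h * (16 * sin (h / 2) ^ 4)).
assert (Cg : forall x, continuous g x) by (intros; apply cont_mult; [apply Cf|apply cont_sin4]).
assert (S4 : forall h, 0 <= h -> 0 <= 16 * sin (h / 2) ^ 4 <= h ^ 4 /\ 16 * sin (h / 2) ^ 4 <= 16).
{ intros h Hh. replace (sin (h / 2) ^ 4) with (Rabs (sin (h / 2)) ^ 4).
  2:{ replace 4%nat with (2 * 2)%nat by reflexivity. rewrite !pow_mult, pow2_abs; reflexivity. }
  assert (Q := Rabs_sin_le (h / 2)). rewrite (Rabs_pos_eq (h / 2)) in Q by lra.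
  assert (Q0 := Rabs_pos (sin (h / 2))).
  assert (Q1 : Rabs (sin (h / 2)) <= 1) by (apply Rabs_le, SIN_bound).
  assert (0 <= Rabs (sin (h / 2)) ^ 4) by (apply pow_le; lra).
  assert (Rabs (sin (h / 2)) ^ 4 <= (h / 2) ^ 4) by (apply pow_incr; lra).
  assert (Rabs (sin (h / 2)) ^ 4 <= 1 ^ 4) by (apply pow_incr; lra).
  rewrite pow1 in H1. replace ((h / 2) ^ 4) with (h ^ 4 / 16) in H0 by field. lra. }
assert (X : forall a b m, 0 <= a <= b -> (forall h, a <= h <= b -> f h <= m) ->
  RInt g a b <= (b - a) * (m * b ^ 4) /\ RInt g a b <= (b - a) * (m * 16)).
{ intros a b m Hab Hm; split; apply RInt_upper; trivial; try lra; intros h Hh; unfold g;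
    destruct (S4 h ltac:(lra)) as (Q1 & Q2); apply Rmult_le_compat; trivial;
    try (apply Rlt_le, modulus_pos); try lra; try (apply Hm; lra).
  assert (h ^ 4 <= b ^ 4) by (apply pow_incr; lra). lra. }
unfold tail; fold g.
rewrite (RInt_split g _ (1 / 2 * t) _ Cg), (RInt_split g (1 / 2 * t) (3 / 4 * t) _ Cg),
  (RInt_split g (3 / 4 * t) (3 / 2 * t) _ Cg).
destruct (X (2 / 5 * t) (1 / 2 * t) (exp (- (105/1000 * u))) ltac:(lra)) as (T1 & _).
{ intros h Hh; apply (modulus_minor u K h (2 / 5)); trivial; fold t; lra. }
destruct (X (1 / 2 * t) (3 / 4 * t) (exp (- (15/100 * u))) ltac:(lra)) as (T2 & _).
{ intros h Hh; apply (modulus_minor u K h (1 / 2)); trivial; fold t; lra. }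
destruct (X (3 / 4 * t) (3 / 2 * t) (exp (- (25/100 * u))) ltac:(lra)) as (T3 & _).
{ intros h Hh; apply (modulus_minor u K h (3 / 4)); trivial; fold t; lra. }
destruct (X (3 / 2 * t) PI (exp (- (403/1000 * u))) ltac:(lra)) as (_ & T4).
{ intros h Hh; apply (modulus_minor u K h (3 / 2)); trivial; fold t; lra. }
(* Exponentials are turned into powers of [t] to match the [t^10] of the fourth moment: [p = 5] on
   the arcs that already carry [t^5], [p = 10] on the last one. *)
assert (D : forall a p n, INR p <= a * 115 -> INR n <= a * 115 ->
   exp (- (a * u)) <= 115 ^ p * / (27/10) ^ n * t ^ p).
{ intros a p n Hp Hn. assert (Q := pow_exp_decay a u 115 p ltac:(lra) Hp).
  assert (Q1 := exp_neg_upper (a * 115) n Hn).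
  replace (exp (- (a * u))) with (u ^ p * exp (- (a * u)) * t ^ p).
  2:{ replace (u ^ p * exp (- (a * u)) * t ^ p) with ((u ^ p * t ^ p) * exp (- (a * u))) by ring.
      rewrite <- Rpow_mult_distr, ut, pow1; ring. }
  apply Rmult_le_compat_r; [apply pow_le; lra|].
  eapply Rle_trans; [exact Q|]. apply Rmult_le_compat_l; [apply pow_le; lra|exact Q1]. }
assert (D1 := D (105/1000) 5%nat 12%nat ltac:(simpl; lra) ltac:(simpl; lra)).
assert (D2 := D (15/100) 5%nat 17%nat ltac:(simpl; lra) ltac:(simpl; lra)).
assert (D3 := D (25/100) 5%nat 28%nat ltac:(simpl; lra) ltac:(simpl; lra)).
assert (D4 := D (403/1000) 10%nat 46%nat ltac:(simpl; lra) ltac:(simpl; lra)).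
assert (T5 : 0 < t ^ 5) by (apply pow_lt; lra).
assert (T10 : 0 < t ^ 10) by (apply pow_lt; lra).
assert (N1 : 115 ^ 5 * / (27/10) ^ 12 <= 134100).
{ apply Rmult_le_reg_r with ((27/10) ^ 12); [apply pow_lt; lra|].
  rewrite Rmult_assoc, Rinv_l by (apply pow_nonzero; lra). simpl; lra. }
assert (N2 : 115 ^ 5 * / (27/10) ^ 17 <= 950).
{ apply Rmult_le_reg_r with ((27/10) ^ 17); [apply pow_lt; lra|].
  rewrite Rmult_assoc, Rinv_l by (apply pow_nonzero; lra). simpl; lra. }
assert (N3 : 115 ^ 5 * / (27/10) ^ 28 <= 1/10).
{ apply Rmult_le_reg_r with ((27/10) ^ 28); [apply pow_lt; lra|].
  rewrite Rmult_assoc, Rinv_l by (apply pow_nonzero; lra). simpl; lra. }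
assert (N4 : 115 ^ 10 * / (27/10) ^ 46 <= 59/10).
{ apply Rmult_le_reg_r with ((27/10) ^ 46); [apply pow_lt; lra|].
  rewrite Rmult_assoc, Rinv_l by (apply pow_nonzero; lra). simpl; lra. }
assert (W : forall e c n p, e <= c * t ^ p -> c <= n -> 0 < t ^ p -> e <= n * t ^ p).
{ intros e c n p He Hn Hp. eapply Rle_trans; [exact He|]. apply Rmult_le_compat_r; lra. }
apply (W _ _ _ _ D1) in N1; [|exact T5]. apply (W _ _ _ _ D2) in N2; [|exact T5].
apply (W _ _ _ _ D3) in N3; [|exact T5]. apply (W _ _ _ _ D4) in N4; [|exact T10].
set (e1 := exp (- (105/1000 * u))) in *. set (e2 := exp (- (15/100 * u))) in *.
set (e3 := exp (- (25/100 * u))) in *. set (e4 := exp (- (403/1000 * u))) in *.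
replace ((1 / 2 * t - 2 / 5 * t) * (e1 * (1 / 2 * t) ^ 4)) with (1 / 160 * (t ^ 5 * e1)) in T1 by field.
replace ((3 / 4 * t - 1 / 2 * t) * (e2 * (3 / 4 * t) ^ 4)) with (81 / 1024 * (t ^ 5 * e2)) in T2 by field.
replace ((3 / 2 * t - 3 / 4 * t) * (e3 * (3 / 2 * t) ^ 4)) with (243 / 64 * (t ^ 5 * e3)) in T3 by field.
assert (Z : forall e n, e <= n * t ^ 5 -> t ^ 5 * e <= n * t ^ 10).
{ intros e n He. replace (n * t ^ 10) with (t ^ 5 * (n * t ^ 5)) by ring. apply Rmult_le_compat_l; lra. }
apply Z in N1. apply Z in N2. apply Z in N3.
assert (0 < e4) by apply exp_pos.
assert (T4' : RInt g (3 / 2 * t) PI <= 64 * e4).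
{ eapply Rle_trans; [exact T4|].
  replace (64 * e4) with (4 * (e4 * 16)) by ring. apply Rmult_le_compat_r; lra. }
(* The four contributions, in units of [t^10], are about 838, 75, 0.4 and 378, below
   [8/100 * 17742]. *)
lra.
Qed.

Lemma harm_form_positive (u : R) (K : nat) : 115 <= u -> rem (exp (- / u)) K <= 1 / 1000 ->
  let f := modulus (/ u) K in let ps := fun h => phase (/ u) K h - mean (/ u) K * h in
  0 < harm f ps (-2) * harm f ps 2 - 4 * harm f ps (-1) * harm f ps 1 + 3 * harm f ps 0 ^ 2.
Proof.
intros Hu Hr f ps.
assert (HT := tail_upper u K Hu Hr). assert (M4 := moment4_lower u K Hu Hr).
fold f in HT, M4. set (t := / u) in *. set (d := 2 / 5 * t) in *.
assert (Ht : 0 < t <= / 115) by (unfold t; split; [apply Rinv_0_lt_compat; lra|apply Rinv_le_contravar; lra]).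
assert (ut : u * t = 1) by (unfold t; field; lra).
assert (Cf : forall x, continuous f x) by (intros; apply continuous_modulus; lra).
assert (Pf : forall x, 0 < f x) by (intros; apply modulus_pos).
assert (Cps : forall x, continuous ps x).
{ intros x; apply cont_minus; [apply continuous_phase; lra|].
  apply cont_mult; [apply continuous_const|apply continuous_id]. }
set (b := 4001/1000 * u ^ 5). set (s := 159/100 * u ^ 3).
assert (ut3 : u ^ 3 * t ^ 3 = 1) by (rewrite <- Rpow_mult_distr, ut, pow1; reflexivity).
(* [159/100 - (4001/1000) (4/25) = 94984/100000], since [u d = 2/5]. *)
assert (Hs : s - b * d ^ 2 = 94984/100000 * u ^ 3).
{ unfold s, b, d. replace (4001 / 1000 * u ^ 5 * (2 / 5 * t) ^ 2) with
    (4001/1000 * 4 / 25 * u ^ 3 * (u * t) ^ 2) by field. rewrite ut; field. }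
assert (U3 : 0 < u ^ 3) by (apply pow_lt; lra).
(* [42124/10000] bounds [(4001/1000) / (94984/100000)], and the loss of relative order [1/u] is
   taken at [u = 115]. The values of [v] below are the resulting quotients, rounded up. *)
assert (Rec : forall j v, v * (159/100 - 42124/10000 * (INR j + 3) / 115) >= INR j + 1 -> 0 <= v ->
   moment f d (S (S j)) <= v * t ^ 3 * moment f d j).
{ intros j v Hv Hv0.
  assert (Q := moment_rec f (decay t K) s b d j ltac:(unfold d; lra) ltac:(unfold b; assert (0 < u ^ 5) by (apply pow_lt; lra); lra)
    Pf (fun x => continuous_decay t K x ltac:(lra)) (fun x => is_derive_modulus t K x ltac:(lra))).
  assert (Q' := Q ltac:(intros h Hh; apply decay_center; trivial) ltac:(rewrite Hs; lra)). clear Q.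
  rewrite Hs in Q'.
  assert (N2 := moment_nonneg f d (S (S j)) ltac:(unfold d; lra) Pf Cf).
  assert (N0 := moment_nonneg f d j ltac:(unfold d; lra) Pf Cf).
  assert (J : 0 <= INR j) by apply pos_INR.
  assert (L : (159/100 - 42124/10000 * (INR j + 3) / 115) * u ^ 3
      <= s - b * (INR j + 3) / (94984/100000 * u ^ 3)).
  { unfold s, b.
    replace (4001 / 1000 * u ^ 5 * (INR j + 3) / (94984 / 100000 * u ^ 3))
      with (4001/1000 * (100000/94984) * (INR j + 3) * u ^ 2) by (field; lra).
    assert ((INR j + 3) * u ^ 2 <= (INR j + 3) * (u ^ 3 / 115)).
    { apply Rmult_le_compat_l; [lra|]. simpl; nra. }
    assert (0 <= (INR j + 3) * u ^ 3) by (apply Rmult_le_pos; lra). lra. }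
  set (M2 := moment f d (S (S j))) in *. set (M0 := moment f d j) in *.
  set (q := 159/100 - 42124/10000 * (INR j + 3) / 115) in *.
  assert (Q1 : q * u ^ 3 * M2 <= (INR j + 1) * M0).
  { eapply Rle_trans; [|exact Q']. apply Rmult_le_compat_r; lra. }
  assert (Q2 : v * (q * M2) <= v * (t ^ 3 * ((INR j + 1) * M0))).
  { apply Rmult_le_compat_l; trivial.
    replace (q * M2) with (t ^ 3 * (q * u ^ 3 * M2)).
    - apply Rmult_le_compat_l; [apply pow_le; lra|exact Q1].
    - replace (t ^ 3 * (q * u ^ 3 * M2)) with (u ^ 3 * t ^ 3 * (q * M2)) by ring. rewrite ut3; ring. }
  assert (Q3 : (INR j + 1) * M2 <= v * q * M2) by (apply Rmult_le_compat_r; lra).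
  apply Rmult_le_reg_l with (INR j + 1); lra. }
assert (R0 := Rec 0%nat (677/1000) ltac:(simpl; lra) ltac:(lra)).
assert (R2 := Rec 2%nat (2136/1000) ltac:(simpl; lra) ltac:(lra)).
assert (R4 := Rec 4%nat (3756/1000) ltac:(simpl; lra) ltac:(lra)).
assert (R6 := Rec 6%nat (5567/1000) ltac:(simpl; lra) ltac:(lra)).
assert (R8 := Rec 8%nat (7604/1000) ltac:(simpl; lra) ltac:(lra)).
assert (T3 : 0 < t ^ 3) by (apply pow_lt; lra).
assert (Ch : forall a b x y z, x <= a * t ^ 3 * y -> y <= b * z -> 0 <= a -> x <= a * t ^ 3 * b * z).
{ intros a b' x y z Hx Hy Ha. eapply Rle_trans; [exact Hx|].
  rewrite (Rmult_assoc (a * t ^ 3)). apply Rmult_le_compat_l; [apply Rmult_le_pos; lra|exact Hy]. }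
assert (S4 := Ch _ _ _ _ _ R2 R0 ltac:(lra)).
assert (S6 := Ch _ _ _ _ _ R4 S4 ltac:(lra)).
assert (S8 := Ch _ _ _ _ _ R6 R4 ltac:(lra)).
assert (S10 := Ch _ _ _ _ _ R8 S8 ltac:(lra)).
(* [(503/100) / 6 * (100/92)], rounded up: the bound on [third] inserted in [phase_center]. *)
set (c := 9113/10000 * u ^ 4).
assert (Hps : forall h, 0 <= h <= d -> Rabs (ps h) <= c * h ^ 3).
{ intros h Hh. eapply Rle_trans; [apply phase_center; [lra|exact Hh]|].
  apply Rmult_le_compat_r; [apply pow_le; lra|].
  destruct (cumulant_estimates u K Hu Hr) as (_ & _ & Q). fold t in Q. unfold c.
  assert (0 < u ^ 4) by (apply pow_lt; lra). lra. }
assert (Hd : 0 < d <= 1 / 50) by (unfold d; lra).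
assert (c0 : 0 <= c) by (unfold c; assert (0 < u ^ 4) by (apply pow_lt; lra); lra).
assert (N4p : 0 < moment f d 4).
{ eapply Rlt_le_trans; [|exact M4]. apply Rmult_lt_0_compat; [lra|apply pow_lt; lra]. }
assert (Ec : c = 9113/10000 * / t ^ 4) by (unfold c, t; field; lra).
set (n4 := 2136/1000 * t ^ 3 * (677/1000 * t ^ 3)) in *.
set (n6 := 3756/1000 * t ^ 3 * n4) in *. set (n10 := 7604/1000 * t ^ 3 * (5567/1000 * t ^ 3 * (3756/1000 * t ^ 3))) in *.
assert (E1 : c ^ 2 / 2 * n10 = (9113/10000) ^ 2 / 2 * (7604/1000 * (5567/1000) * (3756/1000)) * t)
  by (rewrite Ec; unfold n10; field; lra).
assert (E2 : c ^ 2 / 2 * n6 = (9113/10000) ^ 2 / 2 * (3756/1000 * (2136/1000) * (677/1000)) * t)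
  by (rewrite Ec; unfold n6, n4; field; lra).
assert (E3 : 101/100 / d ^ 4 * (8/100) * n4 = 101/100 * (8/100) * (2136/1000 * (677/1000)) * (625/16) * t ^ 2)
  by (unfold d, n4; field; lra).
assert (E4 : c + 101/100 / d ^ 3 * (8/100) = (9113/10000 + 101/100 * (8/100) * (125/8) * t) * / t ^ 4)
  by (rewrite Ec; unfold d; field; lra).
assert (E5 : c / 2 * n6 + 101/100 / (2 * d) * (8/100) * n4
   = (9113/20000 * (3756/1000 * (2136/1000) * (677/1000)) + 101/100 * (8/100) * (5/4) * (2136/1000 * (677/1000))) * t ^ 5)
  by (rewrite Ec; unfold n6, n4, d; field; lra).
assert (E6 : c / 2 * (3756/1000 * t ^ 3) + 101/100 / (2 * d) * (8/100)
   = (9113/20000 * (3756/1000) + 101/100 * (8/100) * (5/4)) * / t) by (rewrite Ec; unfold d; field; lra).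
assert (t2 : 0 < t ^ 2 <= / 115 * t) by (split; [apply pow_lt; lra|simpl; nra]).
assert (t4 : 0 < t ^ 4 <= / 115 * t).
{ split; [apply pow_lt; lra|]. replace (t ^ 4) with (t ^ 2 * t ^ 2) by ring. nra. }
assert (n4b : 0 < n4 <= / 100 * t).
{ unfold n4. replace (2136/1000 * t ^ 3 * (677/1000 * t ^ 3)) with (2136/1000 * (677/1000) * (t ^ 4 * t ^ 2)) by ring.
  split; [apply Rmult_lt_0_compat; [lra|]; apply Rmult_lt_0_compat; lra|]. nra. }
apply (form_positive f ps c d (8/100) n4 n6 n10 (3756/1000 * t ^ 3) Hd c0 ltac:(lra) Pf Cf Cps Hps HT N4p S4 S6 R4 S10).
- rewrite E1; simpl; lra.
- rewrite E1, E2, E3, E4, E5, E6.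
  set (k5 := 9113/20000 * _ + _). set (k6 := 9113/20000 * _ + _).
  replace (8 * ((9113/10000 + 101/100 * (8/100) * (125/8) * t) * / t ^ 4) * (k5 * t ^ 5))
    with (8 * k5 * (9113/10000 * t + 101/100 * (8/100) * (125/8) * t ^ 2)) by (field; lra).
  replace (4 * (k5 * t ^ 5) * (k6 * / t)) with (4 * k5 * k6 * t ^ 4) by (field; lra).
  unfold k5, k6. clear k5 k6.
  (* At [t = 1/115] the error side stays below [18/100], while the two factors are at least [34/100]
     and [97/100]. The largest loss is [c^2 n10 / 2], about [66 t], in the first factor. *)
  apply Rlt_trans with (18/100); [lra|].
  apply Rlt_le_trans with (34/100 * (97/100)); [lra|].
  apply Rmult_le_compat; lra.
Qed.

(** * Choice of the saddle point *)

(** With [z = exp (-1/M)], [x <= exp x] at [x = K / (4M)] gives [z^K K^4 <= (4M)^4], so [rem] is of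
    order [1/K]. *)
Lemma rem_small (M : R) (n : nat) : 1 <= M ->
  exists K, (n <= K)%nat /\ rem (exp (- / M)) K <= 1 / 1000.
Proof.
intros HM.
assert (HI : 0 < / M) by (apply Rinv_0_lt_compat; lra).
assert (Hz := exp_neg_lt_1 (/ M) HI). set (z := exp (- / M)) in *.
set (C := 24 / (1 - z) ^ 5).
assert (HC : 0 < C) by (apply Rdiv_lt_0_compat; [lra|apply pow_lt; lra]).
(* [2048000 = 1000 * 8 * 4^4], where 8 comes from [(K + 1)^3 <= 8 K^3]. *)
destruct (nfloor_ex (2048000 * M ^ 4 * C)) as [k [_ Hk]].
{ apply Rmult_le_pos; [|lra]. apply Rmult_le_pos; [lra|apply pow_le; lra]. }
exists (S k + n)%nat; split; [lia|].
set (K := (S k + n)%nat).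
assert (HK : 2048000 * M ^ 4 * C <= INR K).
{ unfold K; rewrite plus_INR, S_INR. assert (0 <= INR n) by apply pos_INR. lra. }
assert (HK1 : 1 <= INR K) by (apply (le_INR 1); unfold K; lia).
unfold rem; fold C.
assert (E : z ^ K * INR K ^ 4 <= (4 * M) ^ 4).
{ assert (Q : z ^ K = exp (- (INR K / (4 * M))) ^ 4).
  { unfold z; rewrite !exp_pow_nat; f_equal; simpl; field; lra. }
  rewrite Q, <- Rpow_mult_distr. apply pow_incr.
  assert (P := exp_pos (- (INR K / (4 * M)))). split; [apply Rmult_le_pos; lra|].
  assert (Q1 := exp_ineq1_le (INR K / (4 * M))). rewrite exp_Ropp in *.
  set (e := exp (INR K / (4 * M))) in *.
  assert (0 < e) by apply exp_pos.
  apply Rmult_le_reg_l with e; [lra|].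
  replace (e * (/ e * INR K)) with (INR K / (4 * M) * (4 * M)) by (field; lra).
  apply Rmult_le_compat_r; lra. }
assert (K3 : (INR K + 1) ^ 3 <= 8 * INR K ^ 3).
{ replace (8 * INR K ^ 3) with ((2 * INR K) ^ 3) by ring. apply pow_incr; lra. }
assert (Zp : 0 < z ^ K) by (apply pow_lt; lra).
apply Rmult_le_reg_r with (INR K); [lra|].
apply Rle_trans with (8 * (z ^ K * INR K ^ 4) * C).
- replace (8 * (z ^ K * INR K ^ 4) * C) with (z ^ K * (8 * INR K ^ 3) * C * INR K) by ring.
  apply Rmult_le_compat_r; [lra|]. apply Rmult_le_compat_r; [lra|]. apply Rmult_le_compat_l; lra.
- apply Rle_trans with (8 * (4 * M) ^ 4 * C).
  + apply Rmult_le_compat_r; lra.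
  + replace (8 * (4 * M) ^ 4 * C) with (1 / 1000 * (2048000 * M ^ 4 * C)) by field.
    apply Rmult_le_compat_l; lra.
Qed.

Lemma continuous_mean (K : nat) (x : R) : continuous (fun t => mean t K) x.
Proof.
unfold mean; apply (continuous_sum1 (fun k t => INR k * (rk t k / (1 + rk t k)))); intros k _.
apply (ex_derive_continuous (fun t => INR k * (rk t k / (1 + rk t k)))).
unfold rk; auto_derive. assert (P := exp_pos (- (x * INR k))). lra.
Qed.

Lemma sum_id (n : nat) : sum1 (fun k => INR k / 4) n = INR n * (INR n + 1) / 8.
Proof.
induction n as [|n IH]; cbn [sum1]; [simpl; field|]. rewrite IH, S_INR; field.
Qed.

(** For [k <= n] one has [r_k >= exp (-1) >= 1/3], so each weight [r_k / (1 + r_k)] is at least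
    [1/4], and [n (n + 1) / 8 >= n] from [n = 7] on. *)
Lemma mean_lower (n K : nat) : (7 <= n <= K)%nat -> INR n <= mean (/ INR n) K.
Proof.
intros H. assert (Hn : 7 <= INR n) by (replace 7 with (INR 7) by (simpl; lra); apply le_INR; lia).
assert (HI : 0 < / INR n) by (apply Rinv_0_lt_compat; lra).
apply Rle_trans with (mean (/ INR n) n).
- apply Rle_trans with (sum1 (fun k => INR k / 4) n); [rewrite sum_id; nra|].
  assert (X : forall L, (L <= n)%nat -> sum1 (fun k => INR k / 4) L <= mean (/ INR n) L).
  { induction L as [|L IH]; intros HL; unfold mean; cbn [sum1]; [lra|].
    apply Rplus_le_compat; [apply IH; lia|].
    unfold Rdiv at 1; apply Rmult_le_compat_l; [apply pos_INR|].
    assert (Q : / 3 <= rk (/ INR n) (S L)).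
    { unfold rk. apply Rle_trans with (exp (- (1))).
      - rewrite exp_Ropp. apply Rinv_le_contravar; [apply exp_pos|apply exp_le_3].
      - apply exp_mono, Ropp_le_contravar.
        replace 1 with (/ INR n * INR n) by (field; lra).
        apply Rmult_le_compat_l; [lra|apply le_INR; lia]. }
    set (r := rk _ _) in *. apply Rmult_le_reg_r with (1 + r); [lra|].
    replace (r / (1 + r) * (1 + r)) with r by (field; lra). lra. }
  apply X; lia.
- unfold mean; apply sum1_le_length; [|lia]. intros k Hk.
  assert (R := rk_bounds (/ INR n) k HI Hk).
  apply Rmult_le_pos; [apply pos_INR|]. apply Rlt_le, Rdiv_lt_0_compat; lra.
Qed.

(** Intermediate values on [[1/n, 1/115]]: the mean is at least [n] on the left and at most [10980]
    on the right. To avoid a circular choice, [K] is fixed first for the slowest decay [t = 1/n];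
    monotonicity of [rem] then serves every [t] of the interval. *)
Lemma saddle_point (n : nat) : (11000 <= Z.of_nat n)%Z ->
  exists (K : nat) (u : R), (n + 2 <= K)%nat /\ 115 <= u /\ rem (exp (- / u)) K <= 1 / 1000
    /\ mean (/ u) K = INR n.
Proof.
intros Hn.
assert (Hn' : 11000 <= INR n) by (rewrite (INR_IZR_INZ n); apply IZR_le; lia).
destruct (rem_small (INR n) (n + 2) ltac:(lra)) as (K & HK & HR).
exists K.
assert (RM : forall x, / INR n <= x -> rem (exp (- x)) K <= 1 / 1000).
{ intros x Hx; eapply Rle_trans; [|exact HR].
  assert (0 < / INR n) by (apply Rinv_0_lt_compat; lra).
  apply rem_mono; [split; [apply exp_pos|apply exp_mono; lra]|apply exp_neg_lt_1; lra]. }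
assert (I : / INR n <= / 115) by (apply Rinv_le_contravar; lra).
assert (L := mean_lower n K ltac:(lia)).
assert (U := mean_upper K (RM _ I)).
destruct (IVT_gen (fun t => mean t K) (/ INR n) (/ 115) (INR n)) as (t & Ht & E).
- intros x; apply continuity_pt_filterlim, (continuous_mean K x).
- split; [apply Rle_trans with (2 := ltac:(lra) : 10980 <= INR n); eapply Rle_trans; [apply Rmin_r|exact U]|].
  eapply Rle_trans; [exact L|apply Rmax_l].
- rewrite Rmin_left, Rmax_right in Ht by exact I.
  assert (P : 0 < t) by (assert (0 < / INR n) by (apply Rinv_0_lt_compat; lra); lra).
  exists (/ t). rewrite Rinv_inv. repeat split; trivial.
  + replace 115 with (/ / 115) by field. apply Rinv_le_contravar; lra.
  + apply RM; lra.
Qed.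

(** The tilt contributes [exp (- t j)] to the coefficient at offset [j]. Offsets sum to zero in each
    product of the form, so these factors cancel and only a positive common square remains. *)
Lemma dcount_form_positive (n : nat) : (11000 <= Z.of_nat n)%Z -> exists K, (n + 2 <= K)%nat /\
  let a j := dcount K (Z.of_nat n + j) in
  (0 < a (-2) * a 2 - 4 * a (-1) * a 1 + 3 * a 0 ^ 2)%Z.
Proof.
intros Hn; destruct (saddle_point n Hn) as (K & u & HK & Hu & HR & HM).
exists K; split; trivial. intros a.
assert (P := harm_form_positive u K Hu HR). cbv zeta in P.
assert (Ht : 0 < / u) by (apply Rinv_0_lt_compat; lra).
assert (H : forall j : Z, harm (modulus (/ u) K) (fun h => phase (/ u) K h - mean (/ u) K * h) (IZR j)
   = PI / total (/ u) K * exp (- (/ u * INR n)) * exp (- (/ u * IZR j)) * IZR (a j)).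
{ intros j. unfold harm, a.
  transitivity (RInt (fun h => modulus (/ u) K h * cos (phase (/ u) K h - IZR (Z.of_nat n + j) * h)) 0 PI).
  - apply RInt_ext; intros h _. rewrite HM, plus_IZR, <- INR_IZR_INZ. do 2 f_equal.
    match goal with |- ?x = ?y => change (x = y :> R) end. ring.
  - rewrite RInt_polar by exact Ht. rewrite plus_IZR, <- INR_IZR_INZ.
    match goal with |- ?x = ?y => change (x = y :> R) end.
    replace (- (/ u * (INR n + IZR j))) with (- (/ u * INR n) + - (/ u * IZR j)) by ring.
    rewrite exp_plus; ring. }
rewrite (H (-2)%Z), (H 2%Z), (H (-1)%Z), (H 1%Z), (H 0%Z) in P.
set (C := PI / total (/ u) K * exp (- (/ u * INR n))) in *.
assert (E2 : exp (- (/ u * -2)) * exp (- (/ u * 2)) = 1).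
{ rewrite <- exp_plus; transitivity (exp 0); [f_equal; ring|apply exp_0]. }
assert (E1 : exp (- (/ u * -1)) * exp (- (/ u * 1)) = 1).
{ rewrite <- exp_plus; transitivity (exp 0); [f_equal; ring|apply exp_0]. }
assert (E0 : exp (- (/ u * 0)) = 1) by (transitivity (exp 0); [f_equal; ring|apply exp_0]).
apply lt_IZR.
rewrite !plus_IZR, !minus_IZR, !mult_IZR, Z.pow_2_r, mult_IZR.
rewrite E0 in P.
set (x2 := exp (- (/ u * -2))) in *. set (y2 := exp (- (/ u * 2))) in *.
set (x1 := exp (- (/ u * -1))) in *. set (y1 := exp (- (/ u * 1))) in *.
revert P; generalize (IZR (a (-2)%Z)), (IZR (a 2%Z)), (IZR (a (-1)%Z)), (IZR (a 1%Z)), (IZR (a 0%Z)); intros am2 a2 am1 a1 a0 P.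
replace (C * x2 * am2 * (C * y2 * a2) - 4 * (C * x1 * am1) * (C * y1 * a1) + 3 * (C * 1 * a0) ^ 2) with
  (C ^ 2 * ((x2 * y2) * am2 * a2 - 4 * (x1 * y1) * am1 * a1 + 3 * a0 ^ 2)) in P by ring.
rewrite E1, E2 in P.
assert (HC : 0 < C ^ 2).
{ apply pow_lt. apply Rmult_lt_0_compat; [|apply exp_pos].
  apply Rdiv_lt_0_compat; [apply PI_RGT_0|apply total_pos]. }
apply Rmult_lt_reg_l with (C ^ 2); [exact HC|]. rewrite Rmult_0_r.
eapply Rlt_le_trans; [exact P|]. right; ring.
Qed.

Close Scope R_scope.

(** * Exact computation *)

Lemma dcount_neg (K : nat) (z : Z) : (z < 0)%Z -> dcount K z = 0%Z.
Proof.
revert z; induction K as [|K IH]; intros z Hz; cbn [dcount].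
- destruct (Z.eqb_spec z 0); lia.
- rewrite !IH; lia.
Qed.

Lemma dcount_stable (K : nat) (z : Z) : (z <= Z.of_nat K)%Z -> dcount (S K) z = dcount K z.
Proof. intros H; cbn [dcount]; rewrite (dcount_neg K (z - _)); lia. Qed.

Lemma dcount_stable_le (K L : nat) (z : Z) : (z <= Z.of_nat K)%Z -> (K <= L)%nat -> dcount L z = dcount K z.
Proof.
intros H HL; induction HL as [|L HL IH]; trivial. rewrite dcount_stable; [exact IH|lia].
Qed.

(* Number of finite sets S of positive integers, all elements at most L, with
   [sum S + (k - 1) * max S = z], organised by the maximum. *)
Fixpoint by_max (k : Z) (L : nat) (z : Z) : Z :=
  match L with
  | O => if (z =? 0)%Z then 1%Z else 0%Z
  | S l => (by_max k l z + dcount l (z - k * Z.of_nat (S l)))%Z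
  end.

Lemma by_max_1 (L : nat) (z : Z) : by_max 1 L z = dcount L z.
Proof. induction L as [|L IH]; cbn [by_max dcount]; trivial. rewrite IH; do 2 f_equal; lia. Qed.

(** View the set as a partition whose largest part [M] occurs [k] times, and lower these copies by
    one. If [M - 1] was absent, it now occurs [k] times, otherwise [k + 1] times. For [z = k] the
    empty set is counted on both sides of this alternative, hence the correction. *)
Lemma by_max_step (k : Z) (L : nat) (z : Z) : (0 < z)%Z ->
  (by_max k (S L) z = by_max (k + 1) L (z - k) + by_max k L (z - k)
     - (if (z - k =? 0)%Z then 1 else 0))%Z.
Proof.
intros Hz; induction L as [|L IH].
- cbn [by_max dcount]. replace (z - k * Z.of_nat 1)%Z with (z - k)%Z by lia.
  destruct (Z.eqb_spec z 0); [lia|]. destruct (Z.eqb_spec (z - k) 0); lia.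
- cbn [by_max] in IH |- *; rewrite IH; cbn [dcount].
  replace (z - k * Z.of_nat (S (S L)) - Z.of_nat (S L))%Z
    with (z - k - (k + 1) * Z.of_nat (S L))%Z by lia.
  replace (z - k * Z.of_nat (S (S L)))%Z with (z - k - k * Z.of_nat (S L))%Z by lia. lia.
Qed.

Lemma by_max_stable (k : Z) (L M : nat) (z : Z) : (1 <= k)%Z -> (z <= Z.of_nat L)%Z -> (L <= M)%nat ->
  by_max k M z = by_max k L z.
Proof.
intros Hk Hz HM; induction HM as [|M HM IH]; trivial. cbn [by_max]. rewrite IH, dcount_neg; nia.
Qed.

Lemma by_max_small (k : Z) (L : nat) (z : Z) : (1 <= k)%Z -> (z < k)%Z ->
  by_max k L z = (if (z =? 0)%Z then 1 else 0)%Z.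
Proof.
intros Hk Hz; induction L as [|L IH]; cbn [by_max]; trivial. rewrite IH, dcount_neg; nia.
Qed.

(** For [k >= 1], by conjugation: partitions of [z] with smallest part [k] in which every integer
    from [k] to the largest part occurs, the empty one included. In [gap_step] one copy of the
    smallest part is removed. *)
Definition gap (k : nat) (z : Z) : Z := by_max (Z.of_nat k) (Z.to_nat z) z.

Lemma gap_step (k : nat) (z : Z) : (1 <= k)%nat -> (Z.of_nat k <= z)%Z ->
  gap k z = (gap (S k) (z - Z.of_nat k) + gap k (z - Z.of_nat k)
     - (if (z - Z.of_nat k =? 0)%Z then 1 else 0))%Z.
Proof.
intros Hk Hz; unfold gap.
rewrite <- (by_max_stable (Z.of_nat k) (Z.to_nat z) (S (Z.to_nat z))) by lia.
rewrite by_max_step by lia.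
rewrite (by_max_stable (Z.of_nat k) (Z.to_nat (z - Z.of_nat k)) (Z.to_nat z)) by lia.
replace (Z.of_nat k + 1)%Z with (Z.of_nat (S k)) by lia.
rewrite (by_max_stable (Z.of_nat (S k)) (Z.to_nat (z - Z.of_nat k)) (Z.to_nat z)) by lia.
reflexivity.
Qed.

Lemma gap_small (k : nat) (z : Z) : (z < Z.of_nat k)%Z -> gap k z = (if (z =? 0)%Z then 1 else 0)%Z.
Proof.
intros H; destruct k as [|k].
- unfold gap. replace (Z.to_nat z) with O by lia. reflexivity.
- apply by_max_small; lia.
Qed.

Lemma gap_1 (z : Z) : gap 1 z = dcount (Z.to_nat z) z.
Proof. apply by_max_1. Qed.

(* [queue ++ rev back] holds the last [k] outputs: output n is input n plus output n - k. *)
Fixpoint strided_sums (a queue back : list N) {struct a} : list N :=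
  match a with
  | [] => []
  | x :: a' =>
    match queue with
    | y :: queue' => let s := (x + y)%N in s :: strided_sums a' queue' (s :: back)
    | [] => match rev back with
            | y :: queue' => let s := (x + y)%N in s :: strided_sums a' queue' [s]
            | [] => []
            end
    end
  end.

(** The first [k] entries are [1, 0, .., 0], yet the queue starts with zeros only: replacing that 1
    by 0 realises the correction [- 1] of [gap_step] at [z = k]. *)
Definition gap_table_step (k : nat) (F : list N) : list N :=
  1%N :: repeat 0%N (k - 1) ++ strided_sums F (repeat 0%N k) [].

Fixpoint gap_table (k : nat) (F : list N) : list N :=
  match k with O => F | S k' => gap_table k' (gap_table_step k F) end.

Lemma strided_sums_length (a queue back : list N) :
  queue ++ rev back <> [] -> length (strided_sums a queue back) = length a.
Proof.
revert queue back; induction a as [|x a IH]; intros queue back H; simpl; trivial.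
destruct queue as [|y queue]; simpl.
- simpl in H; destruct (rev back) as [|y q]; [congruence|]. simpl; rewrite IH; trivial.
  destruct q; discriminate.
- rewrite IH; trivial. intros E; apply app_eq_nil in E; destruct E as [_ E].
  apply app_eq_nil in E; destruct E; discriminate.
Qed.

(** Only the concatenation [queue ++ rev back] matters: a step removes its head and appends the new
    output, whether or not the buffer is reversed. *)
Lemma strided_sums_nth (a queue back : list N) (i : nat) :
  queue ++ rev back <> [] -> (i < length a)%nat ->
  nth i (strided_sums a queue back) 0%N =
  (nth i a 0 + nth i (queue ++ rev back ++ strided_sums a queue back) 0)%N.
Proof.
revert queue back i; induction a as [|x a IH]; intros queue back i H Hi; [simpl in Hi; lia|].
assert (X : forall y q q' b', queue ++ rev back = y :: q -> q' ++ rev b' = q ++ [(x + y)%N] ->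
   strided_sums (x :: a) queue back = (x + y)%N :: strided_sums a q' b' ->
   nth i (strided_sums (x :: a) queue back) 0%N =
   (nth i (x :: a) 0 + nth i (queue ++ rev back ++ strided_sums (x :: a) queue back) 0)%N).
{ intros y q q' b' E1 E2 E3. rewrite app_assoc, E1, E3.
  destruct i as [|i]; [reflexivity|]. cbn [nth app].
  rewrite IH; [|rewrite E2; destruct q; discriminate|simpl in Hi; lia].
  rewrite app_assoc, E2, <- app_assoc. reflexivity. }
destruct queue as [|y queue].
- destruct (rev back) as [|y q] eqn:E; [simpl in H; congruence|].
  apply (X y q q [(x + y)%N]); rewrite ?E; trivial. simpl; rewrite E; reflexivity.
- apply (X y (queue ++ rev back) queue ((x + y)%N :: back)); trivial.
  simpl; rewrite app_assoc; reflexivity.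
Qed.

Definition tabulates (l : list N) (g : Z -> Z) : Prop :=
  forall i, (i < length l)%nat -> Z.of_N (nth i l 0%N) = g (Z.of_nat i).

Lemma gap_table_step_spec (k : nat) (F : list N) : (1 <= k)%nat -> tabulates F (gap (S k)) ->
  tabulates (gap_table_step k F) (gap k) /\ length (gap_table_step k F) = (k + length F)%nat.
Proof.
intros Hk HF; unfold gap_table_step.
set (o := strided_sums F (repeat 0%N k) []).
assert (Q : repeat 0%N k ++ rev (@nil N) <> []) by (destruct k; [lia|discriminate]).
assert (L : length o = length F) by (apply strided_sums_length, Q).
assert (HL : length (1%N :: repeat 0%N (k - 1) ++ o) = (k + length F)%nat).
{ simpl; rewrite length_app, repeat_length, L; lia. }
split; [|exact HL].
assert (O : forall i, nth (k + i) (1%N :: repeat 0%N (k - 1) ++ o) 0%N = nth i o 0%N).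
{ intros i; replace (k + i)%nat with (S (k - 1 + i)) by lia. cbn [nth].
  rewrite app_nth2; rewrite repeat_length; [f_equal; lia|lia]. }
assert (S0 : forall i, (i < k)%nat ->
   Z.of_N (nth i (1%N :: repeat 0%N (k - 1) ++ o) 0%N) = (if (Z.of_nat i =? 0)%Z then 1 else 0)%Z).
{ intros i Hi; destruct i as [|i]; [reflexivity|]. cbn [nth].
  rewrite app_nth1 by (rewrite repeat_length; lia). rewrite nth_repeat.
  destruct (Z.eqb_spec (Z.of_nat (S i)) 0); [lia|reflexivity]. }
intros n; induction n as [n IH] using lt_wf_ind; intros Hn.
destruct (Nat.lt_ge_cases n k) as [H|H].
- rewrite gap_small by lia. apply S0, H.
- replace n with (k + (n - k))%nat at 1 by lia. rewrite O.
  set (i := (n - k)%nat). rewrite HL in Hn.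
  unfold o; rewrite strided_sums_nth by (trivial; lia). fold o.
  rewrite N2Z.inj_add, HF by lia. rewrite (gap_step k (Z.of_nat n)) by lia.
  replace (Z.of_nat n - Z.of_nat k)%Z with (Z.of_nat i) by lia.
  rewrite <- (IH i) by lia. cbn [rev app].
  destruct (Nat.lt_ge_cases i k) as [Hi|Hi].
  + rewrite app_nth1 by (rewrite repeat_length; exact Hi). rewrite nth_repeat, S0 by exact Hi. simpl; lia.
  + rewrite app_nth2 by (rewrite repeat_length; exact Hi). rewrite repeat_length.
    assert (O' := O (i - k)%nat). replace (k + (i - k))%nat with i in O' by lia. rewrite O'.
    destruct (Z.eqb_spec (Z.of_nat i) 0); lia.
Qed.

Lemma gap_table_spec (k : nat) (F : list N) : tabulates F (gap (S k)) ->
  tabulates (gap_table k F) (fun z => dcount (Z.to_nat z) z) /\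
  (2 * length (gap_table k F) = 2 * length F + k * (k + 1))%nat.
Proof.
revert F; induction k as [|k IH]; intros F HF.
- cbn [gap_table]; split; [|lia]. intros i Hi; rewrite HF by exact Hi. apply gap_1.
- destruct (gap_table_step_spec (S k) F ltac:(lia) HF) as [H1 H2].
  destruct (IH _ H1) as [H3 H4]. cbn [gap_table]; split; [exact H3|]. rewrite H4, H2; lia.
Qed.

Lemma gap_table_start (k r : nat) : (r <= k)%nat -> tabulates (1%N :: repeat 0%N r) (gap (S k)).
Proof.
intros Hr i Hi; simpl in Hi; rewrite repeat_length in Hi. rewrite gap_small by lia.
destruct i as [|i]; [reflexivity|]. cbn [nth]; rewrite nth_repeat.
destruct (Z.eqb_spec (Z.of_nat (S i)) 0); [lia|reflexivity].
Qed.

(* Only the 50 leading bits are multiplied; [u] accounts for the discarded ones. *)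
Definition window_ok (a b c d e : N) : bool :=
  let s := (N.size c - 50)%N in
  let u := if (s =? 0)%N then 0%N else 1%N in
  (4 * ((N.shiftr b s + u) * (N.shiftr d s + u)) <?
   N.shiftr a s * N.shiftr e s + 3 * (N.shiftr c s * N.shiftr c s))%N.

Fixpoint windows_ok (l : list N) : bool :=
  match l with
  | a :: ((b :: c :: d :: e :: _) as l') => if window_ok a b c d e then windows_ok l' else false
  | _ => true
  end.

(** [a], [c], [e] are rounded down and [b], [d] up to multiples of [2^s], so the tested inequality,
    multiplied by [2^(2s)], implies the exact one. *)
Lemma window_ok_spec (a b c d e : N) : window_ok a b c d e = true ->
  (4 * (b * d) < a * e + 3 * (c * c))%N.
Proof.
unfold window_ok; rewrite N.ltb_lt. set (s := (N.size c - 50)%N); clearbody s.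
intros H.
assert (P : (0 < 2 ^ s)%N) by (apply N.neq_0_lt_0, N.pow_nonzero; lia).
assert (L : forall x, (N.shiftr x s * 2 ^ s <= x)%N).
{ intros x; rewrite N.shiftr_div_pow2, N.mul_comm. apply N.Div0.mul_div_le. }
assert (U : forall x, (x <= (N.shiftr x s + (if (s =? 0)%N then 0 else 1)) * 2 ^ s)%N).
{ intros x; destruct (N.eqb_spec s 0) as [Hs|Hs].
  - rewrite Hs, N.shiftr_0_r; simpl; lia.
  - rewrite N.shiftr_div_pow2. assert (Q := N.mul_succ_div_gt x (2 ^ s) ltac:(lia)). nia. }
assert (La := L a). assert (Le := L e). assert (Lc := L c). assert (Ub := U b). assert (Ud := U d).
set (u := if (s =? 0)%N then 0%N else 1%N) in *.
set (p := (2 ^ s)%N) in *. clearbody u p.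
generalize dependent (N.shiftr a s); intros a'. generalize dependent (N.shiftr b s); intros b'.
generalize dependent (N.shiftr c s); intros c'. generalize dependent (N.shiftr d s); intros d'.
generalize dependent (N.shiftr e s); intros e'. intros.
assert (E1 : (b * d <= (b' + u) * (d' + u) * (p * p))%N).
{ apply N.le_trans with ((b' + u) * p * ((d' + u) * p))%N; [apply N.mul_le_mono; assumption|lia]. }
assert (E2 : (a' * e' * (p * p) <= a * e)%N).
{ apply N.le_trans with (a' * p * (e' * p))%N; [lia|apply N.mul_le_mono; assumption]. }
assert (E3 : (c' * c' * (p * p) <= c * c)%N).
{ apply N.le_trans with (c' * p * (c' * p))%N; [lia|apply N.mul_le_mono; assumption]. }
assert (Q : (0 < p * p)%N) by lia.
assert (E4 := proj1 (N.mul_lt_mono_pos_r (p * p) _ _ Q) H). lia.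
Qed.

Lemma windows_ok_spec (l : list N) (i : nat) : windows_ok l = true -> (i + 4 < length l)%nat ->
  let x j := nth (i + j) l 0%N in (4 * (x 1%nat * x 3%nat) < x 0%nat * x 4%nat + 3 * (x 2%nat * x 2%nat))%N.
Proof.
revert i; induction l as [|a l IH]; intros i H Hi; [simpl in Hi; lia|].
destruct l as [|b [|c [|d [|e l]]]]; try (simpl in Hi; lia).
change ((if window_ok a b c d e then windows_ok (b :: c :: d :: e :: l) else false) = true) in H.
destruct (window_ok a b c d e) eqn:W; [|discriminate].
destruct i as [|i]; [apply window_ok_spec, W|].
apply (IH i H). simpl in Hi |- *; lia.
Qed.

(** The seed of 124 entries is trivially correct for [k = 148], and the pass for [k] adds [k]
    entries: [124 + 147 * 148 / 2 = 11002], so indices reach [11001], that is [m + 2] for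
    [m = 10999]. *)
Definition q_table : list N := gap_table 147 (1%N :: repeat 0%N 123).

Lemma q_table_ok : windows_ok (skipn 229 q_table) = true.
Proof. vm_cast_no_check (eq_refl true). Qed.

Lemma dcount_form_positive_small (n : nat) : (231 <= n)%nat -> (Z.of_nat n < 11000)%Z ->
  let a j := dcount (Z.to_nat (Z.of_nat n + j)) (Z.of_nat n + j) in
  (0 < a (-2) * a 2 - 4 * a (-1) * a 1 + 3 * a 0 ^ 2)%Z.
Proof.
intros H1 H2 a.
destruct (gap_table_spec 147 _ (gap_table_start 147 123 ltac:(lia))) as [T L].
fold q_table in T, L.
assert (L' : Z.of_nat (length q_table) = 11002%Z).
{ apply (f_equal Z.of_nat) in L. rewrite length_cons, repeat_length in L. lia. }
clear L.
(* The window centred at [n] starts at [n - 2]; the first one tested, at index 229, is centred at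
   231. *)
assert (W := windows_ok_spec _ (n - 231) q_table_ok). rewrite length_skipn in W.
assert (W' := W ltac:(lia)); clear W; cbv beta zeta in W'.
rewrite !nth_skipn in W'.
assert (X : forall j i, Z.of_nat i = (Z.of_nat n + j)%Z -> (j <= 2)%Z -> Z.of_N (nth i q_table 0%N) = a j).
{ intros j i Hi Hj; rewrite T by lia. unfold a; rewrite Hi; reflexivity. }
rewrite <- (X (-2)%Z (229 + (n - 231 + 0))%nat), <- (X (-1)%Z (229 + (n - 231 + 1))%nat),
  <- (X 0%Z (229 + (n - 231 + 2))%nat), <- (X 1%Z (229 + (n - 231 + 3))%nat),
  <- (X 2%Z (229 + (n - 231 + 4))%nat) by lia.
rewrite Z.pow_2_r. lia.
Qed.

Lemma dcount_quartic_form (f : nat -> nat) : (forall n, Z.of_nat (f n) = dcount n (Z.of_nat n)) ->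
  forall n, (230 <= n)%nat ->
  (4 * (f n * f (n + 2)) < f (n - 1) * f (n + 3) + 3 * (f (n + 1) * f (n + 1)))%nat.
Proof.
intros Hf n Hn.
set (a j := dcount (Z.to_nat (Z.of_nat (n + 1) + j)) (Z.of_nat (n + 1) + j)).
assert (F : forall k j, Z.of_nat k = (Z.of_nat (n + 1) + j)%Z -> a j = Z.of_nat (f k)).
{ intros k j E; unfold a; rewrite <- E, Nat2Z.id, Hf; reflexivity. }
assert (P : (0 < a (-2) * a 2 - 4 * a (-1) * a 1 + 3 * a 0 ^ 2)%Z).
{ destruct (Z.lt_ge_cases (Z.of_nat (n + 1)) 11000) as [H|H].
  - apply (dcount_form_positive_small (n + 1)); lia.
  - destruct (dcount_form_positive (n + 1) H) as (K & HK & P); cbv beta zeta in P.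
    (* Since [K >= n + 3], parts beyond the partitioned number do not contribute and the common
       cutoff [K] can be replaced by that number. *)
    assert (S : forall j, (-2 <= j <= 2)%Z -> dcount K (Z.of_nat (n + 1) + j) = a j)
      by (intros j Hj; apply dcount_stable_le; lia).
    rewrite !S in P by lia. exact P. }
rewrite (F (n - 1) (-2)%Z), (F (n + 3) 2%Z), (F n (-1)%Z), (F (n + 2) 1%Z), (F (n + 1) 0%Z)
  in P by lia.
rewrite Z.pow_2_r in P. lia.
Qed.

(** * Partitions into distinct parts *)

Require Import Defs.
From mathcomp Require Import all_boot all_order all_algebra zify.

Import Order.TTheory GRing.Theory Num.Theory.
Local Open Scope ring_scope.

(** The generating polynomial of subsets of [{1, .., N}], indexed by ['I_N.+1] to match the type of
    the parts. Index 0 contributes the summand 0 when chosen, so sets containing it vanish. *)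
Definition distinct_poly (N : nat) : {poly nat} :=
  \prod_(i < N.+1) ((if i == ord0 then 0 else 'X^i) + 1).

Lemma coef_distinct_poly (N n : nat) :
  (distinct_poly N)`_n =
  #|[set P : {set 'I_N.+1} | (ord0 \notin P) && (\sum_(i in P) i == n)%N]|.
Proof.
rewrite /distinct_poly bigA_distr coef_sum -sum1dep_card [RHS]big_mkcond /=.
apply: eq_bigr => J _.
have [J0 | J0] := boolP (ord0 \in J).
  by rewrite (bigD1 ord0) //= J0 mul0r coef0.
have -> : \prod_i (if i \in J then if i == ord0 then 0 else 'X^i else 1)
          = 'X^(\sum_(i in J) i) :> {poly nat}.
  rewrite -big_mkcond /= (big_morph _ (exprD _) (expr0 _)).
  by apply: eq_bigr => i iJ; case: eqP iJ J0 => // -> ->.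
by rewrite coefXn eq_sym /=; case: eqP.
Qed.

(** Multiplication by [1 + X^(N+1)] is the recursion of [dcount]; a coefficient of negative index is
    0 on one side by [coefMXn], on the other by [dcount_neg]. *)
Lemma coef_distinct_poly_dcount (N n : nat) :
  Z.of_nat (((distinct_poly N)`_n)%R) = dcount N (Z.of_nat n).
Proof.
elim: N n => [|N IH] n.
  rewrite /distinct_poly big_ord1 add0r coef1 /=.
  by case: n.
have -> : distinct_poly N.+1 = distinct_poly N + distinct_poly N * 'X^(N.+1).
  rewrite {1}/distinct_poly big_ord_recr /= mulrDr mulr1 [LHS]addrC.
  suff -> : \prod_(i < N.+1) ((if widen_ord (leqnSn N.+1) i == ord0 then 0 else 'X^i) + 1)
            = distinct_poly N by [].
  by apply: eq_bigr => i _; rewrite -!val_eqE.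
rewrite coefD coefMXn; cbn [dcount].
case: ltnP => h.
  rewrite (dcount_neg N (Z.sub _ _)); last by lia.
  by rewrite -IH; lia.
by rewrite -IH -Nat2Z.inj_sub ?Nat2Z.inj_add ?IH //; lia.
Qed.

Lemma q_dcount (n : nat) : Z.of_nat (q n) = dcount n (Z.of_nat n).
Proof. by rewrite -coef_distinct_poly_dcount coef_distinct_poly. Qed.

Theorem theorem1p2 (n : nat) (hn : (230 <= n)%N) :
  0 < A (q (n - 1))%:Z (q n)%:Z (q (n + 1))%:Z (q (n + 2))%:Z (q (n + 3))%:Z.
Proof.
have := dcount_quartic_form q q_dcount n (elimT ssrnat.leP hn).
rewrite /A expr2 -[4]/(4%:Z) -[3]/(3%:Z) -!PoszM addrAC subr_gt0 -PoszD ltz_nat.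
by move=> h; apply/ssrnat.ltP; rewrite -mulnA.
Qed.
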